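(* Let $\phi \colon \Gamma' \rightarrow \Gamma$ be an infinite Galois covering of a compact metric graph $\Gamma$. Then $$\mu_{\phi, \mathrm{can}}(\Gamma)=g(\Gamma)-1 = -\chi(\Gamma),$$ where $\mu_{\phi,\mathrm{can}}$ is the pushdown to $\Gamma$ of the canonical measure of $\Gamma'$.
   Context: Metric graphs. A metric graph is a connected metric space $\Gamma$ such that, for some fixed $\epsilon>0$, every point has a neighborhood isometric to a star-shaped set $S(n,r)=\{te^{2\pi i k/n} : 0\le t<r,\ k\in\mathbb{Z}\}\subset\mathbb{C}$ of finite valence $n$ and radius $r\geq\epsilon$, endowed with the path metric. $\Gamma$ need not be compact. A vertex set is a discrete subset $V\subset\Gamma$ containing all points of valence $\neq 2$ such that every connected component of $\Gamma\setminus V$ is isometric (in its path metric) to a bounded open interval. It determines a model $G$: the weighted graph with vertex set $V(G)=V$, edge set $E(G)$ the set of components of $\Gamma\setminus V$, and $\ell(e)>0$ the length of the edge $e$ (loops and multiple edges are allowed). $\mathbb{E}(G)$ is the set of oriented edges; each edge has two orientations $e,\bar e\in\mathbb{E}(G)$; $e^-$ and $e^+$ are the initial and terminal vertices of $e$. An orientation $\mathcal{O}\subset\mathbb{E}(G)$ selects one orientation of each edge. The genus $g(\Gamma)$ is the dimension of the first homology of $\Gamma$, and $\chi(\Gamma)=1-g(\Gamma)$. Forms. $C^1(G,\mathbb{R})$ is the space of functions $\omega:\mathbb{E}(G)\to\mathbb{R}$ with $\omega(\bar e)=-\omega(e)$; put $\omega_e=\omega(e)/\ell(e)$, and let $de\in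 C^1(G,\mathbb{R})$ be defined by $(de)(e)=\ell(e)$ and $(de)(e')=0$ for $e'\in\mathcal{O}$, $e'\ne e$. The (partially defined) pairing is $\langle\omega,\omega'\rangle=\sum_{e\in\mathcal{O}}\omega_e\omega'_e\ell(e)$, and $C^1_{L^2}(G,\mathbb{R})=\{\omega : \langle\omega,\omega\rangle<\infty\}$ is a Hilbert space. A form is harmonic if for every $v\in V(G)$, $\sum_{e\in\mathcal{O},\,e^+=v}\omega_e-\sum_{e\in\mathcal{O},\,e^-=v}\omega_e=0$. The harmonic $L^2$ forms form a closed subspace $\mathcal{H}_{L^2}(\Gamma)$ of $C^1_{L^2}(G,\mathbb{R})$; when models are refined (edges subdivided, keeping the values $\omega_e$ on the pieces) this space does not change. Canonical measure. The canonical measure $\mu^{\Gamma}_{\mathrm{can}}$ is the Borel measure on $\Gamma$ which on each edge of a model $G$ is a constant multiple of Lebesgue measure $dx$, with $\mu^\Gamma_{\mathrm{can}}(e)=(\pi(de))_e=\frac{1}{\ell(e)}\langle\pi(de),de\rangle$, where $\pi$ is the orthogonal projection onto $\mathcal{H}_{L^2}(\Gamma)$. It is independent of the model and orientation and invariant under isometries. Covers. A covering map of metric spaces is a continuous map $Y\to X$ such that every point of $X$ has an open neighborhood $U$ whose preimage is a disjoint union of open sets each sent isometrically onto $U$. For path-connected spaces the cover is Galois if the image of $\pi_1(Y)$ in $\pi_1(X)$ is a normal subgroup. For a Galois cover $\phi:\Gamma'\to\Gamma$, $\mu_{\phi,\mathrm{can}}$ (the pushdown of $\mu^{\Gamma'}_{\mathrm{can}}$)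 is the measure on $\Gamma$ whose density on each edge $e$ of a model $G$ of $\Gamma$ is constant and with $\mu_{\phi,\mathrm{can}}(e)=\mu^{\Gamma'}_{\mathrm{can}}(e')$ for any lift $e'$ of $e$ to $\Gamma'$. *)

(* Defs.v *)
From HB Require Import structures.
From mathcomp Require Import all_boot all_order all_algebra.
From mathcomp Require Import all_classical all_reals all_analysis.

Set Implicit Arguments.
Unset Strict Implicit.
Unset Printing Implicit Defensive.

Import Order.TTheory GRing.Theory Num.Theory.
Import numFieldTopology.Exports numFieldNormedType.Exports.

Local Open Scope classical_set_scope.
Local Open Scope ring_scope.

(* The measure theory of the library is developed on pointed types; the base
   point plays no role below. *)
#[short(type="pmetricType")]
HB.structure Definition PointedMetric (K : numDomainType) :=
  {M of Metric K M & isPointed M}.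

Section MetricGraphs.
Context {R : realType}.

(** Paths are functions [R -> X] of which only the restriction to [0, 1]
    matters. *)
Definition is_path (X : topologicalType) (x y : X) (p : R -> X) : Prop :=
  [/\ {within `[0, 1], continuous p}, p 0 = x & p 1 = y].

Definition path_length (X : metricType R) (p : R -> X) : \bar R :=
  ereal_sup [set (\sum_(0 <= i < size s)
                    mdist (p (nth 1 (0 :: s) i)) (p (nth 1 (0 :: s) i.+1)))%:E
            | s in itv_partition (0 : R) 1].

Definition path_dist (X : metricType R) (A : set X) (x y : X) : \bar R :=
  ereal_inf [set path_length p
            | p in [set p | is_path x y p /\ p @` `[0, 1] `<=` A]].

(** The star S(n,r) in polar coordinates: a pair (k, t) with k < n, 0 <= t < r
    stands for the point t e^{2 pi i k / n}, and the path metric of the star is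
    |s - t| on a common ray and s + t across the origin.  [star_chart n r x U p]
    says that p parametrizes U isometrically by S(n,r), the origin going to x.
    S(0,r) is a single point. *)
Definition star_dist (n : nat) (k l : 'I_n) (s t : R) : R :=
  if k == l then `|s - t| else s + t.

Definition star_chart (X : metricType R) (n : nat) (r : R) (x : X) (U : set X)
    (p : 'I_n -> R -> X) : Prop :=
  [/\ forall k, p k 0 = x,
      U = [set x] `|` \bigcup_(k in [set: 'I_n]) (p k @` `[0, r[) &
      forall k l s t, `[0, r[%classic s -> `[0, r[%classic t ->
        mdist (p k s) (p l t) = star_dist k l s t].

(** A point need not be the origin of the star around it: only so can r >= eps
    hold uniformly near a branch point. *)
Definition metric_graph (X : metricType R) : Prop :=
  [/\ [set: X] !=set0, connected [set: X] &
      exists2 eps : R, 0 < eps &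
        forall x : X, exists n r x0 U, exists p : 'I_n -> R -> X,
          [/\ eps <= r, open U, U x & star_chart r x0 U p]].

Definition valence (X : metricType R) (x : X) (n : nat) : Prop :=
  exists r U, exists p : 'I_n -> R -> X,
    [/\ 0 < r, open U & star_chart r x U p].

(** [c] is an isometry from the interval ]0, l[ onto [A] for the path metric
    of [A]. *)
Definition open_arc (X : metricType R) (A : set X) (l : R) (c : R -> X) : Prop :=
  [/\ 0 < l, c @` `]0, l[ = A &
      forall s t, `]0, l[%classic s -> `]0, l[%classic t ->
        path_dist A (c s) (c t) = `|s - t|%:E].

Definition vertex_set (X : metricType R) (V : set X) : Prop :=
  [/\ V `<=` isolated V,
      forall x n, valence x n -> n <> 2%N -> V x &
      forall x, ~ V x ->
        exists l c, open_arc (connected_component (~` V) x) l c].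

(** Oriented edges of the model with vertex set [V].  The two orientations of
    an edge e of length l are its two isometric parametrizations by ]0, l[;
    extending them continuously to R, by constants outside ]0, l[, makes each
    of them a single function R -> X, with initial vertex its value at 0 and
    terminal vertex its value at l. *)
Record oedge (X : metricType R) (V : set X) := OEdge {
  elen : R;
  epar : R -> X;
  epar_cont : continuous epar;
  epar_le0 : forall t, t <= 0 -> epar t = epar 0;
  epar_ge : forall t, elen <= t -> epar t = epar elen;
  epar_arc : open_arc (epar @` `]0, elen[) elen epar;
  epar_comp : exists2 x, ~ V x &
    epar @` `]0, elen[ = connected_component (~` V) x;
  epar_init : V (epar 0);
  epar_term : V (epar elen)
}.

HB.instance Definition _ (X : metricType R) (V : set X) :=
  gen_eqMixin (oedge V).
HB.instance Definition _ (X : metricType R) (V : set X) :=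
  gen_choiceMixin (oedge V).

Section Model.
Context {X : metricType R} {V : set X}.
Implicit Types (e : oedge V) (O : set (oedge V)) (w : oedge V -> R).

Definition einit e : X := epar e 0.
Definition eterm e : X := epar e (elen e).
Definition eset e : set X := epar e @` `]0, elen e[.

Lemma rev_itv e t : `]0, elen e[%classic t -> `]0, elen e[%classic (elen e - t).
Proof.
rewrite /= !in_itv /= => /andP[t0 tl]; apply/andP; split.
  by rewrite subr_gt0.
by rewrite ltrBlDr ltrDl.
Qed.

Lemma rev_image e :
  (fun t => epar e (elen e - t)) @` `]0, elen e[ = epar e @` `]0, elen e[.
Proof.
apply/seteqP; split => x /= [t tI <-].
  by exists (elen e - t) => //; exact: rev_itv.
by exists (elen e - t); [exact: rev_itv | rewrite opprB addrC subrK].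
Qed.

Definition erev (e : oedge V) : oedge V.
Proof.
apply: (@OEdge X V (elen e) (fun t => epar e (elen e - t))).
- move=> t; apply: (@continuous_comp _ _ _ (fun t => elen e - t) (epar e)).
    by apply: cvgB; [exact: cvg_cst | exact: cvg_id].
  exact: epar_cont.
- move=> t t0; rewrite subr0 epar_ge//.
  by rewrite lerBrDr gerDl.
- by move=> t lt; rewrite subrr epar_le0// subr_le0.
- have [l0 _ iso] := epar_arc e; rewrite rev_image; split => //.
    exact: rev_image.
  move=> s t sI tI; rewrite iso; [|exact: rev_itv|exact: rev_itv].
  by rewrite opprB addrC addrA subrK distrC.
- have [x Vx Ex] := epar_comp e.
  by exists x => //; rewrite rev_image.
- by rewrite subr0; exact: epar_term.
- by rewrite subrr; exact: epar_init.
Defined.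

Definition orientation O : Prop := forall e, O e <-> ~ O (erev e).

Definition form w : Prop := forall e, w (erev e) = - w e.

Definition dens w e : R := w e / elen e.

Definition dform (e0 : oedge V) : oedge V -> R := fun e =>
  if e == e0 then elen e0 else if e == erev e0 then - elen e0 else 0.

(** Extended-real value of the sum over O of w_e w'_e l(e); it is meaningful
    when the sum is absolutely convergent or of constant sign. *)
Definition pairing O w w' : \bar R :=
  let f := fun e => (dens w e * dens w' e * elen e)%:E in
  (esum O f^\+ - esum O f^\-)%E.

Definition L2form O w : Prop := form w /\ (pairing O w w < +oo)%E.

Definition harmonic O w : Prop := forall v, V v ->
  \sum_(e \in [set e | O e /\ eterm e = v]) dens w e
  - \sum_(e \in [set e | O e /\ einit e = v]) dens w e = 0.

Definition L2harmonic O w : Prop := L2form O w /\ harmonic O w.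

(** Orthogonal projection onto the L^2 harmonic forms, by its defining
    property; the default value 0 is not used for w in L^2. *)
Definition is_harm_proj O w h : Prop :=
  L2harmonic O h /\
  forall h', L2harmonic O h' -> pairing O (fun e => w e - h e) h' = 0%E.

Definition harm_proj O w : oedge V -> R := xget (fun=> 0) (is_harm_proj O w).

End Model.

Definition borel_measure (X : pmetricType R) :=
  {measure set (g_sigma_algebraType (@open X)) -> \bar R}.

Definition const_density (X : pmetricType R) (V : set X) (mu : borel_measure X)
    (e : oedge V) : Prop :=
  exists c : R, forall B : set X, <<s @open X >> B ->
    mu (B `&` eset e) =
    (c%:E * lebesgue_measure (epar e @^-1` B `&` `]0%R, elen e[))%E.

(** The canonical measure, which does not depend on the model, is
    characterized through all models at once.  Vertices have measure 0. *)
Definition canonical_measure (X : pmetricType R) (mu : borel_measure X) : Prop :=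
  forall (V : set X) (O : set (oedge V)), vertex_set V -> orientation O ->
    mu V = 0%E /\
    forall e : oedge V,
      const_density mu e /\
      mu (eset e) = (dens (harm_proj O (dform e)) e)%:E.

Definition isometric_onto (X Y : metricType R) (f : Y -> X) (A : set Y)
    (U : set X) : Prop :=
  f @` A = U /\ forall y z, A y -> A z -> mdist (f y) (f z) = mdist y z.

Definition covering (X Y : metricType R) (f : Y -> X) : Prop :=
  continuous f /\
  forall x : X, exists2 U : set X, open_nbhs x U &
    exists S : set (set Y),
      [/\ forall A, S A -> open A /\ isometric_onto f A U,
          trivIset S id & f @^-1` U = \bigcup_(A in S) A].

Definition path_cat (X : Type) (p q : R -> X) : R -> X :=
  fun t => if t <= 2^-1 then p (2 * t) else q (2 * t - 1).

Definition path_rev (X : Type) (p : R -> X) : R -> X := fun t => p (1 - t).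

Definition path_homotopic (X : topologicalType) (x y : X) (p q : R -> X) : Prop :=
  exists H : R * R -> X,
    [/\ {within `[0, 1] `*` `[0, 1], continuous H},
        forall t, `[0, 1]%classic t -> H (0, t) = p t /\ H (1, t) = q t &
        forall s, `[0, 1]%classic s -> H (s, 0) = x /\ H (s, 1) = y].

(** The class of the loop [p] at [f y] lies in the image of pi_1(Y, y). *)
Definition in_pi1_image (X Y : topologicalType) (f : Y -> X) (y : Y)
    (p : R -> X) : Prop :=
  exists2 q, is_path y y q & path_homotopic (f y) (f y) (f \o q) p.

Definition galois (X Y : topologicalType) (f : Y -> X) : Prop :=
  forall (y : Y) (a p : R -> X), is_path (f y) (f y) a -> is_path (f y) (f y) p ->
    in_pi1_image f y p ->
    in_pi1_image f y (path_cat (path_cat a p) (path_rev a)).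

Definition galois_covering (X Y : metricType R) (f : Y -> X) : Prop :=
  covering f /\ galois f.

Definition infinite_fibers (X Y : Type) (f : Y -> X) : Prop :=
  forall x, infinite_set (f @^-1` [set x]).

Definition edge_lift (X Y : metricType R) (f : Y -> X) (V : set X)
    (e' : oedge (f @^-1` V)) (e : oedge V) : Prop :=
  elen e' = elen e /\ f \o epar e' = epar e.

Definition pushdown (X Y : pmetricType R) (f : Y -> X) (mu' : borel_measure Y)
    (mu : borel_measure X) : Prop :=
  exists V : set X, [/\ vertex_set V, mu V = 0%E &
    forall e : oedge V, const_density mu e /\
      forall e' : oedge (f @^-1` V), edge_lift e' e ->
        mu (eset e) = mu' (eset e')].

(** Singular homology in degree 1 with real coefficients.  A chain is a
    finitely supported function on singular simplices. *)
Definition stdsimplex (n : nat) : set 'rV[R]_n.+1 :=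
  [set v | (forall i, 0 <= v ord0 i) /\ \sum_i v ord0 i = 1].
Arguments stdsimplex : clear implicits.

Definition coface_row (n : nat) (i : 'I_n.+2) (v : 'rV[R]_n.+1) : 'rV[R]_n.+2 :=
  \row_j (if unlift i j is Some k then v ord0 k else 0).

Lemma coface_row_simplex n (i : 'I_n.+2) (v : 'rV[R]_n.+1) :
  stdsimplex n v -> stdsimplex n.+1 (coface_row i v).
Proof.
move=> [v0 v1]; split => [j|].
  by rewrite mxE; case: unliftP.
rewrite (bigD1_ord i)//= mxE unlift_none add0r -[RHS]v1.
by apply: eq_bigr => k _; rewrite mxE liftK.
Qed.

Definition coface (n : nat) (i : 'I_n.+2) (v : stdsimplex n) : stdsimplex n.+1 :=
  exist _ (coface_row i (set_val v))
    (mem_set (coface_row_simplex i (set_valP v))).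

Lemma coface_continuous (n : nat) (i : 'I_n.+2) : continuous (@coface n i).
Proof.
apply: continuous_comp_initial => v A [P PA sPA] /=.
pose Q (_ : 'I_1) (k : 'I_n.+1) : set R := P ord0 (lift i k).
suff : nbhs (set_val v : 'rV[R]_n.+1) [set u | A (coface_row i u)].
  exact: (@initial_continuous (stdsimplex n) _ set_val v).
exists Q => [a k|u uQ /=].
  have := PA ord0 (lift i k).
  by rewrite /= mxE liftK (ord1 a).
apply: sPA => a j; rewrite (ord1 a) mxE.
case: unliftP => [k ->|jE]; first exact: uQ.
have := PA ord0 j; rewrite /= mxE jE unlift_none => /nbhs_singleton.
by [].
Qed.

HB.instance Definition _ (n : nat) (i : 'I_n.+2) :=
  @isContinuous.Build _ _ (@coface n i) (@coface_continuous n i).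

Section Homology.
Context (X : topologicalType).

Definition simplex (n : nat) := continuousType (stdsimplex n) X.

Definition face (n : nat) (i : 'I_n.+2) (s : simplex n.+1) : simplex n :=
  s \o coface i.

Definition chain (n : nat) (c : simplex n -> R) : Prop :=
  finite_set [set s | c s != 0].

Definition boundary (n : nat) (c : simplex n.+1 -> R) : simplex n -> R := fun t =>
  \sum_(s \in [set: simplex n.+1])
    c s * \sum_(i < n.+2) (-1) ^+ i * (face i s == t)%:R.

Definition cycle1 (c : simplex 1 -> R) : Prop :=
  chain c /\ forall t, boundary c t = 0.

Definition boundary1 (c : simplex 1 -> R) : Prop :=
  exists2 b : simplex 2 -> R, chain b & forall t, boundary b t = c t.

(** The classes of the cycles [b k], k < g, form a basis of H_1(X, R). *)
Definition H1_basis (g : nat) (b : 'I_g -> simplex 1 -> R) : Prop :=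
  (forall k, cycle1 (b k)) /\
  forall z, cycle1 z -> exists! a : 'rV[R]_g,
    boundary1 (fun s => z s - \sum_(k < g) a ord0 k * b k s).

(** The dimension of H_1(X, R), with value 0 if that is infinite. *)
Definition genus : nat :=
  xget 0%N [set g : nat | exists b : 'I_g -> simplex 1 -> R, H1_basis b].

Definition euler_char : int := 1 - genus%:Z.

End Homology.

End MetricGraphs.

(* The field of coefficients cannot be inferred from the space. *)
Arguments genus : clear implicits.
Arguments euler_char : clear implicits.

(* Main.v *)
(* Fix a vertex set V of Gamma, with oriented edges E, and the lifted model of
   Gamma'. Describe forms by their densities, let d be the gradient and d* the
   divergence, and put A = 1 - d d* / 2D and B = 1 - d* d / 2D, with D a bound
   for the weighted degrees. Both have norm at most 1, d* A = B d* and
   <A^2n g, g> decreases; hence A^2n (de') tends to the projection of de' to the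
   harmonic L^2 forms. Writing A^n as a telescoping sum and adding over lifts e'
   of all e in E, one gets
     sum_e (A^n de')_e' = |E| - 2|V| + 2 sum_(v in V) (B^n delta_v')(v'),
   where the Galois property ensures that the return kernel of B^n at a lift v'
   depends on v only. The return kernels tend to 0 because Gamma' is infinite, so
   the measure of Gamma is |E|/2 - |V|.
   Finally dim H_1 = |E|/2 - |V| + 1. Modulo boundaries a short path is a
   difference of segments of edges, since it contracts radially in a star, so
   every cycle is homologous to a combination of edges; and the winding number
   along an edge e, that is, around the circle obtained by collapsing the
   complement of e, is a cocycle that separates these combinations. *)
From HB Require Import structures.
From mathcomp Require Import all_boot all_order all_algebra.
From mathcomp Require Import all_classical all_reals all_analysis.
From mathcomp Require Import ring lra zify.
Require Import Defs.

Set Implicit Arguments.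
Unset Strict Implicit.
Unset Printing Implicit Defensive.

Import Order.TTheory GRing.Theory Num.Theory.
Import numFieldTopology.Exports numFieldNormedType.Exports.

Local Open Scope classical_set_scope.
Local Open Scope ring_scope.

(** * Metric spaces *)

Section MetricBasics.
Context {R : realType}.

(** The Hilbert space of forms is never built. The iterates of a finitely supported form keep finite
    support, so every pairing before the limit is a finite sum, and the limit is recognized as
    [harm_proj] through its defining property. The trace formula is an exact identity for each n, so
    the return kernels are the only quantities whose limit has to be found. Covering theory is
    replaced by a discrete parallel transport with a uniform step [lam], along subdivisions of
    paths. Applied to the cover it gives unique path lifting, homotopy invariance and the lifts of
    edges. Applied to the product of the graph with R, with the increments of an angle modulo 1, it
    gives the winding numbers. One homotopy argument thus serves both the Galois property and the
    computation of H_1. Much local geometry has to be derived: a vertex set is only assumed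
    discrete, an arc is isometric only for the path metric of its component, and that an arc ends at
    vertices comes from compactness. As the cover is not compact, its model is obtained by lifting
    edges of the base. *)

Lemma lebesgue_number (T : pseudoMetricType R) (K : set T) (W : T -> set T) :
  compact K -> (forall x, K x -> nbhs x (W x)) ->
  exists2 d : R, 0 < d & forall x, K x -> exists2 y, K y & ball x d `<=` W y.
Proof.
move=> /compact_near_coveringP cK nW.
have : \forall d \near (0 : R)^'+, K `<=`
    (fun x => exists2 y, K y & ball x d `<=` W y).
  apply: cK => x Kx; have /nbhs_ballP[e /= e0 eW] := nW x Kx.
  exists (ball x (e / 2), [set d | d < e / 2]) => /=.
    split; first by apply: nbhsx_ballx; rewrite divr_gt0.
    by apply: nbhs_right_lt; rewrite divr_gt0.
  move=> [x' d] /= [xx' de]; exists x => // y x'y; apply: eW.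
  rewrite [e]splitr; apply: ball_triangle xx' _; apply: le_ball x'y.
  exact: ltW.
rewrite near_withinE => /nbhs_ballP[e /= e0 eP].
exists (e / 2); first by rewrite divr_gt0.
apply: eP; last by rewrite divr_gt0.
rewrite /ball /= sub0r normrN gtr0_norm ?divr_gt0//.
by rewrite ltr_pdivrMr// ltr_pMr// ltr1n.
Qed.

Lemma nbhs_mdist (X : metricType R) (x : X) (A : set X) :
  nbhs x A <-> exists2 e : R, 0 < e & forall y, mdist x y < e -> A y.
Proof.
split=> [/nbhs_ballP[e /= e0 eA]|[e e0 eA]].
  by exists e => // y xy; apply: eA; rewrite ballEmdist.
by apply/nbhs_ballP; exists e => // y; rewrite ballEmdist /=; exact: eA.
Qed.

Lemma open_mdist (X : metricType R) (A : set X) :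
  open A <-> forall x, A x -> exists2 e : R, 0 < e & forall y, mdist x y < e -> A y.
Proof.
rewrite openE; split=> [oA x /oA/nbhs_mdist//|h x Ax].
by apply/nbhs_mdist/h.
Qed.

Lemma continuous_mdist (X Y : metricType R) (f : X -> Y) (x : X) :
  {for x, continuous f} <-> forall e : R, 0 < e -> exists2 d : R, 0 < d &
    forall y, mdist x y < d -> mdist (f x) (f y) < e.
Proof.
split=> [cf e e0|h A /nbhs_mdist[e /h[d d0 dP] eA]].
  have : nbhs (f x) [set z | mdist (f x) z < e] by apply/nbhs_mdist; exists e.
  by move=> /cf/nbhs_mdist[d d0 dP]; exists d.
by apply/nbhs_mdist; exists d => // y /dP/eA.
Qed.

Lemma continuous_normP (Y : metricType R) (f : R -> Y) (x : R) :
  {for x, continuous f} <-> forall e : R, 0 < e -> exists2 d : R, 0 < d &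
    forall y, `|x - y| < d -> mdist (f x) (f y) < e.
Proof.
split=> [cf e e0|h A /nbhs_mdist[e /h[d d0 dP] eA]].
  have : nbhs (f x) [set z | mdist (f x) z < e] by apply/nbhs_mdist; exists e.
  by move=> /cf/nbhs_ballP[d /= d0 dP]; exists d => // y xy; exact: dP.
by apply/nbhs_ballP; exists d => // y /dP/eA.
Qed.

Lemma lipschitz_continuous (Y : metricType R) (f : R -> Y) (k : R) :
  (forall s t, mdist (f s) (f t) <= k * `|s - t|) -> continuous f.
Proof.
move=> lf x; apply/continuous_normP => e e0.
have k1 : 0 < `|k| + 1 by rewrite ltr_pwDr.
exists (e / (`|k| + 1)) => [|y xy]; first by rewrite divr_gt0.
rewrite (le_lt_trans (lf _ _))//.
rewrite ltr_pdivlMr// in xy; apply: le_lt_trans xy.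
rewrite mulrC ler_wpM2l//; have := ler_norm k; lra.
Qed.

(** Local constancy is asked relative to [A] only, which suits components and connected sets in a
    cover: [P] and its complement both cut [A] in relatively open sets. *)
Lemma connected_locally_constant (X : topologicalType) (A : set X)
    (P : X -> Prop) :
  connected A ->
  (forall x, A x -> \forall y \near x, A y -> (P x <-> P y)) ->
  forall x y, A x -> A y -> P x -> P y.
Proof.
move=> cA lc x y Ax Ay Px.
suff : A `&` P = A by move=> /seteqP[_ /(_ y Ay)[]].
have opn (Q : X -> Prop) :
    (forall x, A x -> \forall y \near x, A y -> (Q x <-> Q y)) ->
    exists2 B, open B & A `&` Q = A `&` B.
  move=> lQ; exists (interior [set z | A z -> Q z]).
    exact: open_interior.
  apply/seteqP; split => z [Az Qz]; split => //.
    apply: filterS (lQ _ Az) => w h Aw; by apply/h.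
  by have := interior_subset Qz; exact.
apply: cA; first by exists x.
- exact: opn.
- have [B oB AB] : exists2 B, open B & A `&` ~` P = A `&` B.
    apply: opn => z Az; apply: filterS (lc _ Az) => w h Aw.
    by have := h Aw; rewrite /setC /=; tauto.
  exists (~` B); first by rewrite closedC.
  apply/seteqP; split => z [Az Pz]; split => //.
    by move=> Bz; have [] : (A `&` ~` P) z by rewrite AB.
  apply: contrapT => nPz; apply: Pz.
  by have [] : (A `&` B) z by rewrite -AB.
Qed.

Lemma connected_image_itv (X : metricType R) (c : R -> X) (i : interval R) :
  (forall t, [set` i] t -> {for t, continuous c}) -> connected (c @` [set` i]).
Proof.
move=> cc; apply: connected_continuous_connected.
  by apply/connected_intervalP; exact: interval_is_interval.
apply: continuous_in_subspaceT => t; rewrite inE => ti; exact: cc.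
Qed.

(** Composing with this retraction of the line onto [[a, b]] turns a path known on a segment into a
    continuous function on the line, with the same Lipschitz constant. *)
Definition clamp (a b t : R) : R := Num.max a (Num.min b t).

Lemma clamp_id a b t : a <= t <= b -> clamp a b t = t.
Proof. by move=> /andP[at_ tb]; rewrite /clamp (min_idPr tb) (max_idPr at_). Qed.

Lemma clamp_itv a b t : a <= b -> a <= clamp a b t <= b.
Proof.
move=> ab; rewrite /clamp le_max lexx /= ge_max ab /=.
by rewrite ge_min lexx.
Qed.

Lemma clamp_le a b t : a <= b -> t <= a -> clamp a b t = a.
Proof.
move=> ab ta; rewrite /clamp; apply/max_idPl.
by rewrite ge_min ta orbT.
Qed.

Lemma clamp_ge a b t : a <= b -> b <= t -> clamp a b t = b.
Proof. by move=> ab bt; rewrite /clamp (min_idPl bt); apply/max_idPr. Qed.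

Lemma clamp_lip a b s t : a <= b -> `|clamp a b s - clamp a b t| <= `|s - t|.
Proof.
move=> ab.
have [sa|sa] := leP s a; [rewrite (clamp_le ab sa)|have [sb|sb] := leP s b];
  [|rewrite (@clamp_id a b s) ?(ltW sa)//|rewrite (clamp_ge ab (ltW sb))];
(have [ta|ta] := leP t a; [rewrite (clamp_le ab ta)|have [tb|tb] := leP t b];
  [|rewrite (@clamp_id a b t) ?(ltW ta)//|rewrite (clamp_ge ab (ltW tb))]);
 rewrite !ler_norml; have := ler_norm (s - t); have := ler_norm (t - s);
 rewrite (distrC t s) => h1 h2; lra.
Qed.

Lemma continuous_clamp a b : a <= b -> continuous (clamp a b).
Proof.
move=> ab; apply: (@lipschitz_continuous R^o (clamp a b) 1) => s t.
by rewrite mul1r [mdist _ _]distrC; exact: clamp_lip.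
Qed.

Lemma lipschitz_clamp (Y : metricType R) (f : R -> Y) (k a b : R) :
  a <= b -> 0 <= k ->
  (forall s t, a <= s <= b -> a <= t <= b -> mdist (f s) (f t) <= k * `|s - t|) ->
  forall s t, mdist (f (clamp a b s)) (f (clamp a b t)) <= k * `|s - t|.
Proof.
move=> ab k0 lf s t; apply: le_trans (lf _ _ (clamp_itv _ ab) (clamp_itv _ ab)) _.
by rewrite ler_wpM2l// clamp_lip.
Qed.

Lemma eq_on_closed_itv (X : metricType R) (f g : R -> X) (l : R) : 0 < l ->
  continuous f -> continuous g -> (forall t : R, 0 < t < l -> f t = g t) ->
  forall t : R, 0 <= t <= l -> f t = g t.
Proof.
move=> l0 cf cg fg t /andP[t0 tl]; apply: mdist_positivity.
apply/eqP; rewrite eq_le mdist_ge0 andbT; apply/ler_addgt0Pl => e e0.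
rewrite addr0; have e20 : 0 < e / 2 by rewrite divr_gt0.
have [df df0 fP] := (continuous_normP f t).1 (cf t) _ e20.
have [dg dg0 gP] := (continuous_normP g t).1 (cg t) _ e20.
have [s /andP[s0 sl] [s1 s2]] : exists2 s, 0 < s < l & `|t - s| < df /\ `|t - s| < dg.
  have [d d0 [d1 d2 d3]] : exists2 d : R, 0 < d & [/\ d < df, d < dg & 2 * d < l].
    pose m := Num.min (Num.min df dg) l.
    have m0 : 0 < m by rewrite !lt_min df0 dg0 l0.
    have m1 : m <= df by rewrite !ge_min lexx.
    have m2 : m <= dg by rewrite !ge_min lexx !orbT.
    have m3 : m <= l by rewrite !ge_min lexx !orbT.
    by exists (m / 3); [rewrite divr_gt0|split; clearbody m; lra].
  have [th|th] := leP t (l / 2).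
    exists (t + d); first by apply/andP; split; lra.
    by rewrite opprD addrA subrr sub0r normrN gtr0_norm.
  exists (t - d); first by apply/andP; split; lra.
  by rewrite opprB addrC subrK gtr0_norm.
apply: (le_trans (metric_triangle _ (f s) _)).
rewrite [e]splitr lerD ?ltW//; first exact: fP.
by rewrite fg ?s0// metric_sym; exact: gP.
Qed.

Lemma compact_finite_cover (T : topologicalType) (W : T -> set T) :
  compact [set: T] -> (forall x, nbhs x (W x)) ->
  exists D : seq T, forall y, exists2 x, x \in D & W x y.
Proof.
move=> /compact_near_coveringP cT nW.
(* The sequences containing a given one generate a filter; the near-covering form of compactness
   then provides one sequence that works for all points. *)
pose F := filter_from [set: seq T]
  (fun D0 : seq T => [set D : seq T | {subset D0 <= D}]).
have FF : Filter F.
  apply: filter_from_filter; first by exists [::].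
  move=> D1 D2 _ _; exists (D1 ++ D2) => // D h; split => x xD; apply: h;
  by rewrite mem_cat xD ?orbT.
have [|D0 _ DP] := cT (seq T) F (fun D y => exists2 x, x \in D & W x y) FF _.
  move=> x _; exists (W x, [set D : seq T | x \in D]).
    split; first exact: nW.
    by exists [:: x] => // D; apply; rewrite inE.
  by move=> [y D] /= [Wy xD]; exists x.
by exists D0 => y; apply: DP.
Qed.

End MetricBasics.

(** * Stars and edges of a model *)

Lemma eq_ler (R : realType) (x y : R) : x = y -> x <= y.
Proof. by move=> ->. Qed.

Section PathDist.
Context {R : realType} {X : metricType R}.
Implicit Types (A : set X) (p : R -> X).

Lemma path_length_ge p : ((mdist (p 0) (p 1))%:E <= path_length p)%E.
Proof.
apply: ereal_sup_ubound; exists [:: 1]; first exact: itv_partition1 ltr01.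
by rewrite /= big_nat1.
Qed.

Lemma path_length_uniform_ge p (n : nat) :
  ((\sum_(i < n.+1) mdist (p (i%:R / n.+1%:R)) (p (i.+1%:R / n.+1%:R)))%:E
    <= path_length p)%E.
Proof.
apply: ereal_sup_ubound; pose g i : R := i%:R / n.+1%:R.
have gn : g n.+1 = 1 by rewrite /g divff// pnatr_eq0.
have g0 : g 0%N = 0 by rewrite /g mul0r.
have glt i : g i < g i.+1 by rewrite ltr_pM2r ?invr_gt0// ltr_nat.
have E m : 0 :: [seq g i.+1 | i <- iota 0 m] = [seq g i | i <- iota 0 m.+1].
  by rewrite /= g0 -[1%N]/(1 + 0)%N iotaDl -map_comp.
have N d j : (j < n.+2)%N -> nth d (0 :: [seq g i.+1 | i <- iota 0 n.+1]) j = g j.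
  by move=> jn; rewrite E (nth_map 0%N) ?size_iota// nth_iota.
have N' d j : (j < n.+1)%N -> nth d [seq g i.+1 | i <- iota 0 n.+1] j = g j.+1.
  by move=> jn; rewrite -(N d j.+1).
exists [seq g i.+1 | i <- iota 0 n.+1].
  split.
    apply/(pathP 0) => i; rewrite size_map size_iota => ni.
    by rewrite (N _ _ (leqW ni)) (N' _ _ ni).
  by rewrite -nth_last size_map size_iota N' ?gn.
rewrite size_map size_iota big_mkord; congr (_%:E); apply: eq_bigr => i _.
by rewrite (N _ i (leqW (ltn_ord i))) (N _ i.+1 (ltn_ord i)).
Qed.

Lemma path_dist_ge A x y : ((mdist x y)%:E <= path_dist A x y)%E.
Proof.
apply: le_ereal_inf_tmp => _ [p [[_ p0 p1] _] <-].
by have := path_length_ge p; rewrite p0 p1.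
Qed.

Lemma path_length_lip p k : 0 <= k ->
  (forall s t : R, 0 <= s <= 1 -> 0 <= t <= 1 -> mdist (p s) (p t) <= k * `|s - t|) ->
  (path_length p <= k%:E)%E.
Proof.
move=> k0 lp; apply: ge_ereal_sup => _ [s ps <-]; rewrite lee_fin.
have nI i : (i <= size s)%N -> 0 <= nth 1 (0 :: s) i <= 1.
  by move=> si; rewrite (itv_partition_nth_ge _ ps)// (itv_partition_nth_le _ ps).
have nlt i : (i < size s)%N -> nth 1 (0 :: s) i < nth 1 (0 :: s) i.+1.
  by move=> si; have [/(pathP 1) + _] := ps; exact.
apply: (@le_trans _ _ (\sum_(0 <= i < size s)
    (k * nth 1 (0 :: s) i.+1 - k * nth 1 (0 :: s) i))).
  rewrite big_nat [leRHS]big_nat; apply: ler_sum => i /andP[_ si].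
  rewrite -mulrBr; apply: le_trans (lp _ _ _ _) _; rewrite ?nI//; first exact: ltnW.
  by rewrite distrC gtr0_norm// subr_gt0 nlt.
rewrite telescope_sumr// (itv_partition_nth_size _ ps) /=; lra.
Qed.

Lemma path_dist_le A x y p k : 0 <= k ->
  (forall s t : R, mdist (p s) (p t) <= k * `|s - t|) ->
  p 0 = x -> p 1 = y -> (forall t : R, 0 <= t <= 1 -> A (p t)) ->
  (path_dist A x y <= k%:E)%E.
Proof.
move=> k0 lp p0 p1 pA; apply: le_trans (path_length_lip k0 (fun s t _ _ => lp s t)).
apply: ereal_inf_lbound; exists p => //; split; first split => //.
  by apply: continuous_subspaceT; exact: lipschitz_continuous lp.
by move=> _ [t + <-]; rewrite /= in_itv /=; exact: pA.
Qed.

End PathDist.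

(** * Stars centred at a given point *)

Section Stars.
Context {R : realType}.

(** Unlike in [star_chart], the support is the whole ball of radius [r] about the origin, so that
    charts can be shrunk and compared with metric neighbourhoods. *)
Definition cstar (X : metricType R) (x : X) (n : nat) (r : R)
    (p : 'I_n -> R -> X) : Prop :=
  [/\ 0 < r, forall k, p k 0 = x,
     forall y, mdist x y < r -> y = x \/ exists k (t : R), 0 < t < r /\ y = p k t &
     forall k l (s t : R), 0 <= s < r -> 0 <= t < r ->
       mdist (p k s) (p l t) = star_dist k l s t].

Context {X : metricType R}.

Lemma cstar_dist (x : X) n r (p : 'I_n -> R -> X) k (t : R) :
  cstar x r p -> 0 <= t < r -> mdist x (p k t) = t.
Proof.
move=> [r0 px _ pd] tr; rewrite -(px k) pd ?lexx// /star_dist eqxx.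
by rewrite sub0r normrN ger0_norm//; case/andP: tr.
Qed.

Lemma cstar_shrink (x : X) n r r' (p : 'I_n -> R -> X) :
  0 < r' <= r -> cstar x r p -> cstar x r' p.
Proof.
move=> /andP[r'0 r'r] cs; have [r0 px py pd] := cs; split => //.
- move=> y xy; have [|->|[k [t [/andP[t0 tr] yE]]]] := py y; [exact: lt_le_trans r'r|by left|].
  right; exists k, t; split=> //; rewrite t0 /=.
  have <- : mdist x (p k t) = t by apply: cstar_dist cs _; rewrite (ltW t0).
  by rewrite -yE.
- move=> k l s t /andP[s0 sr] /andP[t0 tr].
  by rewrite pd// ?s0 ?t0 /= (lt_le_trans _ r'r).
Qed.

Lemma cstar_valence (x : X) n r (p : 'I_n -> R -> X) : cstar x r p -> valence x n.
Proof.
move=> cs; have [r0 px py pd] := cs.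
exists r, (ball x r), p; split => //.
  rewrite ballEmdist; apply/open_mdist => y /= xy; exists (r - mdist x y).
    by rewrite subr_gt0.
  move=> z yz; apply: le_lt_trans (metric_triangle _ y _) _.
  by rewrite addrC -ltrBrDr.
split => //.
  rewrite ballEmdist; apply/seteqP; split=> y /=.
    move=> /py[->|[k [t [/andP[t0 tr] ->]]]]; first by left.
    by right; exists k => //; exists t; rewrite //= in_itv /= (ltW t0).
  move=> [->|[k _ [t /=]]]; first by rewrite mdistxx.
  by rewrite in_itv /= => tr <-; rewrite (cstar_dist _ cs)//; case/andP: tr.
Qed.

(** The star given by the definition of a metric graph may have another origin. If [x] lies inside
    one of its rays, the two directions along that ray form a star of valence 2, of a radius that
    keeps it off the origin and inside the ray. *)
Lemma star_center : metric_graph X -> forall x : X,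
  exists n r (p : 'I_n -> R -> X), cstar x r p.
Proof.
move=> [_ _ [eps eps0 mg]] x.
have [n [r [x0 [U [p [epsr oU Ux [px UE pd]]]]]]] := mg x.
have r0 : 0 < r := lt_le_trans eps0 epsr.
have [r1 r10 r1U] := (open_mdist U).1 oU x Ux.
have cs0 : x = x0 -> exists n r (p : 'I_n -> R -> X), cstar x r p.
  move=> xx0; exists n, (Num.min r r1), p; split.
  - by rewrite lt_min r0.
  - by move=> k; rewrite px.
  - move=> y; rewrite lt_min => /andP[yr yr1]; have := r1U _ yr1; rewrite UE => -[->|[k _ [t]]].
      by left.
    rewrite /= in_itv /= => /andP[t0 tr] yE.
    move: t0; rewrite le_eqVlt => /predU1P[t0|t0].
      by left; rewrite -yE -t0 px.
    right; exists k, t; split => //; rewrite t0 /=.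
    have xyt : mdist x y = t.
      rewrite xx0 -(px k) -yE pd/= ?in_itv/= ?lexx ?(ltW t0)//.
      by rewrite /star_dist eqxx sub0r normrN gtr0_norm.
    by rewrite lt_min -xyt yr yr1.
  - move=> k l s t /andP[s0]; rewrite lt_min => /andP[sr _] /andP[t0].
    rewrite lt_min => /andP[tr _].
    by apply: pd; rewrite /= in_itv /= ?s0 ?t0.
move: (Ux); rewrite UE => -[|[k0 _ [t0]]]; first exact: cs0.
rewrite /= in_itv /= => /andP[]; rewrite le_eqVlt => /predU1P[<- _ xE|t00 t0r xE].
  by apply: cs0; rewrite -xE px.
pose p' (k : 'I_2) (t : R) := if k == ord0 then p k0 (t0 + t) else p k0 (t0 - t).
pose r' := Num.min r1 (Num.min t0 (r - t0)).
have r'1 : r' <= r1 by rewrite ge_min lexx.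
have r'2 : r' <= t0 by rewrite !ge_min lexx orbT.
have r'3 : r' <= r - t0 by rewrite !ge_min lexx !orbT.
have r'0 : 0 < r' by rewrite !lt_min r10 t00 subr_gt0.
exists 2%N, r', p'; clearbody r'; split => //.
- by move=> k; rewrite /p'; case: ifP => _; rewrite ?addr0 ?subr0.
- move=> y yr'; have /r1U : mdist x y < r1 by exact: lt_le_trans r'1.
  rewrite UE => -[yE|[l _ [t]]].
    move: yr'; rewrite yE -(px k0) -xE pd /= ?in_itv/= ?lexx ?(ltW t00)//.
    by rewrite /star_dist eqxx subr0 gtr0_norm// ltNge r'2.
  rewrite /= in_itv /= => /andP[tp tr] yE.
  move: yr'; rewrite -xE -yE pd /= ?in_itv/= ?tp ?(ltW t00)//.
  rewrite /star_dist; case: eqP => [<-|_]; last by move=> h; exfalso; lra.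
  have [tt0|tt0|->] := ltgtP t t0; last by left.
    rewrite gtr0_norm ?subr_gt0// => h; right; exists (lift ord0 ord0), (t0 - t).
    by split; [rewrite subr_gt0 tt0|rewrite /p' /= opprB addrC subrK].
  rewrite distrC gtr0_norm ?subr_gt0// => h; right; exists ord0, (t - t0).
  by split; [rewrite subr_gt0 tt0|rewrite /p' /= addrC subrK].
- move=> k l s t /andP[s0 sr] /andP[tp tr]; rewrite /p'.
  have kl : (k == l) = ((k == ord0) == (l == ord0)).
    by case: k => -[|[|]]//= ?; case: l => -[|[|]].
  rewrite /star_dist kl.
  case: (k == ord0); case: (l == ord0) => /=; rewrite pd /star_dist ?eqxx /= ?in_itv /=;
   try (apply/andP; split; lra).
  + by congr `|_|; ring.
  + by rewrite ger0_norm; lra.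
  + by rewrite distrC ger0_norm; lra.
  + by rewrite distrC; congr `|_|; ring.
Qed.

(** This converts distances in a small ball into path distances, and gives connectedness. Points of
    one ray are joined affinely; otherwise the path runs through the centre at constant speed. *)
Lemma cstar_geodesic (x : X) n r (p : 'I_n -> R -> X) (a b : X) :
  cstar x r p -> mdist x a < r -> mdist x b < r ->
  exists g : R -> X,
   [/\ forall s t : R, mdist (g s) (g t) <= mdist a b * `|s - t|,
     g 0 = a, g 1 = b & forall t, mdist x (g t) < r].
Proof.
move=> cs xa xb; have [r0 px py pd] := cs.
have rep y : mdist x y < r -> (exists k : 'I_n, True) ->
    exists k (t : R), 0 <= t < r /\ y = p k t.
  move=> /py[->|[k [t [/andP[t0 tr] ->]]] _]; last by exists k, t; rewrite (ltW t0).
  by move=> [k _]; exists k, 0; rewrite lexx r0 px.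
(* Without rays the ball is reduced to its centre, which then has no ray coordinate. *)
have [nk|kn] := pselect (exists k : 'I_n, True); last first.
  have E y : mdist x y < r -> y = x.
    by move=> /py[//|[k]]; exfalso; apply: kn; exists k.
  rewrite (E _ xa) (E _ xb); exists (fun=> x).
  by split => //; [move=> s t; rewrite mdistxx mul0r|rewrite mdistxx].
have [k [s [sr aE]]] := rep _ xa nk; have [l [t [tr bE]]] := rep _ xb nk.
have ex (g : R -> X) :
   (forall s t : R, 0 <= s <= 1 -> 0 <= t <= 1 -> mdist (g s) (g t) <= mdist a b * `|s - t|) ->
   g 0 = a -> g 1 = b -> (forall t : R, 0 <= t <= 1 -> mdist x (g t) < r) ->
  exists g : R -> X,
   [/\ forall s t : R, mdist (g s) (g t) <= mdist a b * `|s - t|,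
     g 0 = a, g 1 = b & forall t, mdist x (g t) < r].
  move=> g1 g2 g3 g4; exists (g \o clamp 0 1); split => /=.
  - by apply: lipschitz_clamp => //; exact: mdist_ge0.
  - by rewrite clamp_id// lexx ler01.
  - by rewrite clamp_id// lexx ler01.
  - by move=> u; apply: g4; exact: clamp_itv ler01.
move: (sr) (tr) => /andP[s0 s1] /andP[t0 t1].
have [kl|kl] := eqVneq k l.
  subst l; have dab : mdist a b = `|s - t| by rewrite aE bE pd// /star_dist eqxx.
  have I (u : R) : 0 <= u <= 1 -> 0 <= s + (t - s) * u < r.
    move=> /andP[u0 u1]; have u1' : 0 <= 1 - u by rewrite subr_ge0.
    have [st|ts] := leP s t.
      have st' : 0 <= t - s by rewrite subr_ge0.
      by have := mulr_ge0 st' u0; have := mulr_ge0 st' u1' => *; apply/andP; split; lra.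
    have st' : 0 <= s - t by rewrite subr_ge0 ltW.
    by have := mulr_ge0 st' u0; have := mulr_ge0 st' u1' => *; apply/andP; split; lra.
  apply: (ex (fun u => p k (s + (t - s) * u))).
  - move=> u v u01 v01; rewrite pd ?I// /star_dist eqxx.
    by rewrite dab -normrM -normrN; apply: eq_ler; congr `|_|; ring.
  - by rewrite mulr0 addr0 aE.
  - by rewrite mulr1 addrC subrK bE.
  - move=> u u01; rewrite (cstar_dist _ cs) ?I//; by have /andP[] := I u u01.
have dab : mdist a b = s + t by rewrite aE bE pd// /star_dist (negbTE kl).
have st0 : 0 <= s + t by rewrite addr_ge0.
apply: (ex (fun u => if u * (s + t) <= s then p k (s - u * (s + t))
                                  else p l (u * (s + t) - s))).
- move=> u v /andP[u0 u1] /andP[v0 v1]; rewrite dab.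
  have P1 : 0 <= u * (s + t) <= s + t by apply/andP; split; nra.
  have P2 : 0 <= v * (s + t) <= s + t by apply/andP; split; nra.
  have -> : (s + t) * `|u - v| = `|u * (s + t) - v * (s + t)|.
    by rewrite -mulrBl normrM [`|s + t|]ger0_norm// mulrC.
  move: (u * (s + t)) (v * (s + t)) P1 P2 => {u0 u1 v0 v1}u' v' /andP[a1 a2] /andP[b1 b2].
  case: ifPn => [h1|]; [|rewrite -ltNge => h1]; (case: ifPn => [h2|]; [|rewrite -ltNge => h2]);
  rewrite pd; try (apply/andP; split; lra); rewrite /star_dist ?eqxx ?(negbTE kl) ?[l == k]eq_sym ?(negbTE kl).
  + by rewrite distrC; apply: eq_ler; congr `|_|; ring.
  + by rewrite distrC ger0_norm; lra.
  + by rewrite ger0_norm; lra.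
  + by apply: eq_ler; congr `|_|; ring.
- by rewrite mul0r s0 subr0 aE.
- rewrite mul1r; case: ifPn => [h|_]; last by rewrite [s + t]addrC addrK bE.
  have -> : s - (s + t) = 0 by lra.
  by rewrite px bE (_ : t = 0) ?px//; lra.
- move=> u /andP[u0 u1]; have P1 : 0 <= u * (s + t) <= s + t by apply/andP; split; nra.
  move: (u * (s + t)) P1 => u' /andP[a1 a2].
  by case: ifPn => [h|]; [|rewrite -ltNge => h]; rewrite (cstar_dist _ cs); lra.
Qed.

End Stars.

Section Isometries.
Context {R : realType}.

(** Each point keeps or reverses its displacement from the midpoint, and a single point other than
    the midpoint that keeps it decides for all the others. *)
Lemma itv_isometry (u : R -> R) (a b : R) : a < b ->
  (forall s t, a < s < b -> a < t < b -> `|u s - u t| = `|s - t|) ->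
  exists c, (forall t, a < t < b -> u t = c + t) \/ (forall t, a < t < b -> u t = c - t).
Proof.
move=> ab iu; pose m := (a + b) / 2; have mI : a < m < b by apply/andP; split; rewrite /m; lra.
have D t : a < t < b -> u t - u m = t - m \/ u t - u m = m - t.
  move=> tI; have /eqP := iu t m tI mI; rewrite eqr_norm2 => /orP[/eqP->|/eqP->]; first by left.
  by right; rewrite opprB.
have [[t1 [t1I t1m Dt1]]|N] := pselect (exists t1, [/\ a < t1 < b, t1 != m & u t1 - u m = t1 - m]).
  exists (u m - m); left => t tI; have [h|h] := D t tI; first by lra.
  have := iu t t1 tI t1I.
  have -> : u t - u t1 = m - t - (t1 - m) by lra.
  move/eqP; rewrite eqr_norm2 => /orP[/eqP h1|/eqP h1].
    by have tm : t = m; [lra|rewrite tm; lra].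
  have E1 : t1 = m by lra.
  by move: t1m; rewrite E1 eqxx.
exists (u m + m); right => t tI; have [h|h] := D t tI; last by lra.
have [tm|tm] := eqVneq t m; first by rewrite tm; lra.
by exfalso; apply: N; exists t.
Qed.

End Isometries.

Section OpenArcs.
Context {R : realType} {X : metricType R}.
Implicit Types (A : set X) (c : R -> X).

Lemma open_arc_mdist A l c (s t : R) : open_arc A l c -> 0 < s < l -> 0 < t < l ->
  mdist (c s) (c t) <= `|s - t|.
Proof.
move=> [l0 _ cd] sI tI; rewrite -lee_fin -cd ?/= ?in_itv//.
exact: path_dist_ge.
Qed.

Lemma open_arc_inj A l c (s t : R) : open_arc A l c -> 0 < s < l -> 0 < t < l ->
  c s = c t -> s = t.
Proof.
move=> [l0 cA cd] sI tI E; have As : A (c s) by rewrite -cA; exists s; rewrite //= in_itv.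
have : (path_dist A (c s) (c t) <= 0%:E)%E.
  apply: (@path_dist_le _ _ _ _ _ (fun=> c s)) => //.
  by move=> ? ?; rewrite mdistxx mul0r.
rewrite cd ?/= ?in_itv// lee_fin => h.
by apply/eqP; rewrite -subr_eq0 -normr_eq0 eq_le h normr_ge0.
Qed.

Lemma open_arc_rev A l c : open_arc A l c -> open_arc A l (fun t => c (l - t)).
Proof.
move=> [l0 cA cd]; split => //.
  rewrite -cA; apply/seteqP; split => _ [t + <-]; rewrite /= in_itv /= => /andP[t0 tl].
    by exists (l - t) => //=; rewrite in_itv /=; apply/andP; split; lra.
  exists (l - t); last by rewrite opprB addrC subrK.
  by rewrite /= in_itv /=; apply/andP; split; lra.
move=> s t; rewrite /= !in_itv /= => /andP[s0 sl] /andP[t0 tl].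
rewrite cd; [|by rewrite /= in_itv /=; apply/andP; split; lra|by rewrite /= in_itv /=; apply/andP; split; lra].
by congr (_%:E); rewrite distrC; congr `|_|; ring.
Qed.

End OpenArcs.

(** * Vertex sets and open arcs near a point *)

Section VertexSets.
Context {R : realType} {X : metricType R} {V : set X}.
Hypothesis mg : metric_graph X.
Hypothesis vs : vertex_set V.

Let comp x := connected_component (~` V) x.

Lemma open_arc_image_component x l c : open_arc (comp x) l c -> forall t : R, 0 < t < l -> ~ V (c t).
Proof.
move=> [_ cA _] t tI; have : comp x (c t) by rewrite -cA; exists t; rewrite //= in_itv.
exact: connected_component_sub.
Qed.

(** Closedness of [V], which discreteness alone does not give. A point off [V] has valence 2, so its
    star is an interval; the arc through it maps continuously and injectively into this interval,
    and by the intermediate value theorem it covers a neighbourhood. *)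
Lemma vertex_set_closed_near x : ~ V x -> exists2 r : R, 0 < r & forall y, mdist x y < r -> ~ V y.
Proof.
move=> nVx; have [_ Vval Varc] := vs; have [l [c ac]] := Varc x nVx.
have [n [r [p cs]]] := star_center mg x.
have n2 : n = 2%N by apply: contrapT => n2; apply: nVx; apply: Vval n2; exact: cstar_valence cs.
subst n; have [r0 px py pd] := cs; have [l0 cA cd] := ac.
have : (c @` `]0, l[) x by rewrite cA; exact: connected_component_refl.
move=> [t0]; rewrite /= in_itv /= => /andP[t00 t0l] xE.
(* A signed coordinate on the star: positive on one ray, negative on the other. *)
pose ph y : R := if pselect (exists2 t : R, 0 <= t < r & y = p ord0 t) then mdist x y else - mdist x y.
have ph0 (t : R) : 0 <= t < r -> ph (p ord0 t) = t.
  move=> tr; rewrite /ph; case: pselect => [h|h]; first exact: cstar_dist cs tr.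
  by case: h; exists t.
have ph1 (t : R) : 0 <= t < r -> ph (p (lift ord0 ord0) t) = - t.
  move=> tr; rewrite /ph; case: pselect => [[s sr E]|h]; last by rewrite (cstar_dist _ cs).
  have := pd (lift ord0 ord0) ord0 t s tr sr.
  rewrite -E mdistxx /star_dist /= => h.
  have -> : t = 0 by move/andP: tr => [? _]; move/andP: sr => [? _]; lra.
  by rewrite px mdistxx oppr0.
have bE y : mdist x y < r -> exists2 t : R, 0 <= t < r & y = p ord0 t \/ y = p (lift ord0 ord0) t.
  move=> /py[->|[k [t [/andP[h1 h2] ->]]]].
    by exists 0; rewrite ?lexx//; left; rewrite px.
  exists t; first by rewrite ltW.
  have [->|[->]] : k = ord0 \/ k = lift ord0 ord0; [|by left|by right].
  by case: k => -[|[|]]//= ?; [left|right]; apply/val_inj.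
have phd y z : mdist x y < r -> mdist x z < r -> `|ph y - ph z| = mdist y z.
  move=> /bE[s sr ys] /bE[t tr zt].
  case: ys => ->; case: zt => ->; rewrite ?ph0 ?ph1 ?pd /star_dist//=.
  - by rewrite opprK ger0_norm// addr_ge0//; [case/andP: sr|case/andP: tr].
  - rewrite -opprD normrN ger0_norm// addr_ge0//; [by case/andP: sr|by case/andP: tr].
  - by rewrite opprK addrC distrC.
have phx : ph x = 0 by rewrite -(px ord0) ph0// lexx.
pose eta := Num.min (Num.min t0 (l - t0)) r / 2.
have [eta0 eta1 eta2 eta3] : [/\ 0 < eta, eta < t0, eta < l - t0 & eta < r].
  pose m := Num.min (Num.min t0 (l - t0)) r.
  have m0 : 0 < m by rewrite !lt_min r0 t00 subr_gt0 t0l.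
  have m1 : m <= t0 by rewrite !ge_min lexx.
  have m2 : m <= l - t0 by rewrite !ge_min lexx !orbT.
  have m3 : m <= r by rewrite !ge_min lexx !orbT.
  rewrite /eta -/m; clearbody m; split; lra.
clearbody eta; pose u s := ph (c s).
have tI (s : R) : t0 - eta <= s <= t0 + eta -> 0 < s < l.
  by move=> /andP[? ?]; apply/andP; split; lra.
have t0I : 0 < t0 < l by rewrite t00.
have cI (s : R) : t0 - eta <= s <= t0 + eta -> mdist x (c s) < r.
  move=> sI; rewrite -xE; apply: le_lt_trans (open_arc_mdist ac t0I (tI _ sI)) _.
  by move/andP: sI => [? ?]; rewrite ltr_norml; apply/andP; split; lra.
have uI : {in `[t0 - eta, t0 + eta] &, injective u}.
  move=> s t; rewrite !in_itv /= => sI t'I E; apply: (open_arc_inj ac); [exact: tI|exact: tI|].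
  by apply: mdist_positivity; rewrite -phd ?cI// -/(u s) E subrr normr0.
have uC : {within `[t0 - eta, t0 + eta], continuous u}.
  have clI s : t0 - eta <= clamp (t0 - eta) (t0 + eta) s <= t0 + eta by apply: clamp_itv; lra.
  have : {within `[t0 - eta, t0 + eta], continuous (u \o clamp (t0 - eta) (t0 + eta))}.
    apply: continuous_subspaceT.
    apply: (@lipschitz_continuous _ R^o _ 1) => s t.
    rewrite mul1r /mdist /= distrC /u phd ?cI//.
    apply: le_trans (open_arc_mdist ac (tI _ (clI s)) (tI _ (clI t))) _.
    by apply: clamp_lip; lra.
  apply: subspace_eq_continuous => s; rewrite inE /= in_itv /= => sI.
  by rewrite /from_subspace /= clamp_id.
have le1 : t0 - eta <= t0 + eta by lra.
pose d := Num.min `|u (t0 - eta)| `|u (t0 + eta)|.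
have u0 : u t0 = 0 by rewrite /u xE.
have mem1 : t0 - eta \in `[t0 - eta, t0 + eta] by rewrite in_itv /= lexx.
have mem2 : t0 + eta \in `[t0 - eta, t0 + eta] by rewrite in_itv /= lexx andbT.
have mem0 : t0 \in `[t0 - eta, t0 + eta] by rewrite in_itv /=; apply/andP; split; lra.
(* The coordinate is strictly monotone along the arc, so the two ends of the window lie on opposite
   sides of the centre. *)
have sgn : u (t0 - eta) < 0 < u (t0 + eta) \/ u (t0 + eta) < 0 < u (t0 - eta).
  have [mu|mu] := itv_continuous_inj_mono uC uI.
    have := mu _ _ mem1 mem0; have := mu _ _ mem0 mem2; rewrite u0 => h1 h2.
    by left; rewrite h2 ?h1//; lra.
  have := mu _ _ mem0 mem1; have := mu _ _ mem2 mem0; rewrite u0 => h1 h2.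
  by right; rewrite h1 ?h2//; lra.
have d0 : 0 < d.
  by rewrite lt_min !normr_gt0; case: sgn => /andP[h1 h2]; rewrite ?(lt_eqF h1) ?(gt_eqF h2).
exists (Num.min d r); first by rewrite lt_min d0.
move=> y; rewrite lt_min => /andP[yd yr].
have xx : mdist x x < r by rewrite mdistxx.
have phy : `|ph y| < d by have := phd y x yr xx; rewrite phx subr0 metric_sym => ->.
have [|s sI us] := IVT (v := ph y) le1 uC.
  move: phy; rewrite /d lt_min !ltr_norml => /andP[/andP[h1 h2] /andP[h3 h4]].
  case: sgn => /andP[g1 g2].
    move: h1 h2 h3 h4; rewrite (ltr0_norm g1) (gtr0_norm g2) => *.
    by rewrite ge_min le_max; apply/andP; split; apply/orP; [left|right]; lra.
  move: h1 h2 h3 h4; rewrite (ltr0_norm g1) (gtr0_norm g2) => *.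
  by rewrite ge_min le_max; apply/andP; split; apply/orP; [right|left]; lra.
move: sI; rewrite in_itv /= => sI.
have -> : y = c s.
  by apply: mdist_positivity; rewrite -phd// ?cI// -/(u s) us subrr normr0.
exact: open_arc_image_component ac _ (tI _ sI).
Qed.

Lemma ball_in_component x (r : R) n (p : 'I_n -> R -> X) : ~ V x -> cstar x r p ->
  (forall y, mdist x y < r -> ~ V y) -> forall y, mdist x y < r -> comp x y.
Proof.
move=> nVx cs rV y xy; have [r0 _ _ _] := cs.
have xx : mdist x x < r by rewrite mdistxx.
have [g [gl g0 g1 gr]] := cstar_geodesic cs xx xy.
apply: (@connected_component_max _ _ (g @` [set` `[(0 : R), 1]]) x).
- by exists 0; rewrite //= in_itv /= lexx ler01.
- by move=> _ [t _ <-]; exact: rV.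
- by apply: connected_image_itv => t _; exact: lipschitz_continuous gl t.
- by exists 1; rewrite //= in_itv /= lexx ler01.
Qed.

Lemma small_star x : exists n r (p : 'I_n -> R -> X), cstar x r p /\
  forall y, mdist x y < r -> V y -> y = x.
Proof.
have [n [r [p cs]]] := star_center mg x; have [r0 _ _ _] := cs.
have [rV rV0 rVP] : exists2 r' : R, 0 < r' & forall y, mdist x y < r' -> V y -> y = x.
  have [Vx|nVx] := pselect (V x).
    have [Viso _ _] := vs; have [_ [U nU UE]] := Viso x Vx.
    have [r' r'0 r'P] := (nbhs_mdist x U).1 nU.
    exists r' => // y /r'P Uy Vy; have : (U `&` V) y by [].
    by rewrite UE.
  by have [r' r'0 r'P] := vertex_set_closed_near nVx; exists r' => // y /r'P.
exists n, (Num.min r rV), p; split.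
  by apply: cstar_shrink cs; rewrite ge_min lexx lt_min r0 rV0.
by move=> y; rewrite lt_min => /andP[_]; exact: rVP.
Qed.

(** An arc is isometric for the path metric of its component. In a star ball free of vertices the
    geodesics stay in that component, so there path distance and distance agree. *)
Lemma open_arc_local x0 l c (t0 : R) : open_arc (comp x0) l c -> 0 < t0 < l ->
  exists r : R, [/\ 0 < r, r <= t0 & r <= l - t0] /\
   (forall s t : R, `|t0 - s| < r -> `|t0 - t| < r -> mdist (c s) (c t) = `|s - t|) /\
   (forall y, mdist (c t0) y < r -> exists2 s : R, `|t0 - s| < r & y = c s).
Proof.
move=> ac t0I; have [l0 cA cd] := ac.
have Ax : comp x0 (c t0) by rewrite -cA; exists t0; rewrite //= in_itv.
have nVx : ~ V (c t0) by exact: open_arc_image_component ac _ t0I.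
have [n [r [p [cs rV]]]] := small_star (c t0); have [r0 _ _ _] := cs.
have rV' y : mdist (c t0) y < r -> ~ V y.
  by move=> /rV h Vy; apply: nVx; rewrite -(h Vy).
have rA y : mdist (c t0) y < r -> comp x0 y.
  move=> yr; have <- : comp (c t0) = comp x0 by apply/esym/same_connected_component.
  exact: ball_in_component cs rV' _ yr.
have geo a b : mdist (c t0) a < r -> mdist (c t0) b < r ->
    (path_dist (comp x0) a b <= (mdist a b)%:E)%E.
  move=> ar br; have [g [gl g0 g1 gr]] := cstar_geodesic cs ar br.
  apply: (path_dist_le (mdist_ge0 a b) gl g0 g1) => t _; exact: rA.
move/andP: (t0I) => [t00 t0l].
pose r' := Num.min r (Num.min t0 (l - t0)).
have r'1 : r' <= r by rewrite ge_min lexx.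
have r'2 : r' <= t0 by rewrite !ge_min lexx orbT.
have r'3 : r' <= l - t0 by rewrite !ge_min lexx !orbT.
have r'0 : 0 < r' by rewrite !lt_min r0 t00 subr_gt0 t0l.
clearbody r'; have I (s : R) : `|t0 - s| < r' -> 0 < s < l.
  by rewrite ltr_norml => /andP[? ?]; apply/andP; split; lra.
have cr (s : R) : `|t0 - s| < r' -> mdist (c t0) (c s) < r.
  move=> sr; apply: le_lt_trans (open_arc_mdist ac t0I (I _ sr)) _.
  exact: lt_le_trans sr _.
exists r'; split; [by split|split].
  move=> s t sr tr; apply/eqP; rewrite eq_le (open_arc_mdist ac (I _ sr) (I _ tr)) /=.
  rewrite -lee_fin -cd ?/= ?in_itv /= ?I//; apply: geo; exact: cr.
move=> y yr; have yr' : mdist (c t0) y < r by exact: lt_le_trans r'1.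
have : (c @` `]0, l[) y by rewrite cA; exact: rA.
move=> [s]; rewrite /= in_itv /= => sI yE; exists s => //.
apply: le_lt_trans yr; rewrite -lee_fin -cd ?/= ?in_itv//= -yE; apply: geo.
  by rewrite mdistxx.
by rewrite yE.
Qed.

(** Compactness gives a cluster point at parameter 0, and the Lipschitz bound makes it a limit. Were
    it not a vertex, it would lie on the arc at some [t1 > 0]; points of small parameter would then
    be close both to it and, by injectivity, to the parameter [t1]. *)
Lemma open_arc_end x0 l c : compact [set: X] -> open_arc (comp x0) l c ->
  exists2 z, V z & forall s : R, 0 < s < l -> mdist z (c s) <= s.
Proof.
move=> cX ac; have [l0 cA cd] := ac.
have [z [_ clz]] := cX (c @ (0 : R)^'+) _ filterT.
have near (e : R) : 0 < e -> exists2 s : R, 0 < s < l /\ s < e & mdist z (c s) < e.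
  move=> e0; have cz : (c @ (0 : R)^'+) (c @` [set s | 0 < s < Num.min l e]).
    have : \forall s \near (0 : R)^'+, 0 < s < Num.min l e.
      near=> s; apply/andP; split; near: s; first exact: nbhs_right_gt.
      by apply: nbhs_right_lt; rewrite lt_min l0.
    by apply: filterS => s sI; exists s.
  have nz : nbhs z [set y | mdist z y < e] by apply/nbhs_mdist; exists e.
  have [_ [[s /= /andP[s0 sl] <-] zs]] := clz _ _ cz nz.
  by move: sl; rewrite lt_min => /andP[? ?]; exists s; rewrite ?s0.
have zc (s : R) : 0 < s < l -> mdist z (c s) <= s.
  move=> sI; apply/ler_addgt0Pl => e e0; have /andP[s0 sl] := sI.
  have h0 : 0 < Num.min (e / 2) s by rewrite lt_min s0 divr_gt0.
  have [t [tI]] := near _ h0; rewrite !lt_min => /andP[te ts] /andP[zt _].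
  apply: (le_trans (metric_triangle _ (c t) _)).
  have := open_arc_mdist ac tI sI; rewrite distrC gtr0_norm ?subr_gt0// => h.
  have /andP[t0 _] := tI; lra.
exists z => //; apply: contrapT => nVz.
have [n [r [p [cs rV]]]] := small_star z; have [r0 _ _ _] := cs.
have rV' y : mdist z y < r -> ~ V y by move=> /rV h Vy; apply: nVz; rewrite -(h Vy).
have [s1 [s1I s1r] zs1] := near r r0.
have Az : comp x0 z.
  have : comp z (c s1) by exact: ball_in_component cs rV' _ zs1.
  have : comp x0 (c s1) by rewrite -cA; exists s1; rewrite //= in_itv.
  by move=> h1 /connected_component_sym h2; exact: connected_component_trans h1 h2.
move: (Az); rewrite -{1}cA => -[t1]; rewrite /= in_itv /= => t1I zE.
have [r1 [[r10 r1t r1l] [ri rb]]] := open_arc_local ac t1I.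
have h0 : 0 < Num.min r1 (t1 / 2) by rewrite lt_min r10 divr_gt0//; case/andP: t1I.
have [s [sI]] := near _ h0; rewrite !lt_min -zE => /andP[sr st] /andP[h1 h2].
have [s' s'r cs'] := rb _ h1.
have ss' : s = s'.
  apply: (open_arc_inj ac sI) cs'; move: s'r; rewrite ltr_norml => /andP[? ?]; apply/andP; split; lra.
have := zc s sI; rewrite -zE ri ?subrr ?normr0//; last by rewrite ss'.
move/andP: sI => [s0 _]; rewrite gtr0_norm; lra.
Unshelve. all: by end_near. Qed.

End VertexSets.

(** * Oriented edges as parametrized arcs *)

Section OrientedEdges.
Context {R : realType} {X : metricType R} {V : set X}.
Implicit Types e : oedge V.

Lemma elen_gt0 e : 0 < elen e.
Proof. by have [] := epar_arc e. Qed.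

Lemma oedge_ext e1 e2 : elen e1 = elen e2 -> epar e1 = epar e2 -> e1 = e2.
Proof.
case: e1 => l1 p1 a1 b1 c1 d1 f1 g1 h1; case: e2 => l2 p2 a2 b2 c2 d2 f2 g2 h2 /=.
by move=> ll pp; subst l2 p2; congr OEdge; exact: Prop_irrelevance.
Qed.

Lemma erevK : involutive (@erev R X V).
Proof.
move=> e; apply: oedge_ext => //; apply/funext => t /=.
by rewrite opprB addrC subrK.
Qed.

Lemma epar_notV e t : 0 < t < elen e -> ~ V (epar e t).
Proof.
move=> tI; have [x nVx E] := epar_comp e.
have : (epar e @` `]0, elen e[) (epar e t) by exists t; rewrite //= in_itv.
by rewrite E => /connected_component_sub.
Qed.

Lemma oedge_inj e (s t : R) : 0 < s < elen e -> 0 < t < elen e -> epar e s = epar e t -> s = t.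
Proof. exact: open_arc_inj (epar_arc e). Qed.

Lemma erev_neq e : erev e <> e.
Proof.
move=> E; have := elen_gt0 e => l0.
have : epar (erev e) (elen e / 3) = epar e (elen e / 3) by rewrite E.
move=> /= /oedge_inj h.
have : elen e - elen e / 3 = elen e / 3 by apply: h; apply/andP; split; lra.
lra.
Qed.

Lemma einit_erev e : einit (erev e) = eterm e.
Proof. by rewrite /einit /eterm /= subr0. Qed.

Lemma eterm_erev e : eterm (erev e) = einit e.
Proof. by rewrite /einit /eterm /= subrr. Qed.

Lemma epar_clamp e t : epar e t = epar e (clamp 0 (elen e) t).
Proof.
have l0 := ltW (elen_gt0 e).
have [t0|t0] := leP t 0; first by rewrite clamp_le// epar_le0.
have [tl|tl] := leP (elen e) t; first by rewrite clamp_ge// epar_ge.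
by rewrite clamp_id// !ltW.
Qed.

(** The bound is known inside the open interval; parameters are pushed inside by a small [d], and
    continuity at the ends does the rest. *)
Lemma epar_lipschitz e (s t : R) : mdist (epar e s) (epar e t) <= `|s - t|.
Proof.
have l0 := elen_gt0 e.
pose c d (u : R) := clamp d (elen e - d) u.
have cI d u : 0 < d <= elen e / 2 -> 0 < c d u < elen e.
  move=> /andP[d0 dl]; have : d <= c d u <= elen e - d by apply: clamp_itv; lra.
  by move=> /andP[? ?]; apply/andP; split; lra.
have cc d u : 0 < d <= elen e / 2 -> `|clamp 0 (elen e) u - c d u| <= d.
  move=> /andP[d0 dl]; rewrite /c.
  have [h|h] := leP u d.
    rewrite (@clamp_le _ d)//; last by lra.
    have [h0|h0] := leP u 0; first by rewrite (clamp_le (ltW l0) h0) sub0r normrN gtr0_norm.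
    rewrite clamp_id; last by apply/andP; split; lra.
    by rewrite ler_norml; apply/andP; split; lra.
  have [h'|h'] := leP (elen e - d) u.
    rewrite (@clamp_ge _ d)//; last by lra.
    have [h0|h0] := leP (elen e) u.
      by rewrite clamp_ge ?(ltW l0)// ler_norml; apply/andP; split; lra.
    rewrite clamp_id; last by apply/andP; split; lra.
    by rewrite ler_norml; apply/andP; split; lra.
  rewrite !clamp_id; try by apply/andP; split; lra.
  by rewrite subrr normr0 ltW.
apply/ler_addgt0Pl => eps eps0; rewrite (epar_clamp e s) (epar_clamp e t).
have e20 : 0 < eps / 2 by rewrite divr_gt0.
have e2 := e20.
have cont : continuous (epar e) by exact: epar_cont.
have [d1 d10 D1] := (continuous_normP _ _).1 (cont (clamp 0 (elen e) s)) _ e2.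
have [d2 d20 D2] := (continuous_normP _ _).1 (cont (clamp 0 (elen e) t)) _ e2.
have [d d0 [dl dd1 dd2]] : exists2 d : R, 0 < d & [/\ d <= elen e / 2, d < d1 & d < d2].
  pose m := Num.min (Num.min d1 d2) (elen e).
  have m0 : 0 < m by rewrite !lt_min d10 d20.
  have m1 : m <= d1 by rewrite !ge_min lexx.
  have m2 : m <= d2 by rewrite !ge_min lexx !orbT.
  have m3 : m <= elen e by rewrite !ge_min lexx !orbT.
  by exists (m / 2); [rewrite divr_gt0|split; clearbody m; lra].
have dI : 0 < d <= elen e / 2 by rewrite d0.
have h1 := D1 _ (le_lt_trans (cc d s dI) dd1).
have h2 := D2 _ (le_lt_trans (cc d t dI) dd2).
have h3 := open_arc_mdist (epar_arc e) (cI d s dI) (cI d t dI).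
have h4 : `|c d s - c d t| <= `|s - t| by apply: clamp_lip; lra.
apply: (le_trans (metric_triangle _ (epar e (c d s)) _)).
apply: (@le_trans _ _ (eps / 2 + (`|s - t| + eps / 2))); last by lra.
apply: lerD; first exact: ltW.
apply: (le_trans (metric_triangle _ (epar e (c d t)) _)).
by apply: lerD; [exact: le_trans h4|rewrite metric_sym ltW].
Qed.

Lemma eset_component e t : 0 < t < elen e ->
  eset e = connected_component (~` V) (epar e t).
Proof.
move=> tI; have [x nVx E] := epar_comp e; rewrite /eset E.
apply: same_connected_component; rewrite -E.
by exists t; rewrite //= in_itv.
Qed.

(** A common interior point forces the same component as support. The change of parameter [u] is
    then an isometry of one interval onto the other, hence the identity or the reflection. *)
Lemma oedge_eq e1 e2 (s t : R) : 0 < s < elen e1 -> 0 < t < elen e2 ->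
  epar e1 s = epar e2 t -> e1 = e2 /\ s = t \/ e1 = erev e2 /\ s = elen e2 - t.
Proof.
move=> sI tI st; have EE : eset e1 = eset e2.
  by rewrite (eset_component sI) (eset_component tI) st.
have [l10 _ d1] := epar_arc e1; have [l20 _ d2] := epar_arc e2.
have /choice[u uP] : forall v : R, exists w : R, 0 < v < elen e1 -> 0 < w < elen e2 /\ epar e1 v = epar e2 w.
  move=> v; have [vI|nv] := pselect (0 < v < elen e1); last by exists 0.
  have : eset e1 (epar e1 v) by exists v; rewrite //= in_itv.
  by rewrite EE => -[w /=]; rewrite in_itv /= => wI E; exists w.
have uiso (v w : R) : 0 < v < elen e1 -> 0 < w < elen e1 -> `|u v - u w| = `|v - w|.
  move=> vI wI; have [uv ev] := uP v vI; have [uw ew] := uP w wI.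
  have := d1 v w; rewrite /= !in_itv /= => /(_ vI wI).
  have := d2 (u v) (u w); rewrite /= !in_itv /= => /(_ uv uw).
  by rewrite -ev -ew -/(eset e1) -/(eset e2) EE => -> [].
have usurj (w : R) : 0 < w < elen e2 -> exists2 v, 0 < v < elen e1 & u v = w.
  move=> wI; have : eset e2 (epar e2 w) by exists w; rewrite //= in_itv.
  rewrite -EE => -[v /=]; rewrite in_itv /= => vI E; exists v => //.
  by have [uI E'] := uP v vI; apply: (oedge_inj uI wI); rewrite -E'.
have key e3 : elen e1 = elen e3 -> (forall v : R, 0 < v < elen e1 -> epar e1 v = epar e3 v) -> e1 = e3.
  move=> ll E; apply: oedge_ext => //; apply/funext => v.
  rewrite (epar_clamp e1) (epar_clamp e3) -ll.
  apply: (eq_on_closed_itv l10) => //; try exact: epar_cont.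
  exact: clamp_itv (ltW l10).
have lens c : (forall v : R, 0 < v < elen e1 -> u v = c + v) \/ (forall v : R, 0 < v < elen e1 -> u v = c - v) -> 
    (forall v : R, 0 < v < elen e1 -> 0 < u v < elen e2) -> elen e1 = elen e2.
  move=> h uI; apply/eqP; rewrite eq_le; apply/andP; split.
    rewrite leNgt; apply/negP => ll; pose d := (elen e1 - elen e2) / 3.
    have I1 : 0 < d < elen e1 by rewrite /d; apply/andP; split; lra.
    have I2 : 0 < elen e1 - d < elen e1 by rewrite /d; apply/andP; split; lra.
    move: (uI _ I1) (uI _ I2) => /andP[? ?] /andP[? ?].
    by case: h => h; move: (h _ I1) (h _ I2); rewrite /d in I1 I2 *; lra.
  rewrite leNgt; apply/negP => ll; pose d := (elen e2 - elen e1) / 3.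
  have I1 : 0 < d < elen e2 by rewrite /d; apply/andP; split; lra.
  have I2 : 0 < elen e2 - d < elen e2 by rewrite /d; apply/andP; split; lra.
  have [v1 /andP[? ?] E1] := usurj _ I1; have [v2 /andP[? ?] E2] := usurj _ I2.
  have V1 : 0 < v1 < elen e1 by apply/andP.
  have V2 : 0 < v2 < elen e1 by apply/andP.
  by case: h => h; move: (h _ V1) (h _ V2); rewrite E1 E2 /d; lra.
have uI v : 0 < v < elen e1 -> 0 < u v < elen e2 by move=> /uP[].
have [c hc] := itv_isometry l10 uiso.
have ll := lens c hc uI.
(* A translation that maps an interval into one of the same length with the same origin is
   trivial. *)
have bnd (x : R) : (forall y : R, 0 < y < elen e1 -> 0 < x + y < elen e2) -> x = 0.
  move=> h; apply/eqP; rewrite eq_le; apply/andP; split.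
    rewrite leNgt; apply/negP => x0; pose y := Num.max (elen e1 - x) (elen e1 / 2).
    have y1 : elen e1 - x <= y by rewrite le_max lexx.
    have y2 : elen e1 / 2 <= y by rewrite le_max lexx orbT.
    have y3 : y < elen e1 by rewrite gt_max; apply/andP; split; lra.
    have /h/andP[? ?] : 0 < y < elen e1 by apply/andP; split; lra.
    by lra.
  rewrite leNgt; apply/negP => x0; pose y := Num.min (- x) (elen e1 / 2).
  have y1 : y <= - x by rewrite ge_min lexx.
  have y2 : y <= elen e1 / 2 by rewrite ge_min lexx orbT.
  have y3 : 0 < y by rewrite lt_min; apply/andP; split; lra.
  have /h/andP[? ?] : 0 < y < elen e1 by apply/andP; split; lra.
  by lra.
have [hc1|hc1] := hc.
  have c0 : c = 0 by apply: bnd => y yI; rewrite -hc1// uI.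
  have E12 : e1 = e2.
    by apply: key => // v vI; have [_ ->] := uP v vI; rewrite hc1// c0 add0r.
  left; split => //; apply: (oedge_inj sI); rewrite ?st E12//.
have c0 : c - elen e2 = 0.
  apply: bnd => y /andP[y0 y1].
  have yI : 0 < elen e1 - y < elen e1 by apply/andP; split; lra.
  by have := uI _ yI; rewrite hc1//; move=> /andP[? ?]; apply/andP; split; lra.
have E12 : e1 = erev e2.
  apply: key => // v vI; have [_ ->] := uP v vI; rewrite hc1//=.
  by congr epar; lra.
right; split => //; have tI' : 0 < elen e2 - t < elen e1.
  by rewrite ll; move/andP: tI => [? ?]; apply/andP; split; lra.
apply: (oedge_inj sI tI'); rewrite {2}E12 /= opprB addrC subrK //.
Qed.

End OrientedEdges.

(** * Charts made of edges and finiteness of compact models *)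

Section EdgeCharts.
Context {R : realType} {X : metricType R} {V : set X}.
Hypothesis mg : metric_graph X.
Hypothesis vs : vertex_set V.

(** A component comes with a parametrization of an open interval only; its two limits, which exist
    by compactness, complete it to an oriented edge. *)
Lemma oedge_exists x : compact [set: X] -> ~ V x -> exists e : oedge V, eset e x.
Proof.
move=> cX nVx; have [_ _ Varc] := vs; have [l [c ac]] := Varc x nVx.
have [l0 cA cd] := ac.
have [z0 Vz0 d0] := open_arc_end mg vs cX ac.
have [z1 Vz1 d1] := open_arc_end mg vs cX (open_arc_rev ac).
pose f (t : R) := if t == 0 then z0 else if t == l then z1 else c t.
have fc (t : R) : 0 < t < l -> f t = c t.
  by move=> /andP[h1 h2]; rewrite /f gt_eqF// lt_eqF.
have f0 : f 0 = z0 by rewrite /f eqxx.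
have fl : f l = z1 by rewrite /f gt_eqF// eqxx.
have d1' (s : R) : 0 < s < l -> mdist z1 (c s) <= l - s.
  move=> /andP[h1 h2]; have := d1 (l - s); rewrite subKr; apply.
  by apply/andP; split; lra.
have fL (s t : R) : 0 <= s <= l -> 0 <= t <= l -> mdist (f s) (f t) <= 1 * `|s - t|.
  rewrite mul1r => /andP[s0 sl] /andP[t0 tl].
  wlog st : s t s0 sl t0 tl / s <= t.
    move=> H; have [|/ltW] := leP s t; first exact: H.
    by rewrite metric_sym distrC; exact: H.
  rewrite distrC ger0_norm ?subr_ge0//.
  have [s00|s0'] := eqVneq s 0; have [t1|t1'] := eqVneq t l.
  - have hI : 0 < l / 2 < l by apply/andP; split; lra.
    rewrite s00 t1 f0 fl; apply: le_trans (metric_triangle _ (c (l / 2)) _) _.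
    by have := d0 _ hI; have := d1' _ hI; rewrite [mdist z1 _]metric_sym; lra.
  - have [t00|t0'] := eqVneq t 0; first by rewrite s00 t00 mdistxx subrr.
    have tI : 0 < t < l by rewrite !lt_neqAle t0 tl t1' [0 == _]eq_sym t0'.
    by rewrite s00 f0 fc// subr0 d0.
  - have [s1|s1'] := eqVneq s l; first by rewrite s1 t1 mdistxx subrr.
    have sI : 0 < s < l by rewrite !lt_neqAle s0 sl s1' [0 == _]eq_sym s0'.
    by rewrite t1 fl fc// metric_sym d1'.
  - have sI : 0 < s < l by rewrite lt_neqAle s0 [0 == _]eq_sym s0' /= (le_lt_trans st)// lt_neqAle tl t1'.
    have tI : 0 < t < l by rewrite [t < l]lt_neqAle tl t1' andbT (lt_le_trans _ st)//; case/andP: sI.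
    rewrite !fc//; have := open_arc_mdist ac sI tI; rewrite distrC ger0_norm// subr_ge0//.
pose g t := f (clamp 0 l t).
have gc (t : R) : 0 < t < l -> g t = c t.
  by move=> /andP[h1 h2]; rewrite /g clamp_id ?ltW// fc// h1.
have gimg : g @` `]0, l[ = c @` `]0, l[.
  by apply/seteqP; split => _ [t tI <-]; exists t => //; rewrite gc.
have g0 : g 0 = z0 by rewrite /g clamp_le// ltW.
have gl : g l = z1 by rewrite /g clamp_ge// ltW.
unshelve eexists (@OEdge R X V l g _ _ _ _ _ _ _).
- exact: lipschitz_continuous (lipschitz_clamp (ltW l0) ler01 fL).
- by move=> t t0; rewrite /g !clamp_le// ltW.
- by move=> t t0; rewrite /g !clamp_ge// ltW.
- split=> // s t sI tI; rewrite !gc// gimg cA cd//.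
- by exists x => //; rewrite gimg cA.
- by rewrite g0.
- by rewrite gl.
- change ((g @` `]0, l[) x); rewrite gimg cA; exact: connected_component_refl.
Qed.

Hypothesis HE : forall x, ~ V x -> exists e : oedge V, eset e x.

(** A star whose rays are pieces of oriented edges. In the charts constructed below all [a k] are 0
    at a vertex, and inside an edge the two rays follow the edge and its reverse. The last clause
    ensures that a centre which is not a vertex lies on some ray. *)
Definition edge_chart (x : X) (n : nat) (r : R) (e : 'I_n -> oedge V) (a : 'I_n -> R) : Prop :=
  [/\ cstar x r (fun k t => epar (e k) (a k + t)),
      forall k, 0 <= a k, forall k, a k + r <= elen (e k) &
      ~ V x -> exists k : 'I_n, True].

Lemma oedge_local (e : oedge V) (t0 : R) : 0 < t0 < elen e ->
  exists r : R, [/\ 0 < r, r <= t0 & r <= elen e - t0] /\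
   (forall s t : R, `|t0 - s| < r -> `|t0 - t| < r -> mdist (epar e s) (epar e t) = `|s - t|) /\
   (forall y, mdist (epar e t0) y < r -> exists2 s : R, `|t0 - s| < r & y = epar e s).
Proof.
move=> tI; have := epar_arc e; rewrite -/(eset e) (eset_component tI) => ac.
exact: open_arc_local mg vs _ _ _ _ ac tI.
Qed.

(** The open ray is connected and avoids [V], so it lies in one edge, and its change of parameter is
    a translation or a reflection. As the ray starts at a vertex, the offset is an end of that edge;
    the orientation is chosen to make it the initial one. *)
Lemma ray_edge x n r (p : 'I_n -> R -> X) k : V x -> cstar x r p ->
  (forall y, mdist x y < r -> V y -> y = x) ->
  exists e : oedge V, [/\ einit e = x, r <= elen e & forall t : R, 0 <= t < r -> p k t = epar e t].
Proof.
move=> Vx cs rV; have [r0 px py pd] := cs.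
have nV (t : R) : 0 < t < r -> ~ V (p k t).
  move=> /andP[t0 tr] Vp; have tI : 0 <= t < r by rewrite ltW.
  have := cstar_dist k cs tI; rewrite (rV _ _ Vp) ?mdistxx ?(cstar_dist _ cs tI)//.
  by move=> t00; move: t0; rewrite -t00 ltxx.
have rI : 0 < r / 2 < r by apply/andP; split; lra.
have [e [t1 + E1]] := HE (nV _ rI); rewrite /= in_itv /= => t1I.
have pdk (s t : R) : 0 < s < r -> 0 < t < r -> mdist (p k s) (p k t) = `|s - t|.
  by move=> /andP[s0 sr] /andP[t0 tr]; rewrite pd ?(ltW s0) ?(ltW t0)// /star_dist eqxx.
have cp (t : R) : 0 < t < r -> {for t, continuous (p k)}.
  move=> tI; apply/continuous_normP => eps eps0; move/andP: (tI) => [h1 h2].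
  exists (Num.min eps (Num.min t (r - t))); first by rewrite !lt_min eps0 h1 subr_gt0.
  move=> s; rewrite !lt_min => /andP[s1 /andP[s2 s3]]; rewrite pdk//.
  by move: s2 s3; rewrite !ltr_norml => /andP[? ?] /andP[? ?]; apply/andP; split; lra.
have inE (t : R) : 0 < t < r -> eset e (p k t).
  move=> tI; rewrite (eset_component t1I) E1.
  apply: (@connected_component_max _ _ (p k @` [set` `]0, r[]) (p k (r / 2))).
  - by exists (r / 2); rewrite //= in_itv.
  - by move=> _ [s /= + <-]; rewrite in_itv /=; exact: nV.
  - by apply: connected_image_itv => s; rewrite /= in_itv /=; exact: cp.
  - by exists t; rewrite //= in_itv.
have [l0 _ ed] := epar_arc e.
have /choice[u uP] : forall v : R, exists w : R, 0 < v < r -> 0 < w < elen e /\ p k v = epar e w.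
  move=> v; have [vI|nv] := pselect (0 < v < r); last by exists 0.
  have [w /=] := inE _ vI; rewrite in_itv /= => wI E; by exists w.
(* The piece of ray between the two points is a path inside the edge and bounds the path distance
   from above; the distance in the star bounds it from below. *)
have uiso (v w : R) : 0 < v < r -> 0 < w < r -> `|u v - u w| = `|v - w|.
  move=> vI wI; have [uv ev] := uP v vI; have [uw ew] := uP w wI.
  apply/eqP; rewrite eq_le; apply/andP; split.
    rewrite -lee_fin -ed ?/= ?in_itv//= -ev -ew.
    have cI (t : R) : 0 < v + (w - v) * clamp 0 1 t < r.
      have : 0 <= clamp (0 : R) 1 t <= 1 by apply: clamp_itv.
      move: (clamp 0 1 t) => z /andP[z0 z1]; move/andP: vI => [? ?]; move/andP: wI => [? ?].
      have z1' : 0 <= 1 - z by rewrite subr_ge0.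
      have [vw|/ltW vw] := leP v w.
        have vw' : 0 <= w - v by rewrite subr_ge0.
        by have := mulr_ge0 vw' z0; have := mulr_ge0 vw' z1' => *; apply/andP; split; lra.
      have vw' : 0 <= v - w by rewrite subr_ge0.
      by have := mulr_ge0 vw' z0; have := mulr_ge0 vw' z1' => *; apply/andP; split; lra.
    apply: (@path_dist_le _ _ _ _ _ (fun t => p k (v + (w - v) * clamp 0 1 t))) => //.
    + move=> s t; rewrite pdk// [v + _]addrC addrKA -mulrBr normrM distrC.
      by rewrite ler_wpM2l// clamp_lip.
    + by rewrite clamp_le// mulr0 addr0.
    + by rewrite clamp_ge// mulr1 addrC subrK.
    + by move=> t _; exact: inE.
  rewrite -pdk// -lee_fin -ed ?/= ?in_itv//= -ev -ew; exact: path_dist_ge.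
have [c hc] := itv_isometry r0 uiso.
have ec : epar e c = x.
  apply: mdist_positivity; apply/eqP; rewrite eq_le mdist_ge0 andbT.
  apply/ler_addgt0Pl => eps eps0; rewrite addr0.
  pose t := Num.min (eps / 2) (r / 2).
  have t0 : 0 < t by rewrite lt_min !divr_gt0.
  have t2 : t <= eps / 2 by rewrite ge_min lexx.
  have t3 : t <= r / 2 by rewrite ge_min lexx orbT.
  have tI : 0 < t < r by apply/andP; split; lra.
  have [_ Et] := uP t tI.
  apply: (le_trans (metric_triangle _ (p k t) _)).
  have h1 : mdist (p k t) x = t by rewrite metric_sym (cstar_dist _ cs)// ltW//; case/andP: tI.
  have h2 : mdist (epar e c) (p k t) <= t.
    rewrite Et; apply: le_trans (epar_lipschitz _ _ _) _.
    case: hc => ->//.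
      by rewrite opprD addrA subrr sub0r normrN gtr0_norm.
    by rewrite opprB addrC subrK gtr0_norm.
  by rewrite h1; lra.
have nc : ~ (0 < c < elen e) by move=> /epar_notV; rewrite ec.
have sm (b : R) : 0 < b -> exists t : R, [/\ 0 < t, t < r & t < b].
  move=> b0; exists (Num.min b r / 2).
  have h : 0 < Num.min b r by rewrite lt_min b0.
  have h1 : Num.min b r <= b by rewrite ge_min lexx.
  have h2 : Num.min b r <= r by rewrite ge_min lexx orbT.
  by split; lra.
have cl : 0 <= c <= elen e.
  apply/andP; split; rewrite leNgt; apply/negP => h.
    have [|t [t0 tr tc]] := sm (- c); first by rewrite oppr_gt0.
    have tI : 0 < t < r by rewrite t0.
    have [/andP[u1 u2] _] := uP t tI; case: hc => hc; move: u1 u2; rewrite hc//; lra.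
  have [|t [t0 tr tc]] := sm (c - elen e); first by rewrite subr_gt0.
  have tI : 0 < t < r by rewrite t0.
  have [/andP[u1 u2] _] := uP t tI; case: hc => hc; move: u1 u2; rewrite hc//; lra.
have [hc1|hc1] := hc.
  have c0 : c = 0.
    apply/eqP; rewrite eq_sym eq_le; move/andP: (cl) => [-> cl2] /=; rewrite leNgt; apply/negP => cp0.
    apply: nc; rewrite cp0 /= lt_neqAle cl2 andbT; apply/eqP => cE.
    have [/andP[_ u2] _] := uP _ rI; move: u2; rewrite hc1//; lra.
  exists e; split.
  - by rewrite /einit -c0.
  - rewrite leNgt; apply/negP => lr.
    have lI : 0 < elen e < r by rewrite elen_gt0.
    by have [/andP[_ u2] _] := uP _ lI; move: u2; rewrite hc1// c0 add0r ltxx.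
  - move=> t /andP[]; rewrite le_eqVlt => /predU1P[<- _|t0 tr].
      by rewrite px -ec c0.
    by have [_ ->] := uP t (introT andP (conj t0 tr)); rewrite hc1 ?t0// c0 add0r.
have c0 : c = elen e.
  apply/eqP; rewrite eq_le; move/andP: (cl) => [cl1 ->] /=; rewrite leNgt; apply/negP => cp0.
  apply: nc; rewrite cp0 andbT lt_neqAle cl1 andbT; apply/eqP => cE.
  have [/andP[u1 _] _] := uP _ rI; move: u1; rewrite hc1//; lra.
exists (erev e); split.
- by rewrite einit_erev /eterm -c0.
- rewrite leNgt; apply/negP => lr.
  have lI : 0 < elen e < r by rewrite elen_gt0.
  by have [/andP[u1 _] _] := uP _ lI; move: u1; rewrite hc1// c0 subrr ltxx.
- move=> t /andP[]; rewrite le_eqVlt => /predU1P[<- _|t0 tr].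
    by rewrite /= px -ec c0 subr0.
  by have [_ ->] := uP t (introT andP (conj t0 tr)); rewrite hc1 ?t0// c0.
Qed.

Lemma edge_chart_exists x : exists n r (e : 'I_n -> oedge V) (a : 'I_n -> R), edge_chart x r e a.
Proof.
have [Vx|nVx] := pselect (V x).
  have [n [r [p [cs rV]]]] := small_star mg vs x.
  have /choice[e eP] := fun k => ray_edge k Vx cs rV.
  have [r0 px py pd] := cs.
  exists n, r, e, (fun=> 0); split => //.
    split=> //.
    - by move=> k; rewrite add0r; have [] := eP k.
    - move=> y /py[|[k [t [/andP[t0 tr] ->]]]]; first by left.
      right; exists k, t; rewrite t0 tr add0r; split=> //.
      by have [_ _ ->] := eP k; rewrite // ltW.
    - move=> k l s t sI tI; rewrite !add0r -pd//.
      by have [_ _ ->] := eP k => //; have [_ _ ->] := eP l.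
  by move=> k; rewrite add0r; have [] := eP k.
have [e [t0 + xE]] := HE nVx; rewrite /= in_itv /= => t0I.
have [r [[r0 r1 r2] [ri rb]]] := oedge_local t0I.
pose e' (k : 'I_2) := if k == ord0 then e else erev e.
pose a (k : 'I_2) := if k == ord0 then t0 else elen e - t0.
exists 2%N, r, e', a; move/andP: (t0I) => [h1 h2]; split.
- split=> //.
  + move=> k; rewrite /e' /a; case: ifP => _; first by rewrite addr0.
    by rewrite /= addr0 opprB addrC subrK.
  + move=> y; rewrite -xE => /rb[s]; rewrite ltr_norml => /andP[s1 s2] ->.
    have [st|st|->] := ltgtP s t0; last by left.
      right; exists (lift ord0 ord0), (t0 - s); split; first by apply/andP; split; lra.
      by rewrite /e' /a /=; congr epar; lra.
    right; exists ord0, (s - t0); split; first by apply/andP; split; lra.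
    by rewrite /e' /a /=; congr epar; lra.
  + have kE k s : epar (e' k) (a k + s) = epar e (t0 + (if k == ord0 then s else - s)).
      by rewrite /e' /a; case: ifP => _ //=; congr epar; lra.
    move=> k l s t /andP[s0 sr] /andP[tp tr]; rewrite !kE.
    have kl : (k == l) = ((k == ord0) == (l == ord0)).
      by case: k => -[|[|]]//= ?; case: l => -[|[|]].
    rewrite /star_dist kl ri.
    * case: (k == ord0); case: (l == ord0) => /=.
      - by congr `|_|; ring.
      - by rewrite ger0_norm; lra.
      - by rewrite distrC ger0_norm; lra.
      - by rewrite distrC; congr `|_|; ring.
    * by rewrite opprD addrA subrr sub0r normrN; case: ifP => _; rewrite ?normrN ger0_norm.
    * by rewrite opprD addrA subrr sub0r normrN; case: ifP => _; rewrite ?normrN ger0_norm.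
- by move=> k; rewrite /a; case: ifP => _; lra.
- by move=> k; rewrite /a /e'; case: ifP => _ /=; lra.
- by move=> _; exists ord0.
Qed.

(** Connectedness passes from the space to the model. [F] is extended to the interior of an edge by
    its value at the initial vertex; as the hypothesis applies to both orientations, this is
    unambiguous and locally constant. *)
Lemma vertex_connected (F : X -> Prop) :
  (forall e : oedge V, F (einit e) -> F (eterm e)) ->
  forall x y, V x -> V y -> F x -> F y.
Proof.
move=> Fe; have [_ cX _] := mg.
pose G z := (V z /\ F z) \/ exists (e : oedge V) (t : R), [/\ 0 < t < elen e, z = epar e t & F (einit e)].
have GE (e : oedge V) (t : R) : 0 <= t < elen e -> G (epar e t) <-> F (einit e).
  move=> /andP[]; rewrite le_eqVlt => /predU1P[<- _|t0 tl].
    split=> [[[_ //]|[e' [t' [t'I E _]]]]|]; last by left; split=> //; exact: epar_init.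
    by have := epar_notV t'I; rewrite -E => -[]; exact: epar_init.
  have tI : 0 < t < elen e by rewrite t0.
  split=> [[[Vt _]|[e' [t' [t'I E Fe']]]]|]; last by right; exists e, t.
    by have := epar_notV tI.
  have [[-> _]//|[-> _]] := oedge_eq tI t'I E.
  by rewrite einit_erev; exact: Fe.
have lc x : [set: X] x -> \forall y \near x, [set: X] y -> (G x <-> G y).
  move=> _; have [n [r [e [a [[r0 px py _] a0 ar _]]]]] := edge_chart_exists x.
  apply/nbhs_mdist; exists r => // y /py[->//|[k [t [/andP[t0 tr] ->]]] _].
  have h1 : 0 <= a k < elen (e k) by rewrite a0 /=; have := ar k; lra.
  have h2 : 0 <= a k + t < elen (e k) by have := a0 k; have := ar k => *; apply/andP; split; lra.
  have := GE _ _ h1; have := GE _ _ h2; rewrite -[a k]addr0 px addr0; tauto.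
move=> x y Vx Vy Fx; have : G y.
  by apply: (connected_locally_constant cX lc (x := x)) => //; left.
by move=> [[]//|[e [t [tI E _]]]]; have := epar_notV tI; rewrite -E.
Qed.

(** A chart contains at most one vertex and meets finitely many edges; finitely many charts cover
    the space. *)
Lemma finite_model : compact [set: X] ->
  exists (sV : seq X) (sE : seq (oedge V)),
    (forall x, V x -> x \in sV) /\ (forall e : oedge V, e \in sE).
Proof.
move=> cX.
have /choice[f fP] : forall x, exists rl : R * seq (oedge V), [/\ 0 < rl.1,
    forall y, mdist x y < rl.1 -> V y -> y = x &
    forall (e : oedge V) (t : R), 0 < t < elen e -> mdist x (epar e t) < rl.1 -> e \in rl.2].
  move=> x; have [n [r [e [a [cs a0 ar nV]]]]] := edge_chart_exists x.
  have [r0 px py _] := cs.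
  exists (r, [seq e k | k <- enum 'I_n] ++ [seq erev (e k) | k <- enum 'I_n]); split=> //=.
    move=> y /py[//|[k [t [/andP[t0 tr] ->]]]] /(epar_notV _)[].
    by have := a0 k; have := ar k => *; apply/andP; split; lra.
  have key k (t t' : R) e' : 0 < t < elen e' -> 0 <= t' < r -> epar e' t = epar (e k) (a k + t') ->
      e' \in [seq e k | k <- enum 'I_n] ++ [seq erev (e k) | k <- enum 'I_n].
    move=> tI /andP[t'0 t'r] E.
    have h1 : 0 < a k + t' < elen (e k).
      rewrite lt_neqAle; have := a0 k; have := ar k => h2 h3.
      apply/andP; split; last by lra.
      rewrite addr_ge0// andbT; apply/eqP => h4.
      have := epar_notV tI; rewrite E -h4; apply; exact: epar_init.
    have [[-> _]|[-> _]] := oedge_eq tI h1 E; rewrite mem_cat; apply/orP.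
      by left; apply/mapP; exists k; rewrite ?mem_enum.
    by right; apply/mapP; exists k; rewrite ?mem_enum.
  move=> e' t tI /py[|[k [t' [/andP[t0 tr] E]]]]; last first.
    by apply: (key k t t') => //; rewrite ltW.
  move=> E; have [k _] := nV (fun Vx => epar_notV tI (eq_ind_r V Vx E)).
  by apply: (key k t 0) => //; [rewrite lexx|rewrite px].
have nW x : nbhs x [set y | mdist x y < (f x).1].
  by apply/nbhs_mdist; exists (f x).1 => //; have [] := fP x.
have [D DP] := compact_finite_cover cX nW.
exists D, (flatten [seq (f x).2 | x <- D]); split.
  move=> y Vy; have [x xD xy] := DP y; have [_ h _] := fP x.
  by rewrite (h _ xy Vy).
move=> e; have l0 := elen_gt0 e.
have tI : 0 < elen e / 2 < elen e by apply/andP; split; lra.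
have [x xD xy] := DP (epar e (elen e / 2)); have [_ _ h] := fP x.
apply/flattenP; exists (f x).2; last exact: h tI xy.
by apply/mapP; exists x.
Qed.

End EdgeCharts.

(** * Discrete parallel transport *)

Section UniformContinuity.
Context {R : realType}.

Lemma compact_unif_continuous (T : pseudoMetricType R) (X : metricType R) (K : set T) (f : T -> X) :
  compact K -> {within K, continuous f} -> forall eps : R, 0 < eps ->
  exists2 d : R, 0 < d & forall z w, K z -> K w -> ball z d w -> mdist (f z) (f w) < eps.
Proof.
move=> cK /subspace_continuousP cf eps eps0.
have [|d d0 dP] := lebesgue_number (W := fun z => [set w | K w -> K z -> mdist (f z) (f w) < eps / 2]) cK.
  move=> z Kz; have := cf z Kz.
  move=> /(_ [set y | mdist (f z) y < eps / 2]) h.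
  have /h : nbhs (f z) [set y | mdist (f z) y < eps / 2].
    by apply/nbhs_mdist; exists (eps / 2) => //; rewrite divr_gt0.
  by apply: (@filterS _ (nbhs z)) => w /= + Kw _; exact.
exists d => // z w Kz Kw zw; have [y Ky yP] := dP z Kz.
have h1 := yP z (ballxx _ d0) Kz Ky; have h2 := yP w zw Kw Ky.
apply: le_lt_trans (metric_triangle _ (f y) _) _.
by rewrite [eps]splitr ltrD// metric_sym.
Qed.

Lemma small_mesh (d : R) : 0 < d -> exists n : nat, forall m, (n <= m)%N -> m.+1%:R^-1 < d.
Proof.
move=> d0; exists (Num.truncn d^-1) => m nm.
rewrite -[d]invrK ltf_pV2 ?posrE ?invr_gt0//.
by rewrite (lt_le_trans (truncnS_gt _))// ler_nat ltnS.
Qed.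

Lemma natr_dist_le1 i j : (j <= i.+1)%N -> (i <= j.+1)%N -> `|i%:R - j%:R : R| <= 1.
Proof.
rewrite -(ler_nat R) -natr1 => h; rewrite -(ler_nat R) -natr1 => h'.
by rewrite ler_norml; apply/andP; split; lra.
Qed.

End UniformContinuity.

Section DiscreteTransport.
Context {R : realType} {X : metricType R} {Y : Type}.
Variables (pi : Y -> X) (T : Y -> X -> Y) (lam : R).

(* A discrete form of a local system: points over [x] are transported to every
   [x'] at distance less than [lam], coherently on small triangles. *)
Definition transport_system : Prop :=
  [/\ 0 < lam,
      forall y x, mdist (pi y) x < lam -> pi (T y x) = x,
      forall y x x', mdist (pi y) x < lam -> mdist x x' < lam -> mdist (pi y) x' < lam ->
        T (T y x) x' = T y x' &
      forall y, T y (pi y) = y].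

Hypothesis TS : transport_system.

Fixpoint dtr (p : nat -> X) (n : nat) (y : Y) : Y :=
  if n is m.+1 then T (dtr p m y) (p m.+1) else y.

Lemma dtr_pi p n y : (forall i, (i < n)%N -> mdist (p i) (p i.+1) < lam) -> pi y = p 0%N ->
  pi (dtr p n y) = p n.
Proof.
have [_ T1 _ _] := TS; elim: n => //= n IH h py.
by apply: T1; rewrite IH ?h// => i /ltnW; exact: h.
Qed.

Lemma eq_dtr p q n y : (forall i, (i <= n)%N -> p i = q i) -> dtr p n y = dtr q n y.
Proof.
elim: n => //= n IH h; rewrite h// IH// => i /leqW; exact: h.
Qed.

(** One strip of a discrete homotopy. Each quadrilateral is cut by the diagonal from [p i] to
    [q i.+1] into two small triangles, where transport is coherent. *)
Lemma dtr_close p q n y : pi y = p 0%N ->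
  (forall i, (i < n)%N -> [/\ mdist (p i) (p i.+1) < lam, mdist (q i) (q i.+1) < lam
                       & mdist (p i) (q i.+1) < lam]) ->
  (forall i, (i <= n)%N -> mdist (p i) (q i) < lam) ->
  T (dtr p n y) (q n) = dtr q n (T y (q 0%N)).
Proof.
have [_ T1 T2 _] := TS; move=> py; elim: n => //= n IH h h'.
have [h1 h2 h3] := h n (ltnSn n).
have pn : pi (dtr p n y) = p n by apply: dtr_pi => // i /ltnW/h[].
rewrite -IH; [|by move=> i /ltnW/h|by move=> i /leqW/h'].
rewrite T2 ?pn//; last exact: h'.
by rewrite T2 ?pn//; exact: h'.
Qed.

Lemma dtr_add p m n y : dtr p (m + n) y = dtr (fun i => p (m + i)%N) n (dtr p m y).
Proof. by elim: n => [|n IH]; rewrite ?addn0//= addnS /= IH. Qed.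

Lemma dtr_small p n y : pi y = p 0%N ->
  (forall i j, (i <= n)%N -> (j <= n)%N -> mdist (p i) (p j) < lam) ->
  dtr p n y = T y (p n).
Proof.
have [_ T1 T2 T3] := TS; move=> py; elim: n => [|n IH] h /=; first by rewrite -py T3.
rewrite IH; last by move=> i j /leqW hi /leqW hj; exact: h.
by rewrite T2 ?py//; exact: h.
Qed.

Lemma dtr_refine p n m y : pi y = p 0%N ->
  (forall i j k, (i < n)%N -> (j <= m)%N -> (k <= m)%N ->
     mdist (p (i * m + j)%N) (p (i * m + k)%N) < lam) ->
  dtr p (n * m) y = dtr (fun i => p (i * m)%N) n y.
Proof.
move=> py; elim: n => //= n IH h.
have h' i j k : (i < n)%N -> (j <= m)%N -> (k <= m)%N ->
     mdist (p (i * m + j)%N) (p (i * m + k)%N) < lam by move=> /ltnW; exact: h.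
rewrite mulSnr dtr_add IH// dtr_small.
- by [].
- rewrite addn0 dtr_pi ?mul0n// => i in_.
  by have := h' i 0%N m in_ (leq0n m) (leqnn m); rewrite addn0 -mulSnr.
- by move=> i j im jm; exact: h.
Qed.

Lemma dtr_rev p n y : pi y = p 0%N -> (forall i, (i < n)%N -> mdist (p i) (p i.+1) < lam) ->
  dtr (fun i => p (n - i)%N) n (dtr p n y) = y.
Proof.
have [l0 T1 T2 T3] := TS; move=> py; elim: n => // n IH h.
rewrite -add1n dtr_add /= add1n subSS subn0.
have h' i : (i < n)%N -> mdist (p i) (p i.+1) < lam by move=> /ltnW; exact: h.
have pn : pi (dtr p n y) = p n by exact: dtr_pi.
rewrite T2 ?pn ?mdistxx//; [|exact: h|by rewrite metric_sym; exact: h].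
rewrite add0n -pn T3 -[RHS]IH//; apply: eq_dtr => i _; by rewrite subSS.
Qed.

(** The grid is swept one strip at a time by [dtr_close]. *)
Lemma dtr_square (x : nat -> nat -> X) n m y : pi y = x 0%N 0%N ->
  (forall i j i' j', (i <= n)%N -> (j <= m)%N -> (i' <= n)%N -> (j' <= m)%N ->
     (i' <= i.+1)%N -> (i <= i'.+1)%N -> (j' <= j.+1)%N -> (j <= j'.+1)%N ->
     mdist (x i j) (x i' j') < lam) ->
  dtr (x^~ m) n (dtr (x 0%N) m y) = dtr (x n) m (dtr (x^~ 0%N) n y).
Proof.
move=> py h; have H m' : (m' <= m)%N ->
    dtr (x^~ m') n (dtr (x 0%N) m' y) = dtr (x n) m' (dtr (x^~ 0%N) n y).
  elim: m' => //= m' IH mm; rewrite -IH; last exact: ltnW.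
  rewrite -(@dtr_close (x^~ m') (x^~ m'.+1))//.
  - apply: dtr_pi => // i im; apply: h => //; try lia.
  - by move=> i in_; split; apply: h; lia.
  - by move=> i in_; apply: h; lia.
exact: H.
Qed.

Definition mesh (p : R -> X) (n : nat) (i : nat) : X := p (i%:R / n.+1%:R).

Definition mesh_fine (p : R -> X) (n : nat) : Prop :=
  forall s t : R, 0 <= s <= 1 -> 0 <= t <= 1 -> `|s - t| <= n.+1%:R^-1 -> mdist (p s) (p t) < lam.

Lemma fineW p n m : (n <= m)%N -> mesh_fine p n -> mesh_fine p m.
Proof.
move=> nm fp s t sI tI st; apply: fp => //; apply: le_trans st _.
by rewrite lef_pV2 ?posrE// ler_nat ltnS.
Qed.

Lemma fine_exists p : {within `[(0 : R), 1], continuous p} -> exists n, mesh_fine p n.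
Proof.
have [l0 _ _ _] := TS; move=> cp.
have [d d0 dP] := compact_unif_continuous (segment_compact (a := 0) (b := 1)) cp l0.
have [n nP] := small_mesh d0; exists n => s t sI tI st.
apply: dP; rewrite ?/= ?in_itv//; rewrite /ball /=.
exact: le_lt_trans st (nP _ (leqnn n)).
Qed.

Lemma mesh_itv n i : (i <= n.+1)%N -> 0 <= (i%:R / n.+1%:R : R) <= 1.
Proof.
move=> in_; rewrite divr_ge0//= ler_pdivrMr// mul1r ler_nat//.
Qed.

Lemma fine_mesh p n m i j k : mesh_fine p n -> (i < n.+1)%N -> (j <= m.+1)%N -> (k <= m.+1)%N ->
  mdist (p ((i * m.+1 + j)%:R / (n.+1 * m.+1)%:R)) (p ((i * m.+1 + k)%:R / (n.+1 * m.+1)%:R)) < lam.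
Proof.
move=> fp in_ jm km; have E : (n.+1 * m.+1)%N = (n.+1 * m.+1).-1.+1 by [].
apply: fp; rewrite E; try (apply: mesh_itv; rewrite -E; nia).
rewrite -E -mulrBl !natrD opprD addrACA subrr add0r normrM.
rewrite [`|_^-1|]ger0_norm// natrM invfM mulrCA mulrC ler_piMl//.
rewrite ler_pdivrMr// mul1r ler_norml.
have : (j%:R : R) <= m.+1%:R by rewrite ler_nat.
have : (k%:R : R) <= m.+1%:R by rewrite ler_nat.
have : (0 : R) <= j%:R by []. 
have : (0 : R) <= k%:R by [].
by move=> *; apply/andP; split; lra.
Qed.

Lemma fine_step p n i : mesh_fine p n -> (i < n.+1)%N -> mdist (mesh p n i) (mesh p n i.+1) < lam.
Proof.
move=> fp in_; have := @fine_mesh p n 0 i 0 1 fp in_ isT isT.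
by rewrite !muln1 addn0 addn1.
Qed.

Definition trn p n y := dtr (mesh p n) n.+1 y.

Lemma trn_refine p n m y : pi y = p 0 -> mesh_fine p n -> trn p (n.+1 * m.+1).-1 y = trn p n y.
Proof.
move=> py fp; have E : (n.+1 * m.+1).-1.+1 = (n.+1 * m.+1)%N by [].
rewrite /trn E dtr_refine.
- apply: eq_dtr => i _; rewrite /mesh E; congr p.
  by rewrite !natrM -mulf_div divff ?mulr1// pnatr_eq0.
- by rewrite /mesh mul0r.
- by move=> i j k; exact: fine_mesh.
Qed.

(** Any fine mesh gives the same value, because two meshes have a common refinement. The default
    mesh 0 is reached only if no mesh is fine, which does not happen for a continuous path. *)
Definition Tr (p : R -> X) (y : Y) : Y := trn p (xget 0%N (mesh_fine p)) y.

Lemma TrE p n y : pi y = p 0 -> mesh_fine p n -> Tr p y = trn p n y.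
Proof.
move=> py fp; rewrite /Tr; case: xgetP => [m _ fm|/(_ n)//].
by rewrite -(trn_refine n py fm) mulnC (trn_refine m py fp).
Qed.

Lemma Tr_pi p y : {within `[(0 : R), 1], continuous p} -> pi y = p 0 -> pi (Tr p y) = p 1.
Proof.
move=> /fine_exists[n fp] py; rewrite (TrE py fp) /trn dtr_pi.
- by rewrite /mesh divff// pnatr_eq0.
- by move=> i; exact: fine_step.
- by rewrite /mesh mul0r.
Qed.

Lemma Tr_cst x y : pi y = x -> Tr (fun=> x) y = y.
Proof.
have [l0 _ _ T3] := TS; move=> py; rewrite (@TrE _ 0)//; last first.
  by move=> s t _ _ _; rewrite mdistxx.
by rewrite /trn /= /mesh -py T3.
Qed.

Lemma eq_Tr p q y : pi y = p 0 -> {within `[(0 : R), 1], continuous p} ->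
  (forall t : R, 0 <= t <= 1 -> p t = q t) -> Tr p y = Tr q y.
Proof.
move=> py /fine_exists[n fp] pq.
have fq : mesh_fine q n by move=> s t sI tI; rewrite -!pq//; exact: fp.
have q0 : pi y = q 0 by rewrite -pq// lexx ler01.
rewrite (TrE py fp) (TrE q0 fq); apply: eq_dtr => i in_.
by rewrite /mesh pq//; exact: mesh_itv.
Qed.

Lemma Tr_cat p q y : {within `[(0 : R), 1], continuous p} -> {within `[(0 : R), 1], continuous q} ->
  {within `[(0 : R), 1], continuous (path_cat p q)} -> p 1 = q 0 -> pi y = p 0 ->
  Tr (path_cat p q) y = Tr q (Tr p y).
Proof.
move=> cp cq cpq pq py.
have [n1 f1] := fine_exists cp; have [n2 f2] := fine_exists cq; have [n3 f3] := fine_exists cpq.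
(* A mesh with [2 * n.+1] steps has 1/2 as its node of index [n.+1], and its two halves are meshes
   with [n.+1] steps of [p] and of [q]. At this node [path_cat] still follows [p], hence the
   separate case of index 0 below. *)
pose n := (n1 + n2 + n3)%N.
have {}f1 : mesh_fine p n by apply: fineW f1; rewrite /n; lia.
have {}f2 : mesh_fine q n by apply: fineW f2; rewrite /n; lia.
have {}f3 : mesh_fine (path_cat p q) (n.+1 + n) by apply: fineW f3; rewrite /n; lia.
have pqy : pi y = path_cat p q 0 by rewrite /path_cat mulr0 invr_ge0 ler0n.
rewrite (TrE pqy f3) /trn -addnS dtr_add (TrE (n := n))//; last first.
  by rewrite Tr_pi.
rewrite (TrE py f1) /trn.
have E2 : ((n.+1 + n).+1%:R : R) = 2 * n.+1%:R by rewrite -natrM; congr (_%:R); lia.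
have n0 : (n.+1%:R : R) != 0 by rewrite pnatr_eq0.
have E i : (2 * (i%:R / (n.+1 + n).+1%:R) : R) = i%:R / n.+1%:R.
  by rewrite E2 invfM mulrCA [2 * _]mulrA divff ?pnatr_eq0// mul1r.
have S1 : dtr (mesh (path_cat p q) (n.+1 + n)) n.+1 y = dtr (mesh p n) n.+1 y.
  apply: eq_dtr => i in_; rewrite /mesh /path_cat E ifT//.
  by rewrite E2 invfM mulrCA ler_piMr// ler_pdivrMr// mul1r ler_nat.
rewrite S1; apply: eq_dtr => i in_; rewrite /mesh /path_cat E.
have -> : ((n.+1 + i)%:R / n.+1%:R : R) = 1 + i%:R / n.+1%:R by rewrite natrD mulrDl divff.
case: i in_ => [_|i in_]; last first.
  rewrite ifF; first by rewrite addrAC subrr add0r.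
  apply/negbTE; rewrite -ltNge.
  have -> : ((n.+1 + i.+1)%:R / (n.+1 + n).+1%:R : R) = 2^-1 + i.+1%:R / (n.+1 + n).+1%:R.
    by rewrite natrD mulrDl {1}E2 invfM mulrCA divff ?mulr1.
  by rewrite ltrDl divr_gt0.
rewrite addn0 mul0r addr0 subrr -pq ifT ?divff//.
by rewrite E2 invfM mulrCA divff// mulr1.
Qed.

Lemma Tr_rev p y : {within `[(0 : R), 1], continuous p} -> pi y = p 0 ->
  Tr (path_rev p) (Tr p y) = y.
Proof.
move=> cp py; have [n f] := fine_exists cp.
have f' : mesh_fine (path_rev p) n.
  move=> s t /andP[s0 s1] /andP[t0 t1] st; apply: f; try by apply/andP; split; lra.
  by rewrite opprB addrC addrA subrK distrC.
rewrite (TrE (n := n))//; last by rewrite Tr_pi// /path_rev subr0.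
rewrite (TrE py f) /trn -[RHS](@dtr_rev (mesh p n) n.+1 y).
- apply: eq_dtr => i in_; rewrite /mesh /path_rev; congr p.
  by rewrite natrB// mulrBl divff// pnatr_eq0.
- by rewrite /mesh mul0r.
- by move=> i; exact: fine_step.
Qed.

Lemma Tr_square (H : R * R -> X) y :
  {within `[(0 : R), 1] `*` `[(0 : R), 1], continuous H} -> pi y = H (0, 0) ->
  Tr (fun s => H (s, 1)) (Tr (fun t => H (0, t)) y) =
  Tr (fun t => H (1, t)) (Tr (fun s => H (s, 0)) y).
Proof.
move=> cH yH; have [l0 _ _ _] := TS.
have cK : compact (`[(0 : R), 1] `*` `[(0 : R), 1]).
  by apply: compact_setX; exact: segment_compact.
have [d d0 dP] := compact_unif_continuous cK cH l0.
have [n nP] := small_mesh d0.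
have HP (s t s' t' : R) : 0 <= s <= 1 -> 0 <= t <= 1 -> 0 <= s' <= 1 -> 0 <= t' <= 1 ->
    `|s - s'| <= n.+1%:R^-1 -> `|t - t'| <= n.+1%:R^-1 -> mdist (H (s, t)) (H (s', t')) < lam.
  move=> sI tI s'I t'I ss tt; apply: dP.
  - by split; rewrite /= in_itv.
  - by split; rewrite /= in_itv.
  - by split; rewrite /ball /=; [apply: le_lt_trans ss _|apply: le_lt_trans tt _]; exact: nP.
have n1 : (0 : R) <= n.+1%:R^-1 by rewrite invr_ge0.
have z01 : 0 <= (0 : R) <= 1 by rewrite lexx ler01.
have o01 : 0 <= (1 : R) <= 1 by rewrite lexx ler01.
have f1 u : 0 <= u <= 1 -> mesh_fine (fun s => H (s, u)) n.
  by move=> uI s t sI tI st; apply: HP => //; rewrite subrr normr0.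
have f2 u : 0 <= u <= 1 -> mesh_fine (fun s => H (u, s)) n.
  by move=> uI s t sI tI st; apply: HP => //; rewrite subrr normr0.
have TP p z : mesh_fine p n -> pi z = p 0 -> pi (trn p n z) = p 1.
  move=> fp pz; rewrite /trn dtr_pi.
  - by rewrite /mesh divff// pnatr_eq0.
  - by move=> i; exact: fine_step.
  - by rewrite /mesh mul0r.
rewrite (@TrE _ n y yH (f2 _ z01)) (@TrE _ n y yH (f1 _ z01)).
rewrite (@TrE _ n)//; [|by rewrite TP//; exact: f2|exact: f1].
rewrite (@TrE _ n)//; [|by rewrite TP//; exact: f1|exact: f2].
pose x i j := H (i%:R / n.+1%:R, j%:R / n.+1%:R).
have nn : (n.+1%:R / n.+1%:R : R) = 1 by rewrite divff// pnatr_eq0.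
have := @dtr_square x n.+1 n.+1 y.
rewrite /trn /x /mesh nn !mul0r; apply; first by rewrite yH.
move=> i j i' j' *; apply: HP; try exact: mesh_itv.
  by rewrite -mulrBl normrM [`|_^-1|]ger0_norm// ler_piMl// natr_dist_le1.
by rewrite -mulrBl normrM [`|_^-1|]ger0_norm// ler_piMl// natr_dist_le1.
Qed.

(** In the square of the homotopy, the two sides where the end points stay fixed carry constant
    paths, along which transport is the identity. *)
Lemma Tr_homotopic p q x x' y : {within `[(0 : R), 1], continuous p} ->
  {within `[(0 : R), 1], continuous q} ->
  path_homotopic x x' p q -> pi y = x -> p 0 = x -> Tr p y = Tr q y.
Proof.
move=> cp cq [H [cH H1 H2]] yx px.
have z01 : `[(0 : R), 1]%classic 0 by rewrite /= in_itv /= lexx ler01.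
have o01 : `[(0 : R), 1]%classic 1 by rewrite /= in_itv /= lexx ler01.
have H00 : H (0, 0) = x by have [] := H2 0 z01.
have yH : pi y = H (0, 0) by rewrite H00.
have := Tr_square cH yH.
have Ep z : pi z = x -> Tr (fun t => H (0, t)) z = Tr p z.
  move=> zx; symmetry; apply: eq_Tr => //; first by rewrite px.
  by move=> t tI; have [|-> _] := H1 t; rewrite /= ?in_itv.
have Eq z : pi z = x -> Tr (fun t => H (1, t)) z = Tr q z.
  move=> zx; symmetry; apply: eq_Tr => //.
    by have [_ <-] := H1 0 z01; have [->] := H2 1 o01.
  by move=> t tI; have [|_ ->] := H1 t; rewrite /= ?in_itv.
have E0 : Tr (fun s => H (s, 0)) y = y.
  rewrite -[RHS](@Tr_cst x)//; symmetry; apply: eq_Tr => //.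
    by apply: continuous_subspaceT => ?; exact: cst_continuous.
  by move=> t tI; have [|-> _] := H2 t; rewrite /= ?in_itv.
rewrite E0 Eq// Ep// => <-.
have p1 : p 1 = x' by have [<- _] := H1 1 o01; have [] := H2 0 z01.
have pp : pi (Tr p y) = x' by rewrite Tr_pi// px.
rewrite -[LHS](@Tr_cst x')//; apply: eq_Tr => //.
  by apply: continuous_subspaceT => ?; exact: cst_continuous.
by move=> t tI; have [|_ ->] := H2 t; rewrite /= ?in_itv.
Qed.

End DiscreteTransport.

(** * Lifting edges and walks to a covering *)

Section CoveringTransport.
Context {R : realType} {X Y : metricType R}.
Variable f : Y -> X.

(** Beyond coherence: lifts within a connected set over a small ball are unique, [T y] is an
    isometric section over the ball of radius [lam], and it inverts [f] near [y]. Only the radius in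
    the last clause depends on [y]. *)
Definition covering_system (T : Y -> X -> Y) (lam : R) : Prop :=
  [/\ transport_system f T lam,
      forall (C : set Y) y z, connected C -> C y -> C z ->
        (forall w, C w -> mdist (f y) (f w) < lam) -> T y (f z) = z,
      forall y x x', mdist (f y) x < lam -> mdist (f y) x' < lam ->
        mdist (T y x) (T y x') = mdist x x' &
      forall y, exists2 r : R, 0 < r <= lam & forall z z', mdist y z < r -> mdist y z' < r ->
        mdist (f z) (f z') = mdist z z' /\ T y (f z) = z].

(** [T y x] is the lift of [x] that a connected set over a small ball joins to [y]. Such a set stays
    in the sheet of [y], whence uniqueness; lifting a geodesic of a star into that sheet gives
    existence. *)
Lemma covering_system_exists : compact [set: X] -> metric_graph X -> covering f ->
  exists T lam, covering_system T lam.
Proof.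
move=> cX mgX [cf cov].
have /choice[U UP] : forall x, exists U : set X, open_nbhs x U /\
    exists S : set (set Y), [/\ forall A, S A -> open A /\ isometric_onto f A U,
          trivIset S id & f @^-1` U = \bigcup_(A in S) A].
  by move=> x; have [U h1 h2] := cov x; exists U.
have /choice[r rP] : forall x, exists r : R, 0 < r /\
    exists n (p : 'I_n -> R -> X), cstar x r p.
  move=> x; have [n [r [p cs]]] := star_center mgX x; exists r; split; first by have [] := cs.
  by exists n, p.
pose W x := U x `&` [set y | mdist x y < r x].
have nW x : [set: X] x -> nbhs x (W x).
  move=> _; apply: filterI; first by apply: open_nbhs_nbhs; have [] := UP x.
  by apply/nbhs_mdist; exists (r x) => //; have [] := rP x.
have [d d0 dP] := lebesgue_number cX nW.
(* [d] is a Lebesgue number for evenly covered pieces of stars. Two joining sets used in succession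
   stay within [lam + lam < d], so their union is again admissible. *)
pose lam := d / 3; have lam0 : 0 < lam by rewrite divr_gt0.
have lamd : lam + lam < d by rewrite /lam; lra.
pose joined e y z := exists C : set Y, [/\ connected C, C y, C z & forall w, C w -> mdist (f y) (f w) < e].
have joinedW e e' y z : e <= e' -> joined e y z -> joined e' y z.
  by move=> ee [C [? ? ? h]]; exists C; split=> // w /h h'; exact: lt_le_trans ee.
have sheet y : exists (x0 : X) (A : set Y), [/\ A y /\ open A,
    (forall z w, A z -> A w -> mdist (f z) (f w) = mdist z w),
    (forall x, mdist (f y) x < d -> exists2 z, A z & f z = x),
    (forall z, joined d y z -> A z) &
    exists n (p : 'I_n -> R -> X), cstar x0 (r x0) p /\ forall x, mdist (f y) x < d -> mdist x0 x < r x0].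
  have [x0 _ x0P] := dP (f y) I; have [[oU Ux0] [S [S1 S2 S3]]] := UP x0.
  have inU x : mdist (f y) x < d -> U x0 x.
    by move=> h; have [] : W x0 x by apply: x0P; rewrite ballEmdist.
  have : (f @^-1` U x0) y by apply: inU; rewrite mdistxx.
  rewrite S3 => -[A SA Ay]; have [oA [fA iA]] := S1 A SA.
  exists x0, A; split=> //.
  - by move=> x /inU; rewrite -fA => -[z Az <-]; exists z.
  - move=> z [C [cC Cy Cz CP]].
    apply: (connected_locally_constant cC _ Cy Cz Ay) => w Cw.
    have : (f @^-1` U x0) w by apply: inU; exact: CP.
    rewrite S3 => -[B SB Bw]; have [oB _] := S1 B SB.
    have nB : nbhs w B by apply: open_nbhs_nbhs.
    apply: filterS nB => w' Bw' _.
    have [AB|AB] := pselect (A = B); first by subst B.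
    split=> h; exfalso; apply: AB.
      by apply: S2 => //; exists w.
    by apply: S2 => //; exists w'.
  - have [r0 [n [p cs]]] := rP x0; exists n, p; split=> // x h.
    by have [] : W x0 x by apply: x0P; rewrite ballEmdist.
pose T y x := xget y [set z | f z = x /\ joined d y z].
have juniq y z z' : joined d y z -> joined d y z' -> f z = f z' -> z = z'.
  move=> jz jz' E; have [x0 [A [[Ay oA] iA sA jA _]]] := sheet y.
  by apply: mdist_positivity; rewrite -iA; [rewrite E mdistxx|exact: jA|exact: jA].
have T3 y z : joined d y z -> T y (f z) = z.
  move=> jz; rewrite /T; case: xgetP => [w _ [fw jw]|/(_ z)[]//].
  exact: (juniq y).
have TA y (x0 : X) (A : set Y) n (p : 'I_n -> R -> X) : A y ->
    (forall z w, A z -> A w -> mdist (f z) (f w) = mdist z w) ->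
    (forall x, mdist (f y) x < d -> exists2 z, A z & f z = x) ->
    cstar x0 (r x0) p -> (forall x, mdist (f y) x < d -> mdist x0 x < r x0) ->
    forall x, mdist (f y) x < lam -> joined lam y (T y x) /\ f (T y x) = x.
  move=> Ay iA sA cs x0P x xlam.
  have xd : mdist (f y) x < d by apply: lt_trans xlam _; lra.
  have yd : mdist (f y) (f y) < d by rewrite mdistxx.
  have [g [gL g0 g1 gr]] := cstar_geodesic cs (x0P _ yd) (x0P _ xd).
  pose c := clamp (0 : R) 1.
  have cI t : 0 <= c t <= 1 by apply: clamp_itv.
  have gd t : mdist (f y) (g (c t)) < lam.
    rewrite -{1}g0; apply: le_lt_trans (gL _ _) _; apply: le_lt_trans xlam.
    have /andP[c0 c1] := cI t.
    by rewrite sub0r normrN ger0_norm// ler_piMr// mdist_ge0.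
  have /choice[h hP] : forall t, exists z, A z /\ f z = g (c t).
    move=> t; have [|z Az fz] := sA (g (c t)); last by exists z.
    by apply: lt_trans (gd t) _; lra.
  have h0 : h 0 = y.
    apply: mdist_positivity; have [Ah fh] := hP 0; rewrite -iA// fh /c clamp_le//.
    by rewrite g0 mdistxx.
  have hL s t : mdist (h s) (h t) <= mdist (f y) x * `|s - t|.
    have [Ah fh] := hP s; have [Ah' fh'] := hP t; rewrite -iA// fh fh'.
    apply: le_trans (gL _ _) _; rewrite ler_wpM2l ?mdist_ge0//; exact: clamp_lip.
  have j1 : joined lam y (h 1).
    exists (h @` [set` `[(0 : R), 1]]); split.
    - by apply: connected_image_itv => t _; exact: lipschitz_continuous hL t.
    - by exists 0; rewrite //= in_itv /= lexx ler01.
    - by exists 1; rewrite //= in_itv /= lexx ler01.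
    - by move=> _ [t _ <-]; have [_ ->] := hP t.
  have fh1 : f (h 1) = x by have [_ ->] := hP 1; rewrite /c clamp_ge.
  have jd : joined d y (h 1) by apply: joinedW j1; lra.
  by have <- : h 1 = T y x by rewrite -fh1 T3.
have T1 y x : mdist (f y) x < lam -> joined lam y (T y x) /\ f (T y x) = x.
  have [x0 [A [[Ay oA] iA sA jA [n [p [cs x0P]]]]]] := sheet y.
  exact: (TA _ _ _ _ _ Ay iA sA cs x0P).
exists T, lam; split.
- split=> //.
  + by move=> y x /T1[].
  + move=> y x x' h1 h2 h3; have [j1 f1] := T1 _ _ h1.
    have h2' : mdist (f (T y x)) x' < lam by rewrite f1.
    have [j2 f2] := T1 _ _ h2'; rewrite -{2}f2; symmetry; apply: T3.
    have [C [cC Cy Cz CP]] := j1; have [D [cD Dy Dz DP]] := j2.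
    exists (C `|` D); split; [|by left|by right|].
      by apply: connectedU => //; exists (T y x).
    move=> w [/CP|/DP] h; first by apply: lt_trans h _; lra.
    apply: le_lt_trans (metric_triangle _ x _) _; rewrite f1 in h.
    by apply: lt_trans lamd; exact: ltrD.
  + by move=> y; apply: T3; exists [set y]; split=> //; [exact: connected1|move=> w ->; rewrite mdistxx].
- move=> C y z cC Cy Cz CP; apply: T3; exists C; split=> // w /CP h.
  by apply: lt_trans h _; lra.
- move=> y x x' h1 h2; have [x0 [A [[Ay oA] iA sA jA _]]] := sheet y.
  have [j1 f1] := T1 _ _ h1; have [j2 f2] := T1 _ _ h2.
  rewrite -iA ?f1 ?f2//; apply: jA; [apply: joinedW j1|apply: joinedW j2]; lra.
- move=> y; have [x0 [A [[Ay oA] iA sA jA _]]] := sheet y.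
  have [r1 r10 r1P] := (open_mdist A).1 oA y Ay.
  exists (Num.min r1 lam); first by rewrite lt_min r10 lam0 ge_min lexx orbT.
  move=> z z'; rewrite !lt_min => /andP[/r1P Az zl] /andP[/r1P Az' _].
  split; first exact: iA.
  have [j1 f1] : joined lam y (T y (f z)) /\ f (T y (f z)) = f z.
    by apply: T1; rewrite iA.
  apply: mdist_positivity; rewrite -iA ?f1 ?mdistxx//.
  by apply: jA; apply: joinedW j1; lra.
Qed.

End CoveringTransport.

Lemma local_lipschitz (R : realType) (X : metricType R) (L : R -> X) (d : R) : 0 < d ->
  (forall s t, `|s - t| < d -> mdist (L s) (L t) <= `|s - t|) ->
  forall s t, mdist (L s) (L t) <= `|s - t|.
Proof.
move=> d0 h s t.
have [n nP] : exists n : nat, `|s - t| / n.+1%:R < d.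
  exists (Num.truncn (`|s - t| / d)); rewrite ltr_pdivrMr// mulrC -ltr_pdivrMr//.
  exact: truncnS_gt.
pose u i := s + (t - s) * (i%:R / n.+1%:R).
have un : u n.+1 = t by rewrite /u divff ?pnatr_eq0// mulr1 addrC subrK.
have u0 : u 0%N = s by rewrite /u mul0r mulr0 addr0.
have ud i : `|u i - u i.+1| = `|s - t| / n.+1%:R.
  have -> : u i - u i.+1 = (s - t) / n.+1%:R.
    by rewrite /u; move: (n.+1%:R^-1 : R) => z; rewrite -natr1; ring.
  by rewrite normrM [`|_^-1|]ger0_norm.
have H i : mdist (L (u 0%N)) (L (u i)) <= i%:R * (`|s - t| / n.+1%:R).
  elim: i => [|i IH]; first by rewrite mdistxx mul0r.
  apply: le_trans (metric_triangle _ (L (u i)) _) _.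
  rewrite -natr1 mulrDl mul1r lerD// -(ud i) h// ud//.
have := H n.+1; rewrite u0 un mulrCA divff ?mulr1// pnatr_eq0//.
Qed.

Section PathConcatenation.
Context {R : realType} {X : metricType R}.
Implicit Types p q : R -> X.

Lemma path_cat_continuous p q : continuous p -> continuous q -> p 1 = q 0 ->
  continuous (path_cat p q).
Proof.
move=> cp cq pq.
(* Each half is frozen beyond the middle. At any time one of [P], [Q] sits at the junction point, so
   the oscillation of the concatenation is at most the sum of theirs. *)
pose P t := p (2 * Num.min t 2^-1); pose Q t := q (2 * Num.max t 2^-1 - 1).
have cP : continuous P.
  move=> t; apply: (@continuous_comp _ _ _ (fun t : R => 2 * Num.min t 2^-1) p); last exact: cp.
  apply: (@lipschitz_continuous _ R^o _ 2) => s u.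
  rewrite [mdist _ _]distrC -mulrBr normrM ger0_norm// ler_wpM2l//.
  have [h1|h1] := leP s 2^-1; have [h2|h2] := leP u 2^-1;
  rewrite ler_norml; have := ler_norm (s - u); have := ler_norm (u - s);
    rewrite (distrC u s) => *; apply/andP; split; lra.
have cQ : continuous Q.
  move=> t; apply: (@continuous_comp _ _ _ (fun t : R => 2 * Num.max t 2^-1 - 1) q); last exact: cq.
  apply: (@lipschitz_continuous _ R^o _ 2) => s u.
  have -> : mdist (2 * Num.max s 2^-1 - 1 : R^o) (2 * Num.max u 2^-1 - 1) = `|2 * (Num.max s 2^-1 - Num.max u 2^-1)|.
    by rewrite [mdist _ _]distrC; congr `|_|; ring.
  rewrite normrM ger0_norm// ler_wpM2l//.
  have [h1|h1] := leP s 2^-1; have [h2|h2] := leP u 2^-1;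
  rewrite ler_norml; have := ler_norm (s - u); have := ler_norm (u - s);
    rewrite (distrC u s) => *; apply/andP; split; lra.
have E2 : 2 * 2^-1 = 1 :> R by rewrite divff.
have key s t : mdist (path_cat p q s) (path_cat p q t) <= mdist (P s) (P t) + mdist (Q s) (Q t).
  have H u : (path_cat p q u = P u /\ Q u = p 1) \/ (path_cat p q u = Q u /\ P u = p 1).
    rewrite /path_cat /P /Q; have [h|h] := leP u 2^-1.
      by left; split=> //; rewrite E2 subrr pq.
    by right; split=> //; rewrite E2.
  have [[-> E1]|[-> E1]] := H s; have [[-> E3]|[-> E3]] := H t.
  - by rewrite lerDl mdist_ge0.
  - by rewrite E1 E3; exact: metric_triangle.
  - by rewrite E1 E3 addrC; exact: metric_triangle.
  - by rewrite lerDr mdist_ge0.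
move=> t; apply/continuous_normP => e e0; have e2 : 0 < e / 2 by rewrite divr_gt0.
have [d1 d10 h1] := (continuous_normP P t).1 (cP t) _ e2.
have [d2 d20 h2] := (continuous_normP Q t).1 (cQ t) _ e2.
exists (Num.min d1 d2); first by rewrite lt_min d10.
move=> s; rewrite lt_min => /andP[/h1 k1 /h2 k2]; apply: le_lt_trans (key _ _) _.
by rewrite [e]splitr ltrD.
Qed.

Lemma path_rev_continuous p : continuous p -> continuous (path_rev p).
Proof.
move=> cp t; apply: (@continuous_comp _ _ _ (fun t : R => 1 - t) p); last exact: cp.
by apply: cvgB; [exact: cvg_cst|exact: cvg_id].
Qed.

End PathConcatenation.

Lemma oedge_eq_shift (R : realType) (X : metricType R) (V : set X) (e e' : oedge V) (u s t' : R) :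
  0 < u < elen e -> 0 < s < elen e' -> epar e u = epar e' s -> 0 < t' < elen e' ->
  exists t, [/\ 0 < t < elen e, epar e t = epar e' t' & `|u - t| = `|s - t'|].
Proof.
move=> uI sI E t'I; have [[-> ->]|[-> ->]] := oedge_eq uI sI E; first by exists t'.
exists (elen e' - t'); split; first by move/andP: t'I => [? ?]; apply/andP; split; lra.
  by rewrite /= subKr.
by rewrite distrC; congr `|_|; ring.
Qed.

(** * The lifted model *)

Section EdgeLifting.
Context {R : realType} {X Y : metricType R}.
Variables (f : Y -> X) (T : Y -> X -> Y) (lam : R).
Hypothesis CS : covering_system f T lam.

Let TS : transport_system f T lam. Proof. by case: CS. Qed.

Local Notation Tr := (Tr T lam).

(** Unique lifting: a short piece of a continuous lift is a connected set over a small ball, so each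
    step of the transport follows the lift. *)
Lemma Tr_lift (q : R -> Y) : {within `[(0 : R), 1], continuous q} ->
  {within `[(0 : R), 1], continuous (f \o q)} ->
  Tr (f \o q) (q 0) = q 1.
Proof.
move=> cq cfq; have [n fn] := fine_exists TS cfq.
rewrite (TrE TS (n := n))// /trn.
have E i : (i <= n.+1)%N -> dtr T (mesh (f \o q) n) i (q 0) = q (i%:R / n.+1%:R).
  elim: i => [_|i IH in_] /=; first by rewrite mul0r.
  rewrite IH ?(ltnW in_)// /mesh /=.
  have [_ S2 _ _] := CS.
  pose a : R := i%:R / n.+1%:R; pose b : R := i.+1%:R / n.+1%:R.
  have ab : a <= b by rewrite ler_pM2r ?invr_gt0// ler_nat.
  have [a0 _] : 0 <= a /\ True by rewrite divr_ge0.
  have b1 : b <= 1 by rewrite ler_pdivrMr// mul1r ler_nat.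
  have bE : b - a = n.+1%:R^-1 by rewrite /a /b -mulrBl -natr1 addrAC subrr add0r mul1r.
  apply: (S2 (q @` [set` `[a, b]])).
  - apply: connected_continuous_connected.
      by apply/connected_intervalP; exact: interval_is_interval.
    apply: continuous_subspaceW cq => t; rewrite /= !in_itv /= => /andP[t1 t2].
    by rewrite (le_trans a0 t1) (le_trans t2 b1).
  - by exists a; rewrite //= in_itv /= lexx.
  - by exists b; rewrite //= in_itv /= lexx ab.
  - move=> _ [t /= + <-]; rewrite in_itv /= => /andP[t1 t2]; apply: fn.
    + by rewrite -/a a0 (le_trans ab).
    + by rewrite (le_trans a0 t1) (le_trans t2 b1).
    + by rewrite -/a distrC ger0_norm ?subr_ge0// -bE; lra.
by rewrite E// divff// pnatr_eq0.
Qed.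

Lemma covering_system_continuous : continuous f.
Proof.
have [_ _ _ S4] := CS; move=> y; apply/continuous_mdist => e e0.
have [r /andP[r0 _] rP] := S4 y; exists (Num.min e r); first by rewrite lt_min e0.
move=> z; rewrite lt_min => /andP[ze zr].
by have [-> _] := rP y z (eq_ind_r (fun d => d < r) r0 (mdistxx y)) zr.
Qed.

Context {V : set X}.
Implicit Types e : oedge V.

(** Transport along the piece of [e] before time [t], rescaled to the unit interval. Regularity in
    [t] is not built in; it is part of [elift_spec]. *)
Definition elift e (y : Y) (t : R) : Y :=
  Tr (fun s => epar e (clamp 0 (elen e) t * s)) y.

Lemma elift_spec e y : f y = einit e ->
  [/\ elift e y 0 = y,
      forall t, f (elift e y t) = epar e t,
      forall s t, mdist (elift e y s) (elift e y t) <= `|s - t|,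
      forall s t, `|s - t| < lam / 2 -> elift e y t = T (elift e y s) (epar e t) &
      forall q : R -> Y, continuous q -> q 0 = y -> (forall t, f (q t) = epar e t) ->
        forall t, 0 <= t <= elen e -> q t = elift e y t].
Proof.
move=> fy; have [lam0 T1 T2 T3] := TS.
have l0 := elen_gt0 e; have l0' := ltW l0.
pose c t := clamp 0 (elen e) t.
have cI t : 0 <= c t <= elen e by exact: clamp_itv.
pose p t s := epar e (c t * s).
have cp t : continuous (p t).
  apply: (@lipschitz_continuous _ _ _ (c t)) => s u.
  apply: le_trans (epar_lipschitz _ _ _) _.
  by rewrite -mulrBr normrM ger0_norm//; have /andP[] := cI t.
have wcp t : {within `[(0 : R), 1], continuous (p t)} by apply: continuous_subspaceT; exact: cp.
have p0 t : f y = p t 0 by rewrite fy /p mulr0.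
(* One mesh serves every [t]. With steps below [lam / 2], two times at distance below [lam / 2] give
   interleaved chains to which [dtr_close] applies. *)
have [n nP] : exists n : nat, elen e / n.+1%:R < lam / 2.
  have h : 0 < lam / 2 / elen e by rewrite divr_gt0// divr_gt0.
  have [n nP] := small_mesh h; exists n.
  by rewrite mulrC -ltr_pdivlMr//; exact: nP.
have pd t t' (s s' : R) : 0 <= s <= 1 -> 0 <= s' <= 1 ->
    mdist (p t s) (p t' s') <= `|t - t'| + elen e * `|s - s'|.
  move=> /andP[s0 s1] /andP[s'0 s'1]; apply: le_trans (epar_lipschitz _ _ _) _.
  have -> : c t * s - c t' * s' = (c t - c t') * s' + c t * (s - s') by ring.
  apply: le_trans (ler_normD _ _) _; rewrite !normrM.
  have /andP[ct0 ctl] := cI t; rewrite [`|s'|]ger0_norm// [`|c t|]ger0_norm//.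
  apply: lerD; last by rewrite ler_wpM2r.
  apply: (@le_trans _ _ `|c t - c t'|); first by rewrite ler_piMr.
  exact: clamp_lip.
have fp t : mesh_fine lam (p t) n.
  move=> s s' sI s'I ss; apply: le_lt_trans (pd t t _ _ sI s'I) _.
  rewrite subrr normr0 add0r; apply: (@le_lt_trans _ _ (elen e / n.+1%:R)).
    by rewrite ler_wpM2l.
  by apply: lt_trans nP _; lra.
have LE t : elift e y t = dtr T (mesh (p t) n) n.+1 y.
  by rewrite /elift (TrE TS (p0 t) (fp t)).
have fL t : f (elift e y t) = epar e t.
  rewrite /elift (Tr_pi TS (wcp t) (p0 t)) /p mulr1 /c -epar_clamp//.
have mI i : (i <= n.+1)%N -> 0 <= (i%:R / n.+1%:R : R) <= 1 by exact: mesh_itv.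
have md i : `|i%:R / n.+1%:R - i.+1%:R / n.+1%:R : R| <= n.+1%:R^-1.
  rewrite -mulrBl normrM [`|_^-1|]ger0_norm// ler_piMl//; apply: natr_dist_le1; lia.
have Lloc s t : `|s - t| < lam / 2 -> elift e y t = T (elift e y s) (epar e t).
  move=> st; rewrite !LE.
  have -> : epar e t = mesh (p t) n n.+1.
    by rewrite /mesh divff ?pnatr_eq0// /p mulr1 /c -epar_clamp.
  rewrite (dtr_close TS).
  - by rewrite /mesh mul0r -(p0 t) T3.
  - by rewrite /mesh mul0r -(p0 s).
  - move=> i in_; split.
    + by apply: fine_step in_; exact: fp.
    + by apply: fine_step in_; exact: fp.
    + rewrite /mesh; apply: le_lt_trans (pd _ _ _ _ (mI _ (ltnW in_)) (mI _ in_)) _.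
      have h : elen e * `|i%:R / n.+1%:R - i.+1%:R / n.+1%:R| <= elen e / n.+1%:R.
        by rewrite ler_wpM2l.
      apply: (@le_lt_trans _ _ (`|s - t| + elen e / n.+1%:R)); first by rewrite lerD2l.
      by rewrite [lam]splitr ltrD.
  - move=> i in_; apply: le_lt_trans (pd _ _ _ _ (mI _ in_) (mI _ in_)) _.
    by rewrite subrr normr0 mulr0 addr0; lra.
have [_ S2 S3 _] := CS.
have LL s t : mdist (elift e y s) (elift e y t) <= `|s - t|.
  apply: (@local_lipschitz _ _ (elift e y) (lam / 2)); first by rewrite divr_gt0.
  move=> {}s {}t st; rewrite (Lloc s t st).
  have h : mdist (epar e s) (epar e t) < lam.
    by apply: le_lt_trans (epar_lipschitz _ _ _) _; lra.
  rewrite -{1}(T3 (elift e y s)) S3 ?fL ?mdistxx//; exact: epar_lipschitz.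
split=> //.
- rewrite /elift -[RHS](Tr_cst TS fy); symmetry; apply: (eq_Tr TS) => //.
    by apply: continuous_subspaceT => ?; exact: cst_continuous.
  by move=> t _; rewrite /einit clamp_le// mul0r.
- move=> q cq q0 fq t tI.
  have ctt : c t = t by rewrite /c clamp_id.
  pose q' s := q (t * s).
  have cq' : continuous q'.
    move=> s; apply: (@continuous_comp _ _ _ (fun s : R => t * s) q); last exact: cq.
    by apply: cvgMr; exact: cvg_id.
  have fq' : f \o q' = p t by apply/funext => s /=; rewrite /q' fq /p ctt.
  have := @Tr_lift q' (continuous_subspaceT cq'); rewrite fq' => /(_ (wcp t)).
  by rewrite /q' mulr0 q0 mulr1 => <-.
Qed.

(** The starting point is found by transport backwards along the piece of [e] before [t0]. *)
Lemma Tr_path_unique_start e y t0 : 0 <= t0 <= elen e -> f y = epar e t0 ->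
  exists2 y0, f y0 = einit e & elift e y0 t0 = y.
Proof.
move=> /andP[t00 t0l] fy.
pose p s := epar e (t0 * s).
have cp : continuous p.
  apply: (@lipschitz_continuous _ _ _ t0) => s u.
  apply: le_trans (epar_lipschitz _ _ _) _.
  by rewrite -mulrBr normrM ger0_norm.
have wp := continuous_subspaceT (cp : continuous p).
have wrp := continuous_subspaceT (path_rev_continuous cp).
have fy' : f y = path_rev p 0 by rewrite /path_rev subr0 /p mulr1.
exists (Tr (path_rev p) y).
  by rewrite (Tr_pi TS (wrp _) fy') /path_rev subrr /p mulr0.
rewrite /elift clamp_id ?t00//.
have := Tr_rev TS (wrp _) fy'.
by have -> : path_rev (path_rev p) = p by apply/funext => s; rewrite /path_rev subKr.
Qed.

Hypothesis mgX : metric_graph X.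
Hypothesis vs : vertex_set V.
Hypothesis HE : forall x, ~ V x -> exists e : oedge V, eset e x.
Hypothesis mgY : metric_graph Y.

Let J e y := elift e y @` `]0, elen e[.

(** The lifted arc is connected and avoids the lifted vertices. Conversely, lying on it is a locally
    constant property: nearby points project to the same edge and are reached by the local section,
    as are the nearby points of the arc. *)
Lemma elift_component e y (t0 : R) : f y = einit e -> 0 < t0 < elen e ->
  J e y = connected_component (~` (f @^-1` V)) (elift e y t0).
Proof.
move=> fy t0I; have [L0 fL LL Lloc _] := elift_spec fy.
have [lam0 T1 T2 T3] := TS; have [_ S2 S3 S4] := CS.
have JnV w : J e y w -> ~ (f @^-1` V) w.
  by move=> [t /= + <-]; rewrite in_itv /= fL => /epar_notV.
have l2 : 0 < lam / 2 by rewrite divr_gt0.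
apply/seteqP; split.
  apply: connected_component_max => //.
  - by exists t0; rewrite //= in_itv.
  - by apply: connected_image_itv => t _; exact: (@lipschitz_continuous _ _ _ 1 (fun s t => le_trans (LL s t) (eq_ler (esym (mul1r _))))).
set C := connected_component _ _.
have lc w : C w -> \forall w' \near w, C w' -> (J e y w <-> J e y w').
  move=> /connected_component_sub nVw.
  have [r /andP[r0 rl] rP] := S4 w.
  have [e' [t'] + Ew] := HE nVw; rewrite /= in_itv /= => t'I.
  have [r1 [[r10 r1a r1b] [ri r1P]]] := oedge_local mgX vs t'I.
  have loc w' : mdist w w' < Num.min r (Num.min r1 (lam / 2)) ->
      exists s, [/\ f w' = epar e' s, `|t' - s| < r1, `|t' - s| < lam / 2, 0 < s < elen e' & w' = T w (f w')].
    rewrite !lt_min => /andP[h1 /andP[h2 h3]].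
    have wr : mdist w w < r by rewrite mdistxx.
    have [fd _] := rP _ _ wr h1; have [_ ww'] := rP _ _ h1 wr.
    have [|s sr Es] := r1P (f w'); first by rewrite Ew fd.
    have sI : 0 < s < elen e'.
      by move: sr; rewrite ltr_norml => /andP[? ?]; apply/andP; split; lra.
    exists s; split=> //.
    have tt : `|t' - t'| < r1 by rewrite subrr normr0.
    by rewrite -(ri _ _ tt sr) Ew -Es fd.
  apply/nbhs_mdist; exists (Num.min r (Num.min r1 (lam / 2))).
    by rewrite !lt_min r0 r10.
  move=> w' /loc[s [Es sr sl sI ww']] _.
  have fww : mdist (f w) (f w') < lam.
    by rewrite -Ew Es; apply: le_lt_trans (epar_lipschitz _ _ _) _; lra.
  split=> [[t] | [u]]; rewrite /= in_itv /= => tI Et.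
    have ett : epar e t = epar e' t' by rewrite Ew -Et fL.
    have [s2 [s2I Es2 ds2]] := oedge_eq_shift tI t'I ett sI.
    exists s2; first by rewrite /= in_itv.
    by rewrite (Lloc t) ?ds2// Es2 Et ww' Es.
  have eus : epar e u = epar e' s by rewrite -Es -Et fL.
  have [t2 [t2I Et2 dt2]] := oedge_eq_shift tI sI eus t'I.
  exists t2; first by rewrite /= in_itv.
  rewrite (Lloc u) ?dt2 1?distrC// Et2 Et Ew ww' T2 ?mdistxx// 1?metric_sym//.
have C0 : C (elift e y t0).
  apply: connected_component_refl; apply: JnV.
  by exists t0; rewrite //= in_itv.
move=> w Cw; apply: (connected_locally_constant (A := C) (P := J e y) _ lc C0 Cw).
  exact: component_connected.
by exists t0; rewrite //= in_itv.
Qed.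

(** The arc itself gives the upper bound. For the lower one, a path inside the lifted arc has a
    parameter [u] whose increments over a fine mesh are exact distances, so its length is at least
    the total increment. *)
Lemma elift_path_dist e y (s t : R) : f y = einit e -> 0 < s < elen e -> 0 < t < elen e ->
  path_dist (J e y) (elift e y s) (elift e y t) = `|s - t|%:E.
Proof.
move=> fy sI tI; have [L0 fL LL Lloc _] := elift_spec fy.
have [lam0 T1 T2 T3] := TS; have [_ S2 S3 S4] := CS.
apply/eqP; rewrite eq_le; apply/andP; split.
  apply: (@path_dist_le _ _ _ _ _ (fun u => elift e y (s + (t - s) * clamp 0 1 u))) => //.
  + move=> u v; apply: le_trans (LL _ _) _.
    rewrite [s + _]addrC addrKA -mulrBr normrM distrC.
    by rewrite [`|s - t|]distrC ler_wpM2l// clamp_lip.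
  + by rewrite clamp_le// mulr0 addr0.
  + by rewrite clamp_ge// mulr1 addrC subrK.
  + move=> u uI; exists (s + (t - s) * clamp 0 1 u) => //; rewrite /= in_itv /=.
    rewrite clamp_id//; move/andP: uI => [u0 u1]; move/andP: sI => [s0 sl]; move/andP: tI => [t0 tl].
    have u1' : 0 <= 1 - u by rewrite subr_ge0.
    have [st|/ltW st] := leP s t.
      have st' : 0 <= t - s by rewrite subr_ge0.
      by have := mulr_ge0 st' u0; have := mulr_ge0 st' u1' => *; apply/andP; split; lra.
    have st' : 0 <= s - t by rewrite subr_ge0.
    by have := mulr_ge0 st' u0; have := mulr_ge0 st' u1' => *; apply/andP; split; lra.
apply: le_ereal_inf_tmp => _ [q [[cq q0 q1] qJ] <-].
have /choice[u uP] : forall v : R, exists w : R, 0 <= v <= 1 -> 0 < w < elen e /\ q v = elift e y w.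
  move=> v; have [vI|nv] := pselect (0 <= v <= 1); last by exists 0.
  have : J e y (q v) by apply: qJ; exists v; rewrite //= in_itv.
  by move=> [w /=]; rewrite in_itv /= => wI <-; exists w.
have Linj (a b : R) : 0 < a < elen e -> 0 < b < elen e -> elift e y a = elift e y b -> a = b.
  by move=> aI bI /(congr1 f); rewrite !fL; exact: oedge_inj.
(* Near [q v] the map [f] is an isometry, and below it the edge is isometric to its parameter;
   together distances become differences of parameters. *)
have /choice[r rP] : forall v : R, exists r : R, 0 < r /\ (0 <= v <= 1 ->
   forall a b : R, 0 <= a <= 1 -> 0 <= b <= 1 -> mdist (q v) (q a) < r -> mdist (q v) (q b) < r ->
     mdist (q a) (q b) = `|u a - u b|).
  move=> v; have [vI|nv] := pselect (0 <= v <= 1); last by exists 1; split.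
  have [uvI qv] := uP v vI.
  have [r1 [[r10 r1a r1b] [r1i r1P]]] := oedge_local mgX vs uvI.
  have [r2 /andP[r20 r2l] r2P] := S4 (q v).
  exists (Num.min r1 r2); split; first by rewrite lt_min r10.
  move=> _ a b aI bI; rewrite !lt_min => /andP[a1 a2] /andP[b1 b2].
  have [uaI qa] := uP a aI; have [ubI qb] := uP b bI.
  have vv : mdist (q v) (q v) < r2 by rewrite mdistxx.
  have H c : 0 <= c <= 1 -> mdist (q v) (q c) < r1 -> mdist (q v) (q c) < r2 -> `|u v - u c| < r1.
    move=> cI c1 c2; have [ucI qc] := uP c cI.
    have [|w wr] := r1P (f (q c)).
      by have [E _] := r2P _ _ vv c2; rewrite -(fL (u v)) -qv E.
    rewrite qc fL => E; suff -> : u c = w by [].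
    have wI : 0 < w < elen e.
      by move: wr; rewrite ltr_norml => /andP[? ?]; apply/andP; split; lra.
    exact: oedge_inj ucI wI E.
  have [<- _] := r2P _ _ a2 b2.
  by rewrite qa qb !fL r1i// H.
have [|d d0 dP] := lebesgue_number (segment_compact (a := (0 : R)) (b := 1))
   (W := fun v => [set a | 0 <= a <= 1 -> mdist (q v) (q a) < r v]).
  move=> v vI; have [rv _] := rP v.
  have /subspace_continuousP/(_ v vI) := cq.
  move=> /(_ [set y | mdist (q v) y < r v]) h.
  have /h : nbhs (q v) [set y | mdist (q v) y < r v] by apply/nbhs_mdist; exists (r v).
  apply: (@filterS _ (nbhs v)) => w /= + wI; apply.
  by rewrite in_itv.
have [n nP] := small_mesh d0.
apply: le_trans (path_length_uniform_ge q n); rewrite lee_fin.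
have mI i : (i <= n.+1)%N -> 0 <= (i%:R / n.+1%:R : R) <= 1 by exact: mesh_itv.
have E i : (i < n.+1)%N -> mdist (q (i%:R / n.+1%:R)) (q (i.+1%:R / n.+1%:R)) =
    `|u (i%:R / n.+1%:R) - u (i.+1%:R / n.+1%:R)|.
  move=> in_; have aI := mI _ (ltnW in_); have bI := mI _ in_.
  have [v vI vP] := dP (i%:R / n.+1%:R) aI.
  have [r0 rv] := rP v; apply: rv => //.
    by apply: vP => //; exact: ballxx.
  apply: vP => //; rewrite /ball /= distrC -mulrBl -natr1 addrAC subrr add0r mul1r.
  by rewrite ger0_norm//; exact: nP.
rewrite (eq_bigr (fun i : 'I_n.+1 => `|u (i%:R / n.+1%:R) - u (i.+1%:R / n.+1%:R)|)); last by move=> i _; exact: E.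
have us : u 0 = s.
  have [|u0I E0] := uP 0; first by rewrite lexx ler01.
  by apply: Linj => //; rewrite -E0 q0.
have ut : u 1 = t.
  have [|u0I E0] := uP 1; first by rewrite lexx ler01.
  by apply: Linj => //; rewrite -E0 q1.
apply: le_trans (ler_norm_sum _ _ _).
rewrite -normrN -sumrN (eq_bigr (fun i : 'I_n.+1 => u (i.+1%:R / n.+1%:R) - u (i%:R / n.+1%:R))); last first.
  by move=> i _; rewrite opprB.
rewrite -(big_mkord xpredT (fun i => u (i.+1%:R / n.+1%:R) - u (i%:R / n.+1%:R))).
rewrite (telescope_sumr (fun i => u (i%:R / n.+1%:R)))// divff ?pnatr_eq0// mul0r us ut.
by rewrite distrC.
Qed.

Lemma elift_oedge_exists e y : f y = einit e ->
  exists e' : oedge (f @^-1` V), [/\ edge_lift e' e, einit e' = y & epar e' = elift e y].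
Proof.
move=> fy; have [L0 fL LL Lloc _] := elift_spec fy; have l0 := elen_gt0 e.
have hI : 0 < elen e / 2 < elen e by apply/andP; split; lra.
unshelve eexists (@OEdge R Y (f @^-1` V) (elen e) (elift e y) _ _ _ _ _ _ _).
- by apply: (@lipschitz_continuous _ _ _ 1) => s t; rewrite mul1r.
- by move=> t t0; rewrite /elift !clamp_le// ltW.
- by move=> t t0; rewrite /elift !clamp_ge// ltW.
- by split=> // s t; rewrite /= !in_itv /= => sI tI; exact: elift_path_dist.
- exists (elift e y (elen e / 2)); first by rewrite /= fL; exact: epar_notV.
  exact: elift_component.
- by rewrite /= fL; exact: epar_init.
- by rewrite /= fL; exact: epar_term.
- by split=> //; split=> //=; apply/funext => t /=.
Qed.

(** The rays at [y] project isometrically, and they cover a ball at [f y] because [T y] lifts this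
    ball back into the chart. *)
Lemma valence_image y n : valence y n -> valence (f y) n.
Proof.
move=> [r [U [p [r0 oU [p0 UE pd]]]]].
have [lam0 T1 T2 T3] := TS; have [_ S2 S3 S4] := CS.
have [r1 r10 r1U] := (open_mdist U).1 oU y (eq_ind_r (fun U => U y) (or_introl erefl) UE).
have [r2 /andP[r20 r2l] r2P] := S4 y.
pose r' := Num.min r (Num.min r1 r2).
have r'0 : 0 < r' by rewrite !lt_min r0 r10.
have r'1 : r' <= r by rewrite ge_min lexx.
have r'2 : r' <= r1 by rewrite !ge_min lexx !orbT.
have r'3 : r' <= r2 by rewrite !ge_min lexx !orbT.
clearbody r'.
have pI (t : R) : 0 <= t < r' -> `[0, r[%classic t.
  by move=> /andP[t0 tr]; rewrite /= in_itv /= t0 (lt_le_trans tr).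
have py k (t : R) : 0 <= t < r' -> mdist y (p k t) = t.
  move=> tr; have /andP[t0 _] := tr.
  rewrite -(p0 k) pd/=; [|by apply: pI; rewrite lexx|exact: pI].
  by rewrite /star_dist eqxx sub0r normrN ger0_norm.
have pr k (t : R) : 0 <= t < r' -> mdist y (p k t) < r2.
  by move=> tr; rewrite py//; have /andP[_ h] := tr; exact: lt_le_trans h r'3.
apply: (@cstar_valence _ _ (f y) n r' (fun k t => f (p k t))); split=> //.
- by move=> k; rewrite p0.
- move=> x xr; have xl : mdist (f y) x < lam by apply: lt_le_trans xr (le_trans r'3 r2l).
  have yx : mdist y (T y x) = mdist (f y) x by rewrite -{1}(T3 y) S3 ?mdistxx.
  have : U (T y x) by apply: r1U; rewrite yx; exact: lt_le_trans xr r'2.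
  rewrite UE => -[E|[k _ [t /=]]]; first by left; rewrite -E T1.
  rewrite in_itv /= => /andP[t0 tr] E.
  have tt : mdist y (p k t) = t.
    rewrite -(p0 k) pd/= ?in_itv/= ?lexx ?t0//.
    by rewrite /star_dist eqxx sub0r normrN ger0_norm.
  have tr' : t < r' by rewrite -tt E yx.
  move: t0; rewrite le_eqVlt => /predU1P[t0|t0].
    by left; rewrite -(T1 y x xl) -E -t0 p0.
  by right; exists k, t; rewrite t0 tr'; split=> //; rewrite E T1.
- move=> k l s t sI tI; have [-> _] := r2P _ _ (pr k s sI) (pr l t tI).
  by rewrite pd/=; [|exact: pI|exact: pI].
Qed.

(** The canonical measure of the cover is constrained only through models, so the lifted model has
    to satisfy the definition. *)
Lemma preimage_vertex_set : vertex_set (f @^-1` V).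
Proof.
have [lam0 T1 T2 T3] := TS; have [_ S2 S3 S4] := CS.
have [Viso Vval _] := vs; split.
- move=> y Vy; have [_ [U nU UE]] := Viso (f y) Vy; split; first exact/mem_set.
  have [r r0 rP] := (nbhs_mdist _ _).1 nU.
  have [r2 /andP[r20 r2l] r2P] := S4 y.
  exists [set z | mdist y z < Num.min r r2].
    by apply/nbhs_mdist; exists (Num.min r r2) => //; rewrite lt_min r0.
  apply/seteqP; split=> z /=; last by move=> ->; rewrite mdistxx lt_min r0.
  rewrite lt_min => -[/andP[zr zr2] Vz].
  have yy : mdist y y < r2 by rewrite mdistxx.
  have [E1 E2] := r2P _ _ zr2 yy.
  have : (U `&` V) (f z) by split=> //; apply: rP; rewrite metric_sym E1 metric_sym.
  by rewrite UE => E; rewrite -E2 E T3.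
- by move=> y n /valence_image; exact: Vval.
- move=> y nVy; have [e [t0] + Ee] := HE nVy; rewrite /= in_itv /= => t0I.
  have t0I' : 0 <= t0 <= elen e by move/andP: t0I => [? ?]; rewrite !ltW.
  have [y0 fy0 Ey] := Tr_path_unique_start t0I' (esym Ee).
  exists (elen e), (elift e y0); rewrite -Ey -(elift_component fy0 t0I).
  split=> //; first exact: elen_gt0.
  by move=> s t; rewrite /= !in_itv /= => sI tI; exact: elift_path_dist.
Qed.

Lemma edge_lift_unique e (e1 e2 : oedge (f @^-1` V)) :
  edge_lift e1 e -> edge_lift e2 e -> einit e1 = einit e2 -> e1 = e2.
Proof.
move=> [l1 p1] [l2 p2] i12; apply: oedge_ext; first by rewrite l1.
have fy : f (einit e1) = einit e by rewrite /einit -p1.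
have [_ _ _ _ U] := elift_spec fy.
apply/funext => t; rewrite (epar_clamp e1) (epar_clamp e2) l1 l2.
have cI : 0 <= clamp 0 (elen e) t <= elen e by apply: clamp_itv; exact: ltW (elen_gt0 e).
rewrite (U (epar e1))//; last 2 first.
- exact: epar_cont.
- by move=> s; rewrite -p1.
rewrite (U (epar e2))//; first exact: epar_cont.
by move=> s; rewrite -p2.
Qed.

Lemma edge_lift_rev e (e' : oedge (f @^-1` V)) : edge_lift e' e -> edge_lift (erev e') (erev e).
Proof.
by move=> [l1 p1]; split=> //; apply/funext => t /=; rewrite -p1 l1.
Qed.

Lemma edge_lift_base (e' : oedge (f @^-1` V)) : exists e, edge_lift e' e.
Proof.
have l0 := elen_gt0 e'.
have hI : 0 < elen e' / 2 < elen e' by apply/andP; split; lra.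
have nVy := epar_notV hI; set y := epar e' _ in nVy.
have [e [t0] + Ee] := HE nVy; rewrite /= in_itv /= => t0I.
have t0I' : 0 <= t0 <= elen e by move/andP: t0I => [? ?]; rewrite !ltW.
have [y0 fy0 Ey] := Tr_path_unique_start t0I' (esym Ee).
have [e1 [[l1 p1] _ E1]] := elift_oedge_exists fy0.
have t1I : 0 < t0 < elen e1 by rewrite l1.
have E : epar e' (elen e' / 2) = epar e1 t0 by rewrite E1 Ey.
have [[-> _]|[-> _]] := oedge_eq hI t1I E; first by exists e.
by exists (erev e); apply: edge_lift_rev.
Qed.

Lemma edge_lift_inj (e' : oedge (f @^-1` V)) e1 e2 : edge_lift e' e1 -> edge_lift e' e2 -> e1 = e2.
Proof. by move=> [l1 p1] [l2 p2]; apply: oedge_ext; rewrite -?l1 -?p1. Qed.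

Lemma preimage_edges_exist y : ~ (f @^-1` V) y -> exists e' : oedge (f @^-1` V), eset e' y.
Proof.
move=> nVy; have [e [t0] + Ee] := HE nVy; rewrite /= in_itv /= => t0I.
have t0I' : 0 <= t0 <= elen e by move/andP: t0I => [? ?]; rewrite !ltW.
have [y0 fy0 Ey] := Tr_path_unique_start t0I' (esym Ee).
have [e1 [[l1 p1] _ E1]] := elift_oedge_exists fy0.
by exists e1, t0; rewrite ?E1//= in_itv /= l1.
Qed.

End EdgeLifting.

(** * Walks, their lifts and normality *)

Section Walks.
Context {R : realType} {X Y : metricType R}.
Variables (f : Y -> X) (T : Y -> X -> Y) (lam : R).
Hypothesis CS : covering_system f T lam.
Context {V : set X}.
Implicit Types (e : oedge V) (w : seq (oedge V)).

Let TS : transport_system f T lam. Proof. by case: CS. Qed.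
Local Notation Tr := (Tr T lam).
Local Notation elift := (elift T lam).

Fixpoint is_walk (x : X) w : Prop :=
  if w is e :: w' then einit e = x /\ is_walk (eterm e) w' else True.

Definition step (y : Y) e : Y := elift e y (elen e).

Definition walk_end (y : Y) w : Y := foldl step y w.

Definition walk_target (x : X) w : X := foldl (fun _ e => eterm e) x w.

Fixpoint base_path (x : X) w : R -> X :=
  if w is e :: w' then path_cat (fun s => epar e (s * elen e)) (base_path (eterm e) w')
  else fun=> x.

Fixpoint lift_path (y : Y) w : R -> Y :=
  if w is e :: w' then path_cat (fun s => elift e y (s * elen e)) (lift_path (step y e) w')
  else fun=> y.

Lemma step_proj y e : f y = einit e -> f (step y e) = eterm e.
Proof. by move=> fy; have [_ fL _ _ _] := elift_spec CS fy; rewrite /step fL. Qed.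

Lemma walk_end_proj y w : is_walk (f y) w -> f (walk_end y w) = walk_target (f y) w.
Proof.
elim: w y => //= e w IH y [ei ww]; rewrite /walk_end /walk_target /=.
by rewrite -(step_proj (esym ei)); apply: IH; rewrite step_proj.
Qed.

Lemma is_walk_cat x w1 w2 : is_walk x (w1 ++ w2) <-> is_walk x w1 /\ is_walk (walk_target x w1) w2.
Proof.
elim: w1 x => [|e w IH] x /=; first by split=> [|[]].
by rewrite IH /walk_target /=; tauto.
Qed.

Lemma walk_end_cat y w1 w2 : walk_end y (w1 ++ w2) = walk_end (walk_end y w1) w2.
Proof. exact: foldl_cat. Qed.

Lemma base_path0 x w : is_walk x w -> base_path x w 0 = x.
Proof.
elim: w x => //= e w IH x [<- ww].
by rewrite /path_cat mulr0 invr_ge0 ler0n mul0r.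
Qed.

Lemma lift_path0 y w : is_walk (f y) w -> lift_path y w 0 = y.
Proof.
case: w => //= e w [ei _]; have [L0 _ _ _ _] := elift_spec CS (esym ei).
by rewrite /path_cat mulr0 invr_ge0 ler0n mul0r.
Qed.

Lemma path_cat0 (A : Type) (p q : R -> A) : path_cat p q 0 = p 0.
Proof. by rewrite /path_cat mulr0 invr_ge0 ler0n. Qed.

Lemma path_cat1 (A : Type) (p q : R -> A) : path_cat p q 1 = q 1.
Proof.
rewrite /path_cat ifF; first by congr q; lra.
by apply/negbTE; rewrite -ltNge invf_lt1 ?ltr1n.
Qed.

Lemma lift_path1 y w : lift_path y w 1 = walk_end y w.
Proof. by elim: w y => //= e w IH y; rewrite path_cat1 IH. Qed.

Lemma lift_path_proj y w : is_walk (f y) w -> f \o lift_path y w = base_path (f y) w.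
Proof.
elim: w y => //= e w IH y [ei ww]; have [_ fL _ _ _] := elift_spec CS (esym ei).
rewrite -(step_proj (esym ei)) -IH ?step_proj//.
by apply/funext => t /=; rewrite /path_cat; case: ifP => //=; rewrite fL.
Qed.

Lemma base_path_continuous x w : is_walk x w -> continuous (base_path x w).
Proof.
elim: w x => [x _|e w IH x] /=; first by move=> ?; exact: cst_continuous.
move=> [_ ww]; apply: path_cat_continuous; last by rewrite mul1r base_path0.
  apply: (@lipschitz_continuous _ _ _ (elen e)) => s t.
  apply: le_trans (epar_lipschitz _ _ _) _.
  by rewrite -mulrBl normrM mulrC ger0_norm// ltW// elen_gt0.
exact: IH.
Qed.

Lemma lift_path_continuous y w : is_walk (f y) w -> continuous (lift_path y w).
Proof.
elim: w y => [y _|e w IH y] /=; first by move=> ?; exact: cst_continuous.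
move=> [ei ww]; have [_ fL LL _ _] := elift_spec CS (esym ei).
have ww' : is_walk (f (step y e)) w by rewrite step_proj.
apply: path_cat_continuous; last by rewrite mul1r lift_path0.
  apply: (@lipschitz_continuous _ _ _ (elen e)) => s t.
  apply: le_trans (LL _ _) _.
  by rewrite -mulrBl normrM mulrC ger0_norm// ltW// elen_gt0.
exact: IH.
Qed.

Lemma Tr_base_path y w : is_walk (f y) w -> Tr (base_path (f y) w) y = walk_end y w.
Proof.
move=> ww; rewrite -lift_path1 -lift_path_proj// -{2}(lift_path0 ww).
apply: (Tr_lift CS).
  by apply: continuous_subspaceT; exact: lift_path_continuous.
by rewrite lift_path_proj//; apply: continuous_subspaceT; exact: base_path_continuous.
Qed.

(* With [a] a walk from [x] to [y], normality makes [a w a^-1] lift to a closed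
   path at [x] as soon as [w] does; its middle part is the lift of [w] at [y]. *)
Lemma galois_closed_walk x y a w : @galois R X Y f -> f x = f y ->
  is_walk (f x) a -> walk_end x a = y ->
  is_walk (f x) w -> walk_end x w = x -> walk_end y w = y.
Proof.
move=> gal fxy wa ya ww xw.
have cont u : is_walk (f x) u -> {within `[(0 : R), 1], continuous (base_path (f x) u)}.
  by move=> uu; apply: continuous_subspaceT; exact: base_path_continuous.
have bp1 u : is_walk (f x) u -> base_path (f x) u 1 = f (walk_end x u).
  by move=> uu; rewrite -lift_path_proj//= lift_path1.
have pa : is_path (f x) (f x) (base_path (f x) a).
  by split; [exact: cont|exact: base_path0|rewrite bp1// ya].
have pw : is_path (f x) (f x) (base_path (f x) w).
  by split; [exact: cont|exact: base_path0|rewrite bp1// xw].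
have closed_w : in_pi1_image f x (base_path (f x) w).
  exists (lift_path x w).
    split; [|exact: lift_path0|by rewrite lift_path1].
    by apply: continuous_subspaceT; exact: lift_path_continuous.
  exists (fun z => base_path (f x) w z.2); split.
  - apply: continuous_subspaceT => z.
    apply: (@continuous_comp _ _ _ snd (base_path (f x) w)); first exact: cvg_snd.
    exact: base_path_continuous.
  - by move=> t _; rewrite -lift_path_proj.
  - by move=> s _ /=; rewrite base_path0// bp1// xw.
have [q [cq q0 q1] hom] := gal x _ _ pa pw closed_w.
set p := path_cat _ _ in hom.
have ca := base_path_continuous wa; have cw := base_path_continuous ww.
have c1 : continuous (path_cat (base_path (f x) a) (base_path (f x) w)).
  by apply: path_cat_continuous => //; rewrite bp1// ya base_path0.
have cra := path_rev_continuous ca.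
have e1 : path_cat (base_path (f x) a) (base_path (f x) w) 1 = path_rev (base_path (f x) a) 0.
  by rewrite path_cat1 bp1// xw /path_rev subr0 bp1// ya.
have cp : continuous p by apply: path_cat_continuous.
have p0 : p 0 = f x by rewrite /p !path_cat0 base_path0.
have cfq : {within `[(0 : R), 1], continuous (f \o q)}.
  apply/subspace_continuousP => t tI; have /subspace_continuousP/(_ t tI) h := cq.
  by move=> A /(covering_system_continuous CS) hA; exact: h _ hA.
have Tq : Tr (f \o q) x = x by rewrite -{1}q0 (Tr_lift CS cq cfq).
have Tp : Tr p x = x.
  rewrite -[RHS]Tq; symmetry; apply: (Tr_homotopic TS cfq _ hom) => //.
    exact: continuous_subspaceT.
  by rewrite /= q0.
have w1 : is_walk (f y) w by rewrite -fxy.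
have T1 : Tr (path_cat (base_path (f x) a) (base_path (f x) w)) x = walk_end y w.
  rewrite (Tr_cat TS) ?base_path0//; try by apply: continuous_subspaceT.
    by rewrite Tr_base_path// ya fxy Tr_base_path.
  by rewrite bp1// ya.
(* Transport along the reverse of [a] thus sends [walk_end y w] to [x]; transport back along [a]
   identifies it with [y]. *)
move: Tp; rewrite /p (Tr_cat TS)//; try by apply: continuous_subspaceT.
  rewrite T1 => E.
  have fz : f (walk_end y w) = path_rev (base_path (f x) a) 0.
    by rewrite walk_end_proj// -fxy -walk_end_proj// xw /path_rev subr0 bp1// ya.
  have := Tr_rev TS (continuous_subspaceT cra) fz; rewrite E.
  have -> : path_rev (path_rev (base_path (f x) a)) = base_path (f x) a.
    by apply/funext => s; rewrite /path_rev subKr.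
  by rewrite Tr_base_path// ya => <-.
by rewrite path_cat0 base_path0.
Qed.

End Walks.

From mathcomp Require Import finmap.

(** * The Laplacian of a locally finite graph *)

Section FiniteSums.
Context {R : realType}.

Definition fsupp (T : choiceType) (F : T -> R) : Prop := finite_set [set x | F x != 0].
(** The value is 0 by convention when the support is infinite. *)
Definition fsum (T : choiceType) (F : T -> R) : R := \sum_(x \in [set: T]) F x.

Context {T : choiceType}.
Implicit Types F G : T -> R.

Lemma fsumE (S : set T) F : finite_set S -> (forall x, ~ S x -> F x = 0) ->
  fsum F = \sum_(x <- fset_set S) F x.
Proof.
move=> fS F0; apply: fsbigTE => x; rewrite in_fset_set// => xS; apply: F0.
by move=> Sx; move: xS; rewrite mem_set.
Qed.

Lemma fsupp_sub (S : set T) F : finite_set S -> (forall x, ~ S x -> F x = 0) -> fsupp F.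
Proof.
move=> fS F0; apply: sub_finite_set fS => x /=; apply: contra_neqP; exact: F0.
Qed.

Lemma fsuppN0 F x : ~ [set x | F x != 0] x -> F x = 0.
Proof. by move=> /negP; rewrite negbK => /eqP. Qed.

Lemma fsuppD F G : fsupp F -> fsupp G -> fsupp (fun x => F x + G x).
Proof.
move=> fF fG; apply: (@fsupp_sub ([set x | F x != 0] `|` [set x | G x != 0])).
  by rewrite finite_setU.
by move=> x /not_orP[/fsuppN0 -> /fsuppN0 ->]; rewrite addr0.
Qed.

Lemma fsuppM F G : fsupp F -> fsupp (fun x => F x * G x).
Proof. by move=> fF; apply: (fsupp_sub fF) => x /fsuppN0 ->; rewrite mul0r. Qed.

Lemma fsuppMr F G : fsupp G -> fsupp (fun x => F x * G x).
Proof. by move=> fF; apply: (fsupp_sub fF) => x /fsuppN0 ->; rewrite mulr0. Qed.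

Lemma fsumD F G : fsupp F -> fsupp G -> fsum (fun x => F x + G x) = fsum F + fsum G.
Proof.
move=> fF fG; pose S := [set x | F x != 0] `|` [set x | G x != 0].
have fS : finite_set S by rewrite finite_setU.
rewrite !(fsumE fS) ?big_split//.
- by move=> x /not_orP[_ /fsuppN0 ->].
- by move=> x /not_orP[/fsuppN0 ->].
- by move=> x /not_orP[/fsuppN0 -> /fsuppN0 ->]; rewrite addr0.
Qed.

Lemma fsumZ c F : fsum (fun x => c * F x) = c * fsum F.
Proof. by rewrite /fsum -mulr_fsumr. Qed.

Lemma fsum_ge0 F : (forall x, 0 <= F x) -> 0 <= fsum F.
Proof. by move=> F0; apply: fsumr_ge0 => x _. Qed.

Lemma eq_fsum F G : F =1 G -> fsum F = fsum G.
Proof. by move=> FG; congr fsum; apply/funext. Qed.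

Lemma ler_fsum F G : fsupp F -> fsupp G -> (forall x, F x <= G x) -> fsum F <= fsum G.
Proof.
move=> fF fG FG; pose S := [set x | F x != 0] `|` [set x | G x != 0].
have fS : finite_set S by rewrite finite_setU.
rewrite !(fsumE fS); first by apply: ler_sum.
- by move=> x /not_orP[_ /fsuppN0 ->].
- by move=> x /not_orP[/fsuppN0 ->].
Qed.

Lemma ler_sum_fsum F (A : {fset T}) : fsupp F -> (forall x, 0 <= F x) ->
  \sum_(x <- A) F x <= fsum F.
Proof.
move=> fF F0; pose S := [set x | F x != 0] `|` [set` A].
have fS : finite_set S by rewrite finite_setU; split.
have -> : \sum_(x <- A) F x = fsum (fun x => if x \in A then F x else 0).
  rewrite (@fsumE [set` A]) //; last by move=> x /negP/negbTE ->.
  by rewrite set_fsetK; apply: eq_big_seq => x ->.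
apply: ler_fsum => //.
  by apply: (fsupp_sub fF) => x /fsuppN0 ->; rewrite if_same.
by move=> x; case: ifP.
Qed.

Lemma fsum_delta (x : T) F : fsum (fun y => (y == x)%:R * F y) = F x.
Proof.
rewrite (@fsumE [set x])//; last by move=> y /eqP/negbTE ->; rewrite mul0r.
by rewrite fset_set1 big_seq_fset1 eqxx mul1r.
Qed.

End FiniteSums.

Lemma fsum_fiber (R : realType) (T B : choiceType) (t : T -> B) (F : T -> R) : fsupp F ->
  fsum F = fsum (fun b => \sum_(a \in [set a | t a = b]) F a).
Proof.
move=> fF; set S := [set x | F x != 0] in fF.
have fS : finite_set S by [].
have inner b : \sum_(a \in [set a | t a = b]) F a = \sum_(a <- fset_set S) (if t a == b then F a else 0).
  have -> : \sum_(a \in [set a | t a = b]) F a = fsum (fun a => if t a == b then F a else 0).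
    rewrite fsbig_mkcond; apply: eq_fsum => a; rewrite /patch.
    by case: eqP => [h|h]; [rewrite mem_set|rewrite memNset].
  by apply: fsumE => // a na; rewrite (@fsuppN0 _ _ F a na) if_same.
have fS' : finite_set (t @` S) by exact: finite_image.
rewrite [RHS](@fsumE _ _ (t @` S))//; last first.
  move=> b nb; rewrite inner big_seq big1// => a; rewrite in_fset_set// => /set_mem aS.
  by case: eqP => // h; case: nb; exists a.
under [RHS]eq_bigr do rewrite inner.
rewrite exchange_big /= (fsumE fS); last by move=> a na; exact: (@fsuppN0 _ _ F a na).
apply: eq_big_seq => a; rewrite in_fset_set// => /set_mem aS.
have tS : t a \in fset_set (t @` S) by rewrite in_fset_set// mem_set//; exists a.
rewrite (big_fsetD1 _ tS) /= eqxx big_seq big1 ?addr0// => b.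
by rewrite !inE eq_sym => /andP[/negbTE ->].
Qed.

Lemma fsum_reindex (R : realType) (T U : choiceType) (h : U -> T) (F : T -> R) :
  bijective h -> fsum F = fsum (fun u => F (h u)).
Proof. exact: reindex_fsbigT. Qed.

Lemma norm_lt_of_sqr (R : realDomainType) (x e : R) : 0 < e -> x ^+ 2 < e ^+ 2 -> `|x| < e.
Proof.
by move=> e0; rewrite -(real_normK (num_real x)) ltr_pXn2r// nnegrE// ltW.
Qed.

Lemma cvg_sum_seq (R : realType) (I : Type) (s : seq I) (u : nat -> I -> R) (l : I -> R) :
  (forall i, (fun n => u n i) @ \oo --> l i) ->
  (fun n => \sum_(i <- s) u n i) @ \oo --> \sum_(i <- s) l i.
Proof.
move=> ul; elim: s => [|i s IH].
  by under eq_fun do rewrite big_nil; rewrite big_nil; exact: cvg_cst.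
by under eq_fun do rewrite big_cons; rewrite big_cons; apply: cvgD => //; exact: ul.
Qed.

(** * Gradient, divergence and the iteration of A and B *)

Section GraphAnalysis.
Context {R : realType}.
Variables (E P : choiceType) (hd : E -> P) (rev : E -> E) (len : E -> R) (D : R).
Let tl e := hd (rev e).
Hypothesis revK : involutive rev.
Hypothesis rev_neq : forall e, rev e <> e.
Hypothesis len_rev : forall e, len (rev e) = len e.
Hypothesis len_gt0 : forall e, 0 < len e.
Hypothesis locfin : forall p, finite_set [set e | hd e = p].
Hypothesis D0 : 0 < D.
Hypothesis bound : forall p, \sum_(e \in [set e | hd e = p]) (len e)^-1 <= D.

Implicit Types (u v : P -> R) (g h : E -> R).

(* Forms are represented by their densities [w_e / l(e)], whence the weight
   [len] in the inner product; it counts both orientations of every edge. *)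
Definition grad u e := (u (hd e) - u (tl e)) / len e.
Definition div g p := \sum_(e \in [set e | hd e = p]) g e.
Definition antisym g := forall e, g (rev e) = - g e.
Definition ipE g h := fsum (fun e => g e * h e * len e).
Definition ipP u v := fsum (fun p => u p * v p).

Lemma rev_bij : bijective rev. Proof. by exists rev. Qed.

Lemma divE g p : div g p = \sum_(e <- fset_set [set e | hd e = p]) g e.
Proof. exact: fsbig_finite. Qed.

Lemma divD g h p : div (fun e => g e + h e) p = div g p + div h p.
Proof. by rewrite !divE big_split. Qed.

Lemma divZ c g p : div (fun e => c * g e) p = c * div g p.
Proof. by rewrite !divE mulr_sumr. Qed.

Lemma gradZ c u e : grad (fun p => c * u p) e = c * grad u e.
Proof. by rewrite /grad -mulrBr mulrA. Qed.

Lemma gradD u v e : grad (fun p => u p + v p) e = grad u e + grad v e.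
Proof. by rewrite /grad -mulrDl; congr (_ / _); ring. Qed.

Lemma antisym_grad u : antisym (grad u).
Proof. by move=> e; rewrite /grad /tl revK len_rev -mulNr opprB. Qed.

Lemma fsupp_grad u : fsupp u -> fsupp (grad u).
Proof.
move=> fu; pose S := \bigcup_(p in [set p | u p != 0]) [set e | hd e = p].
have fS : finite_set S by apply: bigcup_finite => // p _; exact: locfin.
apply: (@fsupp_sub _ _ (S `|` rev @` S)).
  by rewrite finite_setU; split=> //; exact: finite_image.
move=> e /not_orP[h1 h2]; rewrite /grad.
have -> : u (hd e) = 0.
  by apply/eqP; apply: contrapT => /negP h; apply: h1; exists (hd e).
have -> : u (tl e) = 0.
  apply/eqP; apply: contrapT => /negP h; apply: h2; exists (rev e); rewrite ?revK//.
  by exists (tl e).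
by rewrite subrr mul0r.
Qed.

Lemma fsupp_div g : fsupp g -> fsupp (div g).
Proof.
move=> fg; apply: (@fsupp_sub _ _ (hd @` [set e | g e != 0])).
  exact: finite_image.
move=> p hp; rewrite /div fsbig1// => e /= he; apply: fsuppN0 => h; apply: hp.
by exists e.
Qed.

Lemma ipP_fsupp u v : fsupp u -> fsupp (fun p => u p * v p).
Proof. exact: fsuppM. Qed.

Lemma ipE_fsupp g h : fsupp g -> fsupp (fun e => g e * h e * len e).
Proof. by move=> fg; apply: fsuppM; exact: fsuppM. Qed.

Lemma ipEC g h : ipE g h = ipE h g.
Proof. by apply: eq_fsum => e; rewrite [g e * _]mulrC. Qed.

Lemma ipPC u v : ipP u v = ipP v u.
Proof. by apply: eq_fsum => e; rewrite mulrC. Qed.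

Lemma ipEDl g h k : fsupp g -> fsupp h -> ipE (fun e => g e + h e) k = ipE g k + ipE h k.
Proof.
move=> fg fh; rewrite -fsumD; [|exact: ipE_fsupp|exact: ipE_fsupp].
by apply: eq_fsum => e; rewrite !mulrDl.
Qed.

Lemma ipEZl c g h : ipE (fun e => c * g e) h = c * ipE g h.
Proof. by rewrite /ipE -fsumZ; apply: eq_fsum => e; rewrite !mulrA. Qed.

Lemma ipPDl u v w : fsupp u -> fsupp v -> ipP (fun e => u e + v e) w = ipP u w + ipP v w.
Proof.
move=> fu fv; rewrite -fsumD; [|exact: ipP_fsupp|exact: ipP_fsupp].
by apply: eq_fsum => e; rewrite !mulrDl.
Qed.

Lemma ipPZl c u v : ipP (fun e => c * u e) v = c * ipP u v.
Proof. by rewrite /ipP -fsumZ; apply: eq_fsum => e; rewrite !mulrA. Qed.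

Lemma ipE_ge0 g : 0 <= ipE g g.
Proof. by apply: fsum_ge0 => e; rewrite mulr_ge0 ?(ltW (len_gt0 e))// -expr2 sqr_ge0. Qed.

Lemma ipP_ge0 u : 0 <= ipP u u.
Proof. by apply: fsum_ge0 => e; rewrite -expr2 sqr_ge0. Qed.

Lemma fsum_hd u g : fsupp (fun e => u (hd e) * g e) ->
  fsum (fun e => u (hd e) * g e) = ipP u (div g).
Proof.
move=> fug; rewrite (fsum_fiber hd fug); apply: eq_fsum => p.
rewrite /div mulr_fsumr; apply: eq_fsbigr => e.
by move=> /set_mem /= ->.
Qed.

Lemma fsupp_hd u g : fsupp u -> fsupp (fun e => u (hd e) * g e).
Proof.
move=> fu; apply: fsuppM.
pose S := \bigcup_(p in [set p | u p != 0]) [set e | hd e = p].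
have fS : finite_set S by apply: bigcup_finite => // p _; exact: locfin.
apply: (fsupp_sub fS) => e h1; apply/eqP; apply: contrapT => /negP h; apply: h1; by exists (hd e).
Qed.

(** Summation by parts: reversal turns the sum over tails into minus the sum over heads, and the
    factor 2 reflects that [ipE] counts both orientations. *)
Lemma grad_div u g : fsupp u -> antisym g -> ipE (grad u) g = 2 * ipP u (div g).
Proof.
move=> fu ag; have f1 : fsupp (fun e => u (hd e) * g e) by exact: fsupp_hd.
have f2 : fsupp (fun e => u (tl e) * g e).
  have := fsupp_hd (fun e => g (rev e)) fu.
  rewrite /fsupp => h; apply: sub_finite_set (finite_image rev h) => e /= he.
  by exists (rev e); rewrite /= revK.
have -> : ipE (grad u) g = fsum (fun e => u (hd e) * g e + -1 * (u (tl e) * g e)).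
  by apply: eq_fsum => e; rewrite /grad; field; rewrite gt_eqF.
rewrite fsumD ?fsumZ//; last exact: fsuppMr.
rewrite (fsum_reindex (fun e => u (tl e) * g e) rev_bij).
have -> : fsum (fun e => u (tl (rev e)) * g (rev e)) = -1 * fsum (fun e => u (hd e) * g e).
  by rewrite -fsumZ; apply: eq_fsum => e; rewrite /tl revK ag; ring.
by rewrite fsum_hd//; ring.
Qed.

(** From [(a - b)^2 <= 2 a^2 + 2 b^2]; each half, gathered over heads, meets the weighted degree,
    which is at most [D]. *)
Lemma grad_bound u : fsupp u -> ipE (grad u) (grad u) <= 4 * D * ipP u u.
Proof.
move=> fu.
pose k e := (u (hd e) * u (hd e)) / len e.
have fk : fsupp k by apply: fsuppM; exact: fsupp_hd.
have fkr : fsupp (fun e => k (rev e)).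
  apply: sub_finite_set (finite_image rev fk) => e /= he.
  by exists (rev e); rewrite /= ?revK.
apply: (@le_trans _ _ (fsum (fun e => 2 * k e + 2 * k (rev e)))).
  apply: ler_fsum; [exact: ipE_fsupp (fsupp_grad fu)|by apply: fsuppD; exact: fsuppMr|].
  move=> e; rewrite /grad /k len_rev -/(tl e).
  set a := u (hd e); set b := u (tl e).
  have -> : (a - b) / len e * ((a - b) / len e) * len e = (a - b) ^+ 2 / len e.
    by field; rewrite gt_eqF.
  rewrite !mulrA -mulrDl ler_wpM2r ?invr_ge0 ?(ltW (len_gt0 e))//.
  by have := sqr_ge0 (a + b); rewrite !expr2; lra.
rewrite fsumD; [|exact: fsuppMr|exact: fsuppMr].
rewrite !fsumZ -(fsum_reindex k rev_bij).
have -> : fsum k = ipP (fun p => u p * u p) (div (fun e => (len e)^-1)).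
  by rewrite -fsum_hd//.
have h : ipP (fun p => u p * u p) (div (fun e => (len e)^-1)) <= D * ipP u u.
  rewrite -fsumZ; apply: ler_fsum.
  - by apply: fsuppM; exact: fsuppM.
  - by apply: fsuppMr; exact: fsuppM.
  - by move=> p; rewrite mulrC ler_wpM2r ?bound// -expr2 sqr_ge0.
by lra.
Qed.

(** The factor [2 * D] comes from [grad_bound]: after the factor 2 of [grad_div], both compositions
    of gradient and divergence are nonnegative operators of norm at most [2 * D], so [Aop] and [Bop]
    lie between 0 and 1. *)
Definition Aop g e := g e - (2 * D)^-1 * grad (div g) e.
Definition Bop u p := u p - (2 * D)^-1 * div (grad u) p.

Lemma antisym_Aop g : antisym g -> antisym (Aop g).
Proof. by move=> ag e; rewrite /Aop ag antisym_grad; ring. Qed.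

Lemma fsupp_Aop g : fsupp g -> fsupp (Aop g).
Proof.
move=> fg; rewrite /Aop; under eq_fun do rewrite -mulNr.
by apply: fsuppD => //; apply: fsuppMr; apply: fsupp_grad; exact: fsupp_div.
Qed.

Lemma fsupp_Bop u : fsupp u -> fsupp (Bop u).
Proof.
move=> fu; rewrite /Bop; under eq_fun do rewrite -mulNr.
by apply: fsuppD => //; apply: fsuppMr; apply: fsupp_div; exact: fsupp_grad.
Qed.

Lemma ipE_sqB c g h : fsupp g -> fsupp h ->
  ipE (fun e => g e - c * h e) (fun e => g e - c * h e) =
  ipE g g - 2 * c * ipE h g + c ^+ 2 * ipE h h.
Proof.
move=> fg fh.
have E1 k : fsupp k -> ipE (fun e => g e - c * h e) k = ipE g k - c * ipE h k.
  move=> fk; under eq_fun do rewrite -mulNr.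
  by rewrite ipEDl// ?ipEZl ?mulNr//; exact: fsuppMr.
have fB : fsupp (fun e => g e - c * h e).
  by under eq_fun do rewrite -mulNr; apply: fsuppD => //; exact: fsuppMr.
by rewrite E1// [ipE g _]ipEC [ipE h (fun _ => _)]ipEC !E1// [ipE g h]ipEC; ring.
Qed.

Lemma ipP_sqB c u v : fsupp u -> fsupp v ->
  ipP (fun e => u e - c * v e) (fun e => u e - c * v e) =
  ipP u u - 2 * c * ipP v u + c ^+ 2 * ipP v v.
Proof.
move=> fu fv.
have E1 k : fsupp k -> ipP (fun e => u e - c * v e) k = ipP u k - c * ipP v k.
  move=> fk; under eq_fun do rewrite -mulNr.
  by rewrite ipPDl// ?ipPZl ?mulNr//; exact: fsuppMr.
have fB : fsupp (fun e => u e - c * v e).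
  by under eq_fun do rewrite -mulNr; apply: fsuppD => //; exact: fsuppMr.
by rewrite E1// [ipP u _]ipPC [ipP v (fun _ => _)]ipPC !E1// [ipP u v]ipPC; ring.
Qed.

(** More than a contraction: the loss of energy controls the divergence, which makes the limit of
    the iterates divergence-free. *)
Lemma Aop_energy g : fsupp g -> antisym g ->
  ipE (Aop g) (Aop g) + ipP (div g) (div g) / D <= ipE g g.
Proof.
move=> fg ag; have fd := fsupp_div fg; have fgd := fsupp_grad fd.
rewrite /Aop ipE_sqB// grad_div//.
have h := grad_bound fd; set N := ipP _ _ in h *; set G := ipE (grad _) _ in h *.
have h2 : (2 * D)^-1 ^+ 2 * G <= (2 * D)^-1 ^+ 2 * (4 * D * N).
  by rewrite ler_wpM2l// sqr_ge0.
apply: (@le_trans _ _ (ipE g g - 2 * (2 * D)^-1 * (2 * N) + (2 * D)^-1 ^+ 2 * (4 * D * N) + N / D)).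
  by lra.
apply: eq_ler; field; rewrite gt_eqF//.
Qed.

Lemma div_bound g : fsupp g -> antisym g -> ipP (div g) (div g) <= D * ipE g g.
Proof.
move=> fg ag; have := Aop_energy fg ag; have := ipE_ge0 (Aop g) => h1 h2.
have h3 : ipP (div g) (div g) / D <= ipE g g by lra.
by rewrite mulrC -ler_pdivrMr.
Qed.

(** Here the loss of energy controls the gradient, so that the iterates flatten along every edge. *)
Lemma Bop_energy u : fsupp u -> ipP (Bop u) (Bop u) + ipE (grad u) (grad u) / (4 * D) <= ipP u u.
Proof.
move=> fu; have fg := fsupp_grad fu; have fd := fsupp_div fg.
rewrite /Bop ipP_sqB// [ipP (div _) u]ipPC.
have := grad_div fu (@antisym_grad u); have := div_bound fg (@antisym_grad u).
set G := ipE _ _; set N := ipP (div _) _; set M := ipP u (div _) => h1 h2.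
have h3 : (2 * D)^-1 ^+ 2 * N <= (2 * D)^-1 ^+ 2 * (D * G).
  by rewrite ler_wpM2l// sqr_ge0.
apply: (@le_trans _ _ (ipP u u - 2 * (2 * D)^-1 * (G / 2) + (2 * D)^-1 ^+ 2 * (D * G) + G / (4 * D))).
  have -> : M = G / 2 by lra.
  by lra.
apply: eq_ler; field; rewrite gt_eqF//.
Qed.

Lemma Aop_sym g h : fsupp g -> fsupp h -> antisym g -> antisym h -> ipE (Aop g) h = ipE g (Aop h).
Proof.
have H k k' : fsupp k -> fsupp k' -> antisym k' ->
    ipE (Aop k) k' = ipE k k' - (2 * D)^-1 * (2 * ipP (div k) (div k')).
  move=> fk fk' ak'; rewrite /Aop; under eq_fun do rewrite -mulNr.
  rewrite ipEDl//; last by apply: fsuppMr; apply: fsupp_grad; exact: fsupp_div.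
  by rewrite ipEZl grad_div ?mulNr//; exact: fsupp_div.
move=> fg fh ag ah; rewrite H// [RHS]ipEC H// [ipE h g]ipEC.
by rewrite [ipP (div h) _]ipPC.
Qed.

Lemma Aop_harmonic g h : fsupp g -> antisym h -> (forall p, div h p = 0) -> ipE (Aop g) h = ipE g h.
Proof.
move=> fg ah dh; rewrite /Aop; under eq_fun do rewrite -mulNr.
rewrite ipEDl//; last by apply: fsuppMr; apply: fsupp_grad; exact: fsupp_div.
rewrite ipEZl grad_div//; last exact: fsupp_div.
rewrite [ipP _ _](_ : _ = 0) ?mulr0 ?addr0//.
by rewrite /ipP /fsum fsbig1// => p _; rewrite dh mulr0.
Qed.

Lemma div_Aop g p : div (Aop g) p = Bop (div g) p.
Proof.
rewrite /Aop /Bop; under [in LHS]eq_fun do rewrite -mulNr.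
by rewrite divD divZ mulNr.
Qed.

Section Iterates.
Variable g0 : E -> R.
Hypothesis fg0 : fsupp g0.
Hypothesis ag0 : antisym g0.

Let G n := iter n Aop g0.

Lemma fsupp_iterA n : fsupp (G n).
Proof. by elim: n => //= n IH; exact: fsupp_Aop. Qed.

Lemma antisym_iterA n : antisym (G n).
Proof. by elim: n => //= n IH; exact: antisym_Aop. Qed.

Lemma ipE_iterA_shift n m k : ipE (G (n + k)) (G m) = ipE (G n) (G (m + k)).
Proof.
elim: k n => [|k IH] n; first by rewrite !addn0.
have GS i : G i.+1 = Aop (G i) by [].
rewrite addnS -addSn IH addnS !GS Aop_sym//;
 try exact: fsupp_iterA; exact: antisym_iterA.
Qed.

Let al n := ipE (G n) (G n).

Lemma al_decr n : al n.+1 + ipP (div (G n)) (div (G n)) / D <= al n.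
Proof. exact: Aop_energy (fsupp_iterA n) (antisym_iterA n). Qed.

Lemma al_cauchy eps : 0 < eps -> exists N, forall n m, (N <= n)%N -> (N <= m)%N -> `|al n - al m| < eps.
Proof.
move=> e0; have d1 : {homo al : n m / (n <= m)%N >-> m <= n}.
  apply: (@homo_leq _ al (fun x y => y <= x)) => // [? ? ? h1 h2|n]; first exact: le_trans h2 h1.
  apply: le_trans (al_decr n); rewrite lerDl divr_ge0 ?(ltW D0)//; exact: ipP_ge0.
have al0 : has_lbound (range al) by exists 0 => _ [n _ <-]; exact: ipE_ge0.
have := nonincreasing_is_cvgn d1 al0; move=> /cvgrPdist_lt /(_ (eps / 2)).
rewrite divr_gt0// => /(_ isT)[N _ NP]; exists N => n m nN mN.
have h1 := NP n nN; have h2 := NP m mN.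
rewrite (le_lt_trans (ler_distD (lim (al @ \oo)) _ _))// [eps]splitr ltrD//.
by rewrite distrC.
Qed.

(** By symmetry of [Aop] the cross term of [G 2n] and [G 2m] is [al (n + m)], so the squared
    distance is [al 2n - 2 al (n + m) + al 2m], small because [al] converges. Even exponents are
    what makes the cross term a value of [al]. *)
Lemma even_cauchy eps : 0 < eps -> exists N, forall n m, (N <= n)%N -> (N <= m)%N ->
  ipE (fun e => G n.*2 e - G m.*2 e) (fun e => G n.*2 e - G m.*2 e) <= eps.
Proof.
move=> e0; have e2 : 0 < eps / 2 by rewrite divr_gt0.
have [N NP] := al_cauchy e2; exists N => n m nN mN.
have := @ipE_sqB 1 (G n.*2) (G m.*2) (fsupp_iterA _) (fsupp_iterA _).
under [X in ipE X]eq_fun do rewrite mul1r; under [X in ipE _ X]eq_fun do rewrite mul1r.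
move=> ->; rewrite -[ipE (G n.*2) _]/(al _) -[ipE (G m.*2) (G m.*2)]/(al _).
have -> : ipE (G m.*2) (G n.*2) = al (n + m)%N.
  have [nm|/ltnW nm] := leqP n m.
    have -> : m.*2 = (m + n + (m - n))%N by lia.
    by rewrite ipE_iterA_shift /al; congr ipE; congr G; lia.
  have -> : n.*2 = (m + n + (n - m))%N by lia.
  by rewrite ipEC ipE_iterA_shift /al; congr ipE; congr G; lia.
have h1 : `|al n.*2 - al (n + m)%N| < eps / 2 by apply: NP; lia.
have h2 : `|al m.*2 - al (n + m)%N| < eps / 2 by apply: NP; lia.
move: h1 h2; rewrite !ltr_norml => /andP[? ?] /andP[? ?]; lra.
Qed.

(** The last clause is convergence in norm, stated through finite partial sums because [h] may have
    infinite support, where [ipE] is not the norm. *)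
Lemma iterA_limit : exists h,
  [/\ antisym h, forall p, div h p = 0,
      forall e, (fun n => G n.*2 e) @ \oo --> h e &
      forall eps, 0 < eps -> exists N, forall n (F : {fset E}), (N <= n)%N ->
         \sum_(e <- F) (G n.*2 e - h e) ^+ 2 * len e <= eps].
Proof.
have pw e n m : (G n.*2 e - G m.*2 e) ^+ 2 * len e <=
    ipE (fun e => G n.*2 e - G m.*2 e) (fun e => G n.*2 e - G m.*2 e).
  have fB : fsupp (fun e => G n.*2 e - G m.*2 e).
    by under eq_fun do rewrite -mulN1r; apply: fsuppD; [|apply: fsuppMr]; exact: fsupp_iterA.
  have := @ler_sum_fsum _ _ (fun e => (G n.*2 e - G m.*2 e) * (G n.*2 e - G m.*2 e) * len e) [fset e]%fset.
  rewrite big_seq_fset1 expr2; apply; first exact: ipE_fsupp.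
  by move=> e'; rewrite mulr_ge0 ?(ltW (len_gt0 _))// -expr2 sqr_ge0.
have cv e : cvg ((fun n => G n.*2 e) @ \oo).
  apply: cauchy_cvg; apply: cauchy_exP => eps eps0.
  have e0 : 0 < eps ^+ 2 * len e / 2 by rewrite divr_gt0// mulr_gt0// exprn_gt0.
  have [N NP] := even_cauchy e0; exists (G N.*2 e), N => // n /= Nn.
  rewrite /ball /=; have := le_trans (pw e N n) (NP _ _ (leqnn N) Nn) => h.
  have : (G N.*2 e - G n.*2 e) ^+ 2 < eps ^+ 2.
    rewrite -(ltr_pM2r (len_gt0 e)); apply: le_lt_trans h _.
    by rewrite ltr_pdivrMr// ltr_pMr ?mulr_gt0 ?exprn_gt0// ltr1n.
  exact: norm_lt_of_sqr.
pose h e := lim ((fun n => G n.*2 e) @ \oo).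
have ch e : (fun n => G n.*2 e) @ \oo --> h e by exact: cv.
exists h; split=> //.
- move=> e; have c1 : (- (fun n => G n.*2 e)) @ \oo --> - h e by apply: cvgN; exact: ch.
  have c2 := ch (rev e).
  have E1 : (fun n => G n.*2 (rev e)) = - (fun n => G n.*2 e).
    by apply/funext => n; rewrite antisym_iterA.
  by rewrite E1 in c2; exact: (cvg_unique (@Rhausdorff R) c2 c1).
- move=> p; have c1 : (fun n => div (G n.*2) p) @ \oo --> div h p.
    rewrite divE; under eq_fun do rewrite divE.
    by apply: cvg_sum_seq => e; exact: ch.
  apply: (cvg_unique _ c1); first exact: Rhausdorff.
  apply/cvgrPdist_lt => eps eps0.
  have e0 : 0 < eps ^+ 2 / D by rewrite divr_gt0// exprn_gt0.
  have [N NP] := al_cauchy e0; exists N => // n /= Nn; rewrite sub0r normrN.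
  have h1 := al_decr n.*2.
  have h2 : `|al n.*2 - al n.*2.+1| < eps ^+ 2 / D by apply: NP; lia.
  have h3 : ipP (div (G n.*2)) (div (G n.*2)) < eps ^+ 2.
    have : ipP (div (G n.*2)) (div (G n.*2)) / D < eps ^+ 2 / D.
      by move: h2; rewrite ltr_norml => /andP[_ ?]; lra.
    by rewrite ltr_pM2r// invr_gt0.
  have h4 : div (G n.*2) p ^+ 2 <= ipP (div (G n.*2)) (div (G n.*2)).
    have := @ler_sum_fsum _ _ (fun p => div (G n.*2) p * div (G n.*2) p) [fset p]%fset.
    rewrite big_seq_fset1 expr2; apply; first by apply: fsuppM; apply: fsupp_div; exact: fsupp_iterA.
    by move=> q; rewrite -expr2 sqr_ge0.
  have : div (G n.*2) p ^+ 2 < eps ^+ 2 by exact: le_lt_trans h4 h3.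
  exact: norm_lt_of_sqr.
- move=> eps eps0; have [N NP] := even_cauchy eps0; exists N => n F Nn.
  have c1 : (fun m => \sum_(e <- F) (G n.*2 e - G m.*2 e) ^+ 2 * len e) @ \oo -->
      \sum_(e <- F) (G n.*2 e - h e) ^+ 2 * len e.
    apply: cvg_sum_seq => e; apply: cvgMl; under eq_fun do rewrite expr2; rewrite expr2.
    by apply: cvgM; apply: cvgB; [exact: cvg_cst|exact: ch|exact: cvg_cst|exact: ch].
  rewrite -(cvg_lim (@Rhausdorff R) c1); apply: limr_le; first by apply/cvg_ex; eexists; exact: c1.
  exists N => // m /= Nm; apply: le_trans (NP n m Nn Nm).
  rewrite (eq_bigr (fun e => (G n.*2 e - G m.*2 e) * (G n.*2 e - G m.*2 e) * len e)).
    apply: ler_sum_fsum.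
      apply: ipE_fsupp; under eq_fun do rewrite -mulN1r.
      by apply: fsuppD; [|apply: fsuppMr]; exact: fsupp_iterA.
    by move=> e'; rewrite mulr_ge0 ?(ltW (len_gt0 _))// -expr2 sqr_ge0.
  by move=> e _; rewrite expr2.
Qed.

Lemma ipE_iterA_harmonic n h : antisym h -> (forall p, div h p = 0) -> ipE (G n) h = ipE g0 h.
Proof.
move=> ah dh; elim: n => //= n IH; rewrite Aop_harmonic//; exact: fsupp_iterA.
Qed.

End Iterates.

Definition delta (T : choiceType) (x y : T) : R := (y == x)%:R.

Lemma fsupp_delta (T : choiceType) (x : T) : fsupp (delta x).
Proof. by apply: (@fsupp_sub _ _ [set x]) => // y /eqP/negbTE; rewrite /delta => ->. Qed.

Lemma BopB u v : Bop (fun p => u p - v p) = (fun p => Bop u p - Bop v p).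
Proof.
apply/funext => p; rewrite /Bop.
have -> : grad (fun p => u p - v p) = (fun e => grad u e + -1 * grad v e).
  by apply/funext => e; rewrite -gradZ -gradD; congr grad; apply/funext => q; rewrite mulN1r.
by rewrite divD divZ; ring.
Qed.

Lemma iterB_sub n u v : iter n Bop (fun p => u p - v p) = (fun p => iter n Bop u p - iter n Bop v p).
Proof. by elim: n => //= n ->; exact: BopB. Qed.

Definition edge_form (e0 : E) : E -> R := fun e => delta e0 e - delta (rev e0) e.

Lemma antisym_edge_form e0 : antisym (edge_form e0).
Proof.
move=> e; rewrite /edge_form /delta.
have -> : (rev e == e0) = (e == rev e0) by rewrite -(inj_eq (inv_inj revK)) revK.
by rewrite (inj_eq (inv_inj revK)) opprB.
Qed.

Lemma fsupp_edge_form e0 : fsupp (edge_form e0).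
Proof.
rewrite /edge_form; under eq_fun do rewrite -mulN1r.
by apply: fsuppD; [|apply: fsuppMr]; exact: fsupp_delta.
Qed.

Lemma div_delta e0 : div (delta e0) = delta (hd e0).
Proof.
apply/funext => p; rewrite /div /delta fsbig_mkcond.
rewrite -(fsum_delta e0 (fun=> (p == hd e0)%:R)).
apply: eq_fsum => e; rewrite /patch.
have [->|ne] := eqVneq e e0; last by rewrite mul0r if_same.
rewrite mul1r; case: eqP => [h|h]; first by rewrite mem_set.
by rewrite memNset// => /esym.
Qed.

Lemma div_edge_form e0 : div (edge_form e0) = (fun p => delta (hd e0) p - delta (tl e0) p).
Proof.
apply/funext => p; rewrite /edge_form.
have -> : (fun e => delta e0 e - delta (rev e0) e) = (fun e => delta e0 e + -1 * delta (rev e0) e).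
  by apply/funext => e; rewrite mulN1r.
by rewrite divD divZ !div_delta mulN1r.
Qed.

(** [Bop] is the transition operator of a lazy random walk with conductances [1 / len]; this is the
    probability of going from [p] to [q] in [n] steps. *)
Definition kern n (p q : P) : R := iter n Bop (delta q) p.

(** Each step subtracts a multiple of the gradient of [div (A^k g) = B^k (div g)], and the
    divergence of an edge form is the difference of the point masses at its two ends. *)
Lemma iterA_edge_form n e0 : iter n Aop (edge_form e0) e0 =
  1 - (2 * D)^-1 * \sum_(k < n) (kern k (hd e0) (hd e0) - kern k (hd e0) (tl e0)
                - (kern k (tl e0) (hd e0) - kern k (tl e0) (tl e0))) / len e0.
Proof.
have dG m : div (iter m Aop (edge_form e0)) = iter m Bop (div (edge_form e0)).
  by elim: m => //= m IH; rewrite -IH; apply/funext => p; exact: div_Aop.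
elim: n => [|n IH].
  rewrite big_ord0 mulr0 subr0 /= /edge_form /delta eqxx.
  by case: eqP => [/esym/rev_neq//|_]; rewrite subr0.
rewrite big_ord_recr /= /Aop IH dG div_edge_form iterB_sub /grad /kern.
by rewrite mulrDr; ring.
Qed.

(** The values of [B^n delta_x] at vertices connected to [x] approach each other, because the
    gradients tend to 0. A return kernel of absolute value at least [eps] would then force values at
    least [eps / 2] on many vertices of [W], against the energy bound 1. *)
Lemma return_kernel_vanishes (W : set P) x : W x -> infinite_set W ->
  (forall Q : P -> Prop, Q x -> (forall e, Q (tl e) -> Q (hd e)) -> forall p, W p -> Q p) ->
  (fun n => kern n x x) @ \oo --> (0 : R).
Proof.
move=> Wx Winf conn; pose u n := iter n Bop (delta x).
have fu n : fsupp (u n) by elim: n => [|n IH]; [exact: fsupp_delta|exact: fsupp_Bop].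
pose be n := ipP (u n) (u n).
have bd n : be n.+1 + ipE (grad (u n)) (grad (u n)) / (4 * D) <= be n by exact: Bop_energy.
have D4 : 0 < 4 * D by rewrite mulr_gt0.
have d1 : {homo be : n m / (n <= m)%N >-> m <= n}.
  apply: (@homo_leq _ be (fun x y => y <= x)) => // [? ? ? h1 h2|n]; first exact: le_trans h2 h1.
  apply: le_trans (bd n); rewrite lerDl divr_ge0 ?(ltW D4)//; exact: ipE_ge0.
have be1 n : be n <= 1.
  apply: (@le_trans _ _ (be 0%N)); first exact: d1.
  rewrite /be /u /= /ipP; apply: eq_ler; rewrite -[RHS](fsum_delta x (fun p => 1)).
  by apply: eq_fsum => p; rewrite /delta; case: eqP; rewrite ?mulr1 ?mulr0.
have be0 : has_lbound (range be) by exists 0 => _ [n _ <-]; exact: ipP_ge0.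
have cbe := nonincreasing_is_cvgn d1 be0.
have cdiff : (fun n => be n - be n.+1) @ \oo --> (0 : R).
  rewrite -[0](subrr (lim (be @ \oo))); apply: cvgB => //.
  have c0 : be @ \oo --> limn be := cbe.
  by move: c0; rewrite -cvg_shiftS.
have edge e : (fun n => u n (hd e) - u n (tl e)) @ \oo --> (0 : R).
  apply/cvgrPdist_lt => eps eps0.
  have e0 : 0 < eps ^+ 2 / len e / (4 * D) by rewrite !divr_gt0// exprn_gt0.
  have [N _ NP] := (cvgrPdist_lt _ _).1 cdiff _ e0; exists N => // n Nn.
  have := NP n Nn; rewrite !sub0r !normrN => h.
  have h1 : ipE (grad (u n)) (grad (u n)) < eps ^+ 2 / len e.
    have h2 := bd n; move: h; rewrite ltr_norml => /andP[_ h].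
    have : ipE (grad (u n)) (grad (u n)) / (4 * D) < eps ^+ 2 / len e / (4 * D) by lra.
    by rewrite ltr_pM2r// invr_gt0.
  have h2 : grad (u n) e * grad (u n) e * len e <= ipE (grad (u n)) (grad (u n)).
    have := @ler_sum_fsum _ _ (fun e => grad (u n) e * grad (u n) e * len e) [fset e]%fset.
    rewrite big_seq_fset1; apply; first by apply: ipE_fsupp; exact: fsupp_grad.
    by move=> e'; rewrite mulr_ge0 ?(ltW (len_gt0 _))// -expr2 sqr_ge0.
  have h3 : (u n (hd e) - u n (tl e)) ^+ 2 / len e < eps ^+ 2 / len e.
    apply: le_lt_trans h1; apply: le_trans h2; apply: eq_ler.
    by rewrite /grad; field; rewrite gt_eqF.
  move: h3; rewrite ltr_pM2r ?invr_gt0//; exact: norm_lt_of_sqr.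
have near p : W p -> (fun n => u n p - u n x) @ \oo --> (0 : R).
  move=> Wp; apply: (conn (fun p => (fun n => u n p - u n x) @ \oo --> (0 : R))) => //.
    by under eq_fun do rewrite subrr; exact: cvg_cst.
  move=> e he; have -> : (fun n => u n (hd e) - u n x) =
     (fun n => (u n (hd e) - u n (tl e)) + (u n (tl e) - u n x)).
    by apply/funext => n; rewrite addrA subrK.
  by rewrite -[0]addr0; apply: cvgD.
apply/cvgrPdist_lt => eps eps0.
(* [K] values of size [eps / 2] already exceed the total energy. *)
have [K KP] : exists K : nat, 1 < K%:R * (eps / 2) ^+ 2.
  have e2 : 0 < (eps / 2) ^+ 2 by rewrite exprn_gt0// divr_gt0.
  exists (Num.truncn ((eps / 2) ^- 2)).+1.
  by rewrite -ltr_pdivrMr// div1r truncnS_gt.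
have [F FW FK] := infinite_set_fset K Winf.
have e2 : 0 < eps / 2 by rewrite divr_gt0.
have : \forall n \near \oo, forall p, p \in F -> `|u n p - u n x| < eps / 2.
  have H (s : seq P) : {subset s <= F} ->
      exists N, forall n, (N <= n)%N -> forall p, p \in s -> `|u n p - u n x| < eps / 2.
    elim: s => [|p s IH] sF; first by exists 0%N.
    have [|N1 N1P] := IH; first by move=> q qs; apply: sF; rewrite inE qs orbT.
    have Wp : W p by apply: FW; apply: sF; rewrite inE eqxx.
    have [N2 _ N2P] := (cvgrPdist_lt _ _).1 (near p Wp) _ e2.
    exists (maxn N1 N2) => n; rewrite geq_max => /andP[n1 n2] q; rewrite inE => /predU1P[->|qs].
      by have := N2P n n2; rewrite sub0r normrN.
    exact: N1P.
  have [|N NP] := H F; first by move=> q.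
  by exists N.
move=> [N _ NP]; exists N => // n Nn; rewrite sub0r normrN -/(u n x).
rewrite ltNge; apply/negP => hx.
have big p : p \in F -> (eps / 2) ^+ 2 <= u n p * u n p.
  move=> pF; have h1 := NP n Nn p pF.
  have : eps / 2 <= `|u n p|.
    have := ler_normB (u n p) (u n p - u n x); rewrite subKr => h2.
    have : `|u n x| <= `|u n p| + `|u n p - u n x| by [].
    by lra.
  by move=> h2; rewrite -expr2 -(real_normK (num_real (u n p))) ler_pXn2r// nnegrE// ltW.
have h1 : \sum_(p <- F) u n p * u n p <= be n.
  apply: ler_sum_fsum; first exact: fsuppM.
  by move=> p; rewrite -expr2 sqr_ge0.
have h2 : K%:R * (eps / 2) ^+ 2 <= \sum_(p <- F) u n p * u n p.
  apply: (@le_trans _ _ (\sum_(p <- F) (eps / 2) ^+ 2)); last first.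
    by rewrite !big_seq; apply: ler_sum => p; exact: big.
  by rewrite big_const_seq count_predT iter_addr_0 -[leRHS]mulr_natl ler_wpM2r ?sqr_ge0// ler_nat.
by have := be1 n; lra.
Qed.

End GraphAnalysis.

(** * The harmonic projection and its trace over a cover *)

Section HarmonicProjection.
Context {R : realType} {Y : metricType R} {V : set Y}.
Variables (O : set (oedge V)) (D : R).
Hypothesis OO : orientation O.
Hypothesis locfin : forall p : Y, finite_set [set e : oedge V | eterm e = p].
Hypothesis D0 : 0 < D.
Hypothesis bound : forall p : Y, \sum_(e \in [set e : oedge V | eterm e = p]) (elen e)^-1 <= D.

Implicit Types (w : oedge V -> R) (phi psi : oedge V -> R) (e : oedge V).

Let E := oedge V.
Let hd : E -> Y := fun e => eterm e.
Let rv : E -> E := fun e => erev e.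
Let ln : E -> R := fun e => elen e.
Let len0 (e : E) : 0 < ln e. Proof. exact: elen_gt0. Qed.
Let lenr (e : E) : ln (rv e) = ln e. Proof. by []. Qed.
Let rvK : involutive rv. Proof. exact: erevK. Qed.
Let rvN (e : E) : rv e <> e. Proof. exact: erev_neq. Qed.

(** The signed infinite sum occurring in [pairing], freed from its factors so that additivity can be
    proved under absolute convergence. *)
Definition pn phi : \bar R :=
  (esum O (fun e => (phi e)%:E)^\+ - esum O (fun e => (phi e)%:E)^\-)%E.

Definition abs_bounded (C : R) phi : Prop :=
  forall F : {fset E}, [set` F] `<=` O -> \sum_(e <- F) `|phi e| <= C.

Lemma esum_abs_le C phi : abs_bounded C phi -> (\esum_(e in O) `|(phi e)%:E| <= C%:E)%E.
Proof.
move=> h; apply: ge_ereal_sup => _ [A [fA AO] <-].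
rewrite fsbig_finite//= (eq_bigr (fun e => `|phi e|%:E))// sumEFin lee_fin; apply: h.
by rewrite fset_setK.
Qed.

Lemma abs_bounded_ge0 C phi : abs_bounded C phi -> 0 <= C.
Proof. by move=> /(_ fset0); rewrite big_seq_fset0; apply => x. Qed.

Lemma abs_bounded_summable C phi : abs_bounded C phi -> summable O (fun e => (phi e)%:E).
Proof. by move=> /esum_abs_le h; apply: le_lt_trans h _; exact: ltry. Qed.

Lemma pn_le C phi : abs_bounded C phi -> (`|pn phi| <= C%:E)%E.
Proof.
move=> h; have hs := abs_bounded_summable h.
have P1 : (esum O (fun e => (phi e)%:E)^\+ <= C%:E)%E.
  apply: le_trans (esum_abs_le h); apply: le_esum => e _.
  by rewrite funeposE ge_max; apply/andP; split; [exact: lee_abs|exact: abse_ge0].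
have P2 : (esum O (fun e => (phi e)%:E)^\- <= C%:E)%E.
  apply: le_trans (esum_abs_le h); apply: le_esum => e _.
  by rewrite funenegE ge_max -abseN; apply/andP; split; [exact: lee_abs|exact: abse_ge0].
have Q1 : (0 <= esum O (fun e => (phi e)%:E)^\+)%E by apply: esum_ge0.
have Q2 : (0 <= esum O (fun e => (phi e)%:E)^\-)%E by apply: esum_ge0.
rewrite /pn; move: (esum O _) (esum O _) P1 P2 Q1 Q2 => [a||] [b||] //=.
by rewrite !lee_fin ler_norml => *; apply/andP; split; lra.
Qed.

Lemma funepos_EFin phi e : ((fun e => (phi e)%:E)^\+ e)%E = (Num.max (phi e) 0)%:E.
Proof. by rewrite funeposE EFin_max. Qed.

Lemma funeneg_EFin phi e : ((fun e => (phi e)%:E)^\- e)%E = (Num.max (- phi e) 0)%:E.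
Proof. by rewrite funenegE EFin_max. Qed.

Lemma pnD C C' phi psi : abs_bounded C phi -> abs_bounded C' psi ->
  pn (fun e => phi e + psi e) = (pn phi + pn psi)%E.
Proof.
move=> /abs_bounded_summable h1 /abs_bounded_summable h2.
pose f e := (phi e)%:E; pose g e := (psi e)%:E.
(* [p] and [n] need not be the positive and negative parts of the sum; they are nonnegative summable
   functions with this difference, which determines the signed sum. *)
pose p := (f^\+ \+ g^\+)%E; pose n := (f^\- \+ g^\-)%E.
have sp : summable O p by apply: summableD; exact: summable_funepos.
have sn : summable O n by apply: summableD; exact: summable_funeneg.
have p0 e : O e -> (0 <= p e)%E by move=> _; rewrite adde_ge0.
have n0 e : O e -> (0 <= n e)%E by move=> _; rewrite adde_ge0.
have pE e : p e = (Num.max (phi e) 0 + Num.max (psi e) 0)%:E by rewrite /p /= !funepos_EFin.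
have nE e : n e = (Num.max (- phi e) 0 + Num.max (- psi e) 0)%:E by rewrite /n /= !funeneg_EFin.
have E1 : (p \- n)%E = (fun e => (phi e + psi e)%:E).
  apply/funext => e; rewrite /= pE nE -EFinB; congr (_%:E); rewrite /Num.max.
  by case: ifPn; case: ifPn; case: ifPn; case: ifPn; rewrite -?leNgt => *; lra.
have := esumB sp sn p0 n0; rewrite E1 /pn => ->.
rewrite /p /n !esumD//.
have fin k : summable O k -> (forall e, O e -> 0 <= k e)%E -> (\esum_(e in O) k e)%E \is a fin_num.
  move=> sk k0; move: sk; rewrite summableE => h.
  by rewrite (eq_esum (b := fun e => `|k e|%E))// => e Oe; rewrite gee0_abs// k0.
have F1 : (\esum_(e in O) f^\+ e)%E \is a fin_num by apply: fin => //; exact: summable_funepos.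
have F2 : (\esum_(e in O) f^\- e)%E \is a fin_num by apply: fin => //; exact: summable_funeneg.
have F3 : (\esum_(e in O) g^\+ e)%E \is a fin_num by apply: fin => //; exact: summable_funepos.
have F4 : (\esum_(e in O) g^\- e)%E \is a fin_num by apply: fin => //; exact: summable_funeneg.
rewrite -/f -/g.
move: (\esum_(e in O) f^\+ e)%E (\esum_(e in O) f^\- e)%E (\esum_(e in O) g^\+ e)%E (\esum_(e in O) g^\- e)%E F1 F2 F3 F4.
move=> [a||] [b||] [c||] [d||] // _ _ _ _.
have H : a + c - (b + d) = a - b + (c - d) by ring.
exact: (congr1 EFin H).
Qed.

Lemma pn_ge0 phi : (forall e, O e -> 0 <= phi e) -> pn phi = (\esum_(e in O) (phi e)%:E)%E.
Proof.
move=> p0; rewrite /pn (eq_esum (b := fun e => (phi e)%:E)); last first.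
  by move=> e Oe; rewrite funeposE; apply/max_idPl; rewrite lee_fin p0.
rewrite [X in (_ - X)%E]esum1 ?sube0// => e Oe; rewrite funenegE; apply/max_idPr.
by rewrite -EFinN lee_fin oppr_le0 p0.
Qed.

Lemma fsupp_abs_bounded phi : fsupp phi -> abs_bounded (fsum (fun e => `|phi e|)) phi.
Proof.
move=> fp F FO; apply: ler_sum_fsum => //.
by apply: (fsupp_sub fp) => e he; rewrite (@fsuppN0 _ _ phi e he) normr0.
Qed.

Lemma pn_fsupp phi : fsupp phi -> pn phi = (fsum (fun e => (e \in O)%:R * phi e))%:E.
Proof.
move=> fp; pose S := [set e | phi e != 0].
have fin (f : oedge V -> \bar R) : (forall e, ~ S e -> f e = 0%E) -> (forall e, 0 <= f e)%E ->
    esum O f = (\sum_(e \in O `&` S) f e)%E.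
  move=> f0 fge; rewrite -esum_fset//; last exact: finite_setIr.
  rewrite esum_mkcondr; apply: eq_esum => e Oe.
  by case: ifPn => // /negP nS; rewrite f0// => Se; apply: nS; exact/mem_set.
have fOS : finite_set (O `&` S) by exact: finite_setIr.
rewrite /pn !fin//; last 2 first.
- by move=> e he; rewrite funeneg_EFin (@fsuppN0 _ _ phi e he) oppr0 maxxx.
- by move=> e he; rewrite funepos_EFin (@fsuppN0 _ _ phi e he) maxxx.
rewrite (@fsumE _ _ (O `&` S))//; last first.
  move=> e nOS; case: (pselect (O e)) => Oe; last by rewrite memNset// mul0r.
  by rewrite (@fsuppN0 _ _ phi e) ?mulr0// => Se; exact: nOS.
rewrite !fsbig_finite//=.
rewrite [X in (X - _)%E](eq_bigr (fun e => (Num.max (phi e) 0)%:E)); last by move=> e _; exact: funepos_EFin.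
rewrite [X in (_ - X)%E](eq_bigr (fun e => (Num.max (- phi e) 0)%:E)); last by move=> e _; exact: funeneg_EFin.
rewrite !sumEFin -EFinN -EFinD; congr (_%:E); rewrite -sumrB.
apply: eq_big_seq => e; rewrite in_fset_set// => /set_mem[Oe _].
rewrite mem_set// mul1r /Num.max.
by case: ifPn; case: ifPn; rewrite -?leNgt => *; lra.
Qed.

Lemma pairingE w w' : pairing O w w' = pn (fun e => dens w e * dens w' e * elen e).
Proof. by []. Qed.

Lemma fsum_oriented phi : fsupp phi -> (forall e, phi (erev e) = phi e) ->
  fsum phi = 2 * fsum (fun e => (e \in O)%:R * phi e).
Proof.
move=> fp pr; have f1 : fsupp (fun e => (e \in O)%:R * phi e) by exact: fsuppMr.
have -> : fsum phi = fsum (fun e => (e \in O)%:R * phi e + (erev e \in O)%:R * phi e).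
  apply: eq_fsum => e; rewrite -mulrDl; have := OO e.
  case: (pselect (O e)) => Oe; [have := (OO e).1 Oe => nO|have nO : O (erev e)].
  - by rewrite mem_set// memNset// addr0 mul1r.
  - by apply: contrapT => h; apply: Oe; apply/OO.
  - by rewrite memNset// mem_set// add0r mul1r.
rewrite fsumD//; last exact: fsuppMr.
have rb : bijective (fun e : E => erev e) by exists (fun e => erev e); exact: erevK.
rewrite [X in _ + X](fsum_reindex _ rb).
have -> : fsum (fun e : E => (erev (erev e) \in O)%:R * phi (erev e)) = fsum (fun e => (e \in O)%:R * phi e).
  by apply: eq_fsum => e; rewrite erevK pr.
by ring.
Qed.

Lemma L2formP w : L2form O w <-> form w /\ exists C, abs_bounded C (fun e => dens w e * dens w e * elen e).
Proof.
have p0 e : 0 <= dens w e * dens w e * elen e.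
  by rewrite mulr_ge0 ?(ltW (elen_gt0 e))// -expr2 sqr_ge0.
rewrite /L2form pairingE pn_ge0//; split=> -[fw].
  move=> h; split=> //.
  have g0 : (0 <= \esum_(e in O) (dens w e * dens w e * elen e)%:E)%E.
    by apply: esum_ge0 => e _; rewrite lee_fin.
  exists (fine (\esum_(e in O) (dens w e * dens w e * elen e)%:E)%E) => F FO.
  rewrite -lee_fin fineK; last by rewrite ge0_fin_numE.
  apply: ereal_sup_ubound; exists [set` F]; first by split.
  rewrite fsbig_finite//= set_fsetK -sumEFin; apply: eq_bigr => e _.
  by rewrite ger0_norm.
move=> [C /esum_abs_le h]; split=> //.
apply: le_lt_trans (ltry C); apply: le_trans h; apply: le_esum => e _.
by rewrite /= lee_fin ler_norm.
Qed.

(** A weighted form of [2 a b <= k a^2 + b^2 / k] takes the place of the Cauchy-Schwarz inequality;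
    the weight is tuned where the bound is used. *)
Lemma abs_bounded_mul C C' k phi psi : 0 < k ->
  abs_bounded C (fun e => phi e * phi e * elen e) ->
  abs_bounded C' (fun e => psi e * psi e * elen e) ->
  abs_bounded (k * C + k^-1 * C') (fun e => phi e * psi e * elen e).
Proof.
move=> k0 h1 h2 F FO.
apply: (@le_trans _ _ (k * \sum_(e <- F) `|phi e * phi e * elen e| + k^-1 * \sum_(e <- F) `|psi e * psi e * elen e|)); last first.
  by apply: lerD; rewrite ler_pM2l ?invr_gt0//; [exact: h1|exact: h2].
rewrite !mulr_sumr -big_split; apply: ler_sum => e _.
have l0 := elen_gt0 e; have le : `|elen e| = elen e by rewrite gtr0_norm.
rewrite !normrM le /= !mulrA -mulrDl ler_wpM2r ?(ltW l0)//.
have a0 := normr_ge0 (phi e); have b0 := normr_ge0 (psi e).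
set a := `|phi e| in a0 *; set b := `|psi e| in b0 *.
have h : 0 <= k^-1 * (k * a - b) ^+ 2 by rewrite mulr_ge0 ?sqr_ge0// invr_ge0 ltW.
have : k^-1 * (k * a - b) ^+ 2 = k * a * a + k^-1 * b * b - 2 * (a * b).
  by field; rewrite gt_eqF.
by have := mulr_ge0 a0 b0; lra.
Qed.

(** An edge that arrives at [v] and is not in [O] is the reverse of an edge of [O] leaving [v], and
    reversal changes the sign. *)
Lemma div_oriented w v : form w ->
  div hd (dens w) v = \sum_(e \in [set e | O e /\ eterm e = v]) dens w e
       - \sum_(e \in [set e | O e /\ einit e = v]) dens w e.
Proof.
move=> fw; rewrite /div (fsbigID O)//=.
congr (_ + _).
  by apply: eq_fsbigl; apply/seteqP; split=> e /= [].
rewrite (reindex_fsbig (fun e : E => erev e) [set e | O e /\ einit e = v]); last first.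
  split=> [e [Oe <-]|e e' _ _ /(congr1 (@erev _ _ _))|e [/= he nO]].
  - by split; [exact: eterm_erev|exact: (OO e).1].
  - by rewrite !erevK.
  - exists (erev e); last by rewrite erevK.
    split; last by rewrite einit_erev.
    by apply: contrapT => h; apply: nO; apply/OO.
rewrite -[RHS]mulN1r mulr_fsumr; apply: eq_fsbigr => e _.
by rewrite /dens fw mulN1r mulNr.
Qed.

Lemma harmonicP w : form w -> harmonic O w <-> forall v, div hd (dens w) v = 0.
Proof.
move=> fw; split=> [hw v|dw v Vv]; last by rewrite -div_oriented.
have [Vv|nVv] := pselect (V v); first by rewrite div_oriented// hw.
rewrite /div fsbig1// => e /= he; exfalso; apply: nVv; rewrite -he; exact: epar_term.
Qed.

Lemma dens_dform e0 e : dens (dform e0) e = edge_form rv e0 e.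
Proof.
rewrite /dens /dform /edge_form /delta /rv.
have l0 : elen e != 0 by rewrite gt_eqF// elen_gt0.
have [->|n1] := eqVneq e e0.
  rewrite divff ?gt_eqF ?elen_gt0//; case: eqP => [h|]; last by rewrite subr0.
  by have := @erev_neq _ _ _ e0; rewrite -h.
have [->|n2] := eqVneq e (erev e0); last by rewrite mul0r subrr.
by rewrite mulNr divff ?gt_eqF ?elen_gt0// sub0r.
Qed.

Lemma dens_sub w w' e : dens (fun e => w e - w' e) e = dens w e - dens w' e.
Proof. by rewrite /dens mulrBl. Qed.

Lemma abs_bounded_sqB C C' phi psi :
  abs_bounded C (fun e => phi e * phi e * elen e) ->
  abs_bounded C' (fun e => psi e * psi e * elen e) ->
  abs_bounded (2 * (C + C')) (fun e => (phi e - psi e) * (phi e - psi e) * elen e).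
Proof.
move=> h1 h2 F FO.
apply: (@le_trans _ _ (2 * (\sum_(e <- F) `|phi e * phi e * elen e| + \sum_(e <- F) `|psi e * psi e * elen e|))); last first.
  by rewrite ler_pM2l//; apply: lerD; [exact: h1|exact: h2].
rewrite -big_split mulr_sumr; apply: ler_sum => e _ /=.
have l0 := ltW (elen_gt0 e).
rewrite !ger0_norm; try by rewrite mulr_ge0// -expr2 sqr_ge0.
rewrite -mulrDl mulrA ler_wpM2r//.
by have := sqr_ge0 (phi e + psi e); rewrite expr2; lra.
Qed.

Lemma L2harmonicB w w' : L2harmonic O w -> L2harmonic O w' -> L2harmonic O (fun e => w e - w' e).
Proof.
move=> [/L2formP[fw [C bC]] /harmonicP-/(_ fw) hw] [/L2formP[fw' [C' bC']] /harmonicP-/(_ fw') hw'].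
have fB : form (fun e => w e - w' e) by move=> e; rewrite fw fw'; ring.
have dB : dens (fun e => w e - w' e) = (fun e => dens w e + -1 * dens w' e).
  by apply/funext => e; rewrite dens_sub mulN1r.
split; last by apply/harmonicP => // v; rewrite dB divD ?divZ ?hw ?hw' ?mulr0 ?addr0//.
apply/L2formP; split=> //; exists (2 * (C + C')).
have -> : (fun e => dens (fun e => w e - w' e) e * dens (fun e => w e - w' e) e * elen e) =
   (fun e => (dens w e - dens w' e) * (dens w e - dens w' e) * elen e).
  by apply/funext => e; rewrite dens_sub.
exact: abs_bounded_sqB.
Qed.

Local Notation A := (Aop hd rv ln D).

(** [Aop] preserves the pairing with any harmonic form, so each [G n] differs from the edge form by
    something orthogonal to harmonic forms; this passes to the limit in norm, and the limit is
    harmonic. *)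
Lemma harm_proj_limit (e0 : oedge V) :
  (fun n => iter n.*2 A (edge_form rv e0) e0) @ \oo --> dens (harm_proj O (dform e0)) e0.
Proof.
have fg := @fsupp_edge_form R E rv e0; have ag := @antisym_edge_form R E rv rvK e0.
have [h [ah dh ch uh]] := @iterA_limit R E Y hd rv ln D rvK lenr len0 locfin D0 bound _ fg ag.
pose G n := iter n.*2 A (edge_form rv e0).
have fG n : fsupp (G n) by exact: fsupp_iterA.
have aG n : antisym rv (G n) by exact: antisym_iterA.
pose w (e : E) := h e * elen e.
have dw : dens w = h.
  by apply/funext => e; rewrite /dens /w mulfK// gt_eqF// elen_gt0.
have fw : form w by move=> e; rewrite /w ah mulNr.
have sq0 (g : E -> R) e : 0 <= g e * g e * elen e.
  by rewrite mulr_ge0 ?(ltW (elen_gt0 e))// -expr2 sqr_ge0.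
have diff eps : 0 < eps -> exists n, abs_bounded eps (fun e => (G n e - h e) * (G n e - h e) * elen e).
  move=> eps0; have [N NP] := uh _ eps0; exists N => F FO.
  apply: le_trans (NP N F (leqnn N)); apply: ler_sum => e _.
  by rewrite ger0_norm ?expr2//; exact: (sq0 (fun e => G N e - h e)).
have Lw : L2harmonic O w.
  split; last by apply/harmonicP => //; rewrite dw.
  apply/L2formP; split=> //; rewrite dw.
  have [n nP] := diff 1 ltr01.
  have fGG : fsupp (fun e => G n e * G n e * elen e) by apply: fsuppM; exact: fsuppM.
  have bG := fsupp_abs_bounded fGG; set C := fsum _ in bG.
  exists (2 * (1 + C)) => F FO.
  apply: le_trans (_ : 2 * (\sum_(e <- F) `|(G n e - h e) * (G n e - h e) * elen e| + \sum_(e <- F) `|G n e * G n e * elen e|) <= _); last first.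
    by rewrite ler_pM2l//; apply: lerD; [exact: nP|exact: bG].
  rewrite -big_split mulr_sumr; apply: ler_sum => e _ /=.
  rewrite !ger0_norm ?sq0//; last exact: (sq0 (fun e => G n e - h e)).
  rewrite -mulrDl mulrA ler_wpM2r ?(ltW (elen_gt0 e))//.
  by have := sqr_ge0 (2 * G n e - h e); rewrite expr2; lra.
have orth w' : L2harmonic O w' ->
   pn (fun e => (edge_form rv e0 e - h e) * dens w' e * elen e) = 0%E.
  move=> [/L2formP[fw' [C bC]] /harmonicP-/(_ fw') dw'].
  have aw' : antisym rv (dens w') by move=> e; rewrite /dens fw' mulNr.
  set ph := fun e => _ * elen e.
  have C0 := abs_bounded_ge0 bC.
  (* Orthogonality before the limit, where only finite sums occur. [ipE] sums over both
     orientations, hence vanishing over [O] follows by halving. *)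
  have fin n : pn (fun e => (edge_form rv e0 e - G n e) * dens w' e * elen e) = 0%E.
    have fs : fsupp (fun e => (edge_form rv e0 e - G n e) * dens w' e * elen e).
      apply: fsuppM; apply: fsuppM; under eq_fun do rewrite -mulN1r.
      by apply: fsuppD => //; exact: fsuppMr.
    rewrite pn_fsupp//; congr (_%:E).
    have E0 : fsum (fun e => (edge_form rv e0 e - G n e) * dens w' e * elen e) = 0.
      have -> : fsum (fun e => (edge_form rv e0 e - G n e) * dens w' e * elen e) =
          ipE ln (edge_form rv e0) (dens w') + -1 * ipE ln (G n) (dens w').
        rewrite /ipE -fsumZ -fsumD.
        - by apply: eq_fsum => e; rewrite /ln; ring.
        - by apply: fsuppM; exact: fsuppM.
        - by apply: fsuppMr; apply: fsuppM; exact: fsuppM.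
      have -> : ipE ln (G n) (dens w') = ipE ln (edge_form rv e0) (dens w').
        exact: ipE_iterA_harmonic.
      by rewrite mulN1r subrr.
    have := fsum_oriented fs; rewrite E0 => HS.
    have /HS : forall e, (edge_form rv e0 (erev e) - G n (erev e)) * dens w' (erev e) * elen (erev e) =
        (edge_form rv e0 e - G n e) * dens w' e * elen e.
      by move=> e; rewrite (ag e : edge_form rv e0 (erev e) = _) (aG n e : G n (erev e) = _) (aw' e : dens w' (erev e) = _) /=; ring.
    by lra.
  have small eta : 0 < eta -> (`|pn ph| <= eta%:E)%E.
    (* With the first norm at most [eta / 2 / k], both terms of [abs_bounded_mul] are at most
       [eta / 2]. The summand 1 keeps [k] positive when [C] is 0. *)
    move=> eta0; pose k := 2 * (C + 1) / eta.
    have C1 : 0 < C + 1 by rewrite ltr_wpDl.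
    have k0 : 0 < k by rewrite divr_gt0// mulr_gt0.
    have [n nP] := diff _ (divr_gt0 (divr_gt0 eta0 (ltr0Sn R 1)) k0).
    have b2 := abs_bounded_mul k0 nP bC.
    have fs : fsupp (fun e => (edge_form rv e0 e - G n e) * dens w' e * elen e).
      apply: fsuppM; apply: fsuppM; under eq_fun do rewrite -mulN1r.
      by apply: fsuppD => //; exact: fsuppMr.
    have := pnD (fsupp_abs_bounded fs) b2; rewrite fin add0e.
    have -> : (fun e => (edge_form rv e0 e - G n e) * dens w' e * elen e +
        (G n e - h e) * dens w' e * elen e) = ph.
      by apply/funext => e; rewrite /ph; ring.
    move=> ->; apply: le_trans (pn_le b2) _; rewrite lee_fin.
    have -> : k * (eta / 2 / k) = eta / 2 by field; rewrite gt_eqF.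
    have -> : k^-1 * C = eta / 2 * (C / (C + 1)).
      by rewrite /k; field; rewrite !gt_eqF.
    have : eta / 2 * (C / (C + 1)) <= eta / 2 * 1.
      by rewrite ler_pM2l ?divr_gt0// ler_pdivrMr// mul1r lerDl.
    by lra.
  have : (`|pn ph| <= 0%:E)%E.
    by apply/lee_addgt0Pr => eta eta0; rewrite add0e; exact: small.
  by move=> h0; apply/eqP; rewrite -abse_eq0 eq_le h0 abse_ge0.
have Pw : is_harm_proj O (dform e0) w.
  split=> // w' Lw'; rewrite pairingE -[RHS](orth w' Lw'); congr pn.
  by apply/funext => e; rewrite dens_sub dw dens_dform.
suff -> : harm_proj O (dform e0) = w by rewrite dw; exact: ch.
(* [harm_proj] is some form with the defining property. Its difference with [w] is harmonic and
   orthogonal to itself, hence zero on [O], and then everywhere by antisymmetry. *)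
rewrite /harm_proj; case: xgetP => [w2 _ [L2 orth2]|/(_ w)[]//].
have LB := L2harmonicB Lw L2; set d := fun e => _ in LB.
have dd e : dens d e = h e - dens w2 e by rewrite /d dens_sub dw.
have [/L2formP[fw2 [C2 bC2]] _] := L2.
have [/L2formP[_ [Cw bCw]] _] := Lw; rewrite dw in bCw.
have [/L2formP[_ [Cd bCd]] _] := LB.
have fe : fsupp (fun e => edge_form rv e0 e * edge_form rv e0 e * elen e) by apply: fsuppM; exact: fsuppM.
have b1 := abs_bounded_mul ltr01 (abs_bounded_sqB (fsupp_abs_bounded fe) bCw) bCd.
have b2 := abs_bounded_mul ltr01 (abs_bounded_sqB bCw bC2) bCd.
have := pnD b1 b2; rewrite (orth _ LB) add0e.
have -> : (fun e => (edge_form rv e0 e - h e) * dens d e * elen e + (h e - dens w2 e) * dens d e * elen e) =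
   (fun e => dens (fun e => dform e0 e - w2 e) e * dens d e * elen e).
  by apply/funext => e; rewrite dens_sub dens_dform; ring.
rewrite -pairingE (orth2 _ LB).
have p0 e : 0 <= (h e - dens w2 e) * dens d e * elen e.
  by rewrite dd; exact: (sq0 (fun e => h e - dens w2 e)).
rewrite pn_ge0// => Z.
have zO e : O e -> h e = dens w2 e.
  move=> Oe; have : (((h e - dens w2 e) * dens d e * elen e)%:E <= 0)%E.
    rewrite Z; apply: ereal_sup_ubound; exists [set e].
      by split; [exact: finite_set1|move=> _ ->].
    by rewrite fsbig_set1.
  rewrite -[0%E]/(0%:E) lee_fin dd => le0; apply/eqP; rewrite -subr_eq0.
  have : (h e - dens w2 e) * (h e - dens w2 e) * elen e == 0.
    by rewrite eq_le le0 (sq0 (fun e => h e - dens w2 e)).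
  by rewrite !mulf_eq0 orbb [elen e == 0]gt_eqF ?elen_gt0// orbF.
apply/funext => e; have [Oe|nO] := pselect (O e).
  by rewrite /w zO// /dens divfK// gt_eqF// elen_gt0.
have Or : O (erev e) by apply: contrapT => k; apply: nO; apply/OO.
have := zO _ Or; rewrite (ah e : h (erev e) = - h e) /dens fw2 mulNr => /oppr_inj hE.
by rewrite /w hE divfK// gt_eqF// elen_gt0.
Qed.

End HarmonicProjection.

Lemma sum_partition (R : realType) (I J : eqType) (s : seq I) (r : seq J) (t : I -> J) (F : I -> R) :
  uniq r -> (forall i, i \in s -> t i \in r) ->
  \sum_(i <- s) F i = \sum_(j <- r) \sum_(i <- s | t i == j) F i.
Proof.
move=> ur tr; under [RHS]eq_bigr do rewrite big_mkcond.
rewrite exchange_big /=; apply: eq_big_seq => i /tr ti.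
rewrite -big_mkcond /= (eq_bigl (fun j => j == t i)); last by move=> j; rewrite eq_sym.
by rewrite big_mkcond (bigD1_seq (t i))//= eqxx big1 ?addr0// => j /negbTE ->.
Qed.

(** * The trace over one lift of each edge *)

Section CoverTrace.
Context {R : realType} {X Y : metricType R}.
Variables (f : Y -> X) (T : Y -> X -> Y) (lam : R).
Hypothesis CS : covering_system f T lam.
Context {V : set X}.
Hypothesis mgX : metric_graph X.
Hypothesis mgY : metric_graph Y.
Hypothesis vs : vertex_set V.
Hypothesis HE : forall x, ~ V x -> exists e : oedge V, eset e x.
Hypothesis gal : @galois R X Y f.
Hypothesis inf : infinite_fibers f.
Variables (sE : seq (oedge V)) (sV : seq X).
Hypothesis usE : uniq sE.
Hypothesis usV : uniq sV.
Hypothesis sEP : forall e : oedge V, e \in sE.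
Hypothesis sVP : forall x, x \in sV <-> V x.

Local Notation V' := (f @^-1` V).
Local Notation step := (step T lam).
Local Notation walk_end := (walk_end T lam).

Lemma edge_lift_step (e' : oedge V') (e : oedge V) : edge_lift e' e ->
  f (einit e') = einit e /\ step (einit e') e = eterm e'.
Proof.
move=> [le pe]; have fy : f (einit e') = einit e by rewrite /einit -pe.
split=> //; have [_ _ _ _ U] := elift_spec CS fy.
rewrite /step -(U (epar e')) ?/eterm ?le//; first exact: epar_cont.
  by move=> t; rewrite -pe.
by rewrite (ltW (elen_gt0 e)) lexx.
Qed.

(** Lifts are determined by their initial vertex whereas the divergence sums over arriving edges,
    hence the reversal. *)
Lemma edges_at_bij (b : oedge V' -> oedge V) y : (forall e', edge_lift e' (b e')) ->
  V' y ->
  set_bij [set e' : oedge V' | eterm e' = y] [set e : oedge V | einit e = f y]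
    (fun e' => b (erev e')).
Proof.
move=> bP Vy; split.
- move=> e' /= <-; have [<- _] := edge_lift_step (bP (erev e')).
  by rewrite einit_erev.
- move=> e1 e2 /set_mem /= h1 /set_mem /= h2 E.
  have := bP (erev e1); rewrite E => k1.
  have := edge_lift_unique CS k1 (bP (erev e2)).
  rewrite !einit_erev h1 h2 => /(_ erefl) /(congr1 (@erev _ _ _)).
  by rewrite !erevK.
- move=> e /= /esym fy; have [e1 [l1 i1 _]] := elift_oedge_exists CS mgX vs HE fy.
  exists (erev e1); first exact: etrans (eterm_erev e1) i1.
  by rewrite erevK; apply: edge_lift_inj (bP _) l1.
Qed.

(** Connectedness of the cover, expressed by walks of the base so that the same walk can be lifted
    from other points of the fibre. *)
Lemma cover_connected y1 y2 : V' y1 -> V' y2 ->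
  exists a : seq (oedge V), is_walk (f y1) a /\ walk_end y1 a = y2.
Proof.
move=> V1 V2; have vs' := preimage_vertex_set CS mgX vs HE.
have HE' := preimage_edges_exist CS mgX vs HE.
pose F z := exists a : seq (oedge V), is_walk (f y1) a /\ walk_end y1 a = z.
suff : F y2 by [].
apply: (vertex_connected mgY vs' HE' (F := F) _ V1 V2); last by exists [::].
move=> e' [a [wa ea]]; have [e l] := edge_lift_base CS mgX vs HE e'.
have [fe se] := edge_lift_step l.
exists (a ++ [:: e]); split; last by rewrite walk_end_cat ea.
by apply/is_walk_cat; split=> //=; rewrite -(walk_end_proj CS wa) ea fe.
Qed.

Lemma trace_harm_proj (O' : set (oedge V')) (lf : oedge V -> oedge V') :
  orientation O' -> (forall e, edge_lift (lf e) e) ->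
  \sum_(e <- sE) dens (harm_proj O' (dform (lf e))) (lf e) = (size sE)%:R - 2 * (size sV)%:R.
Proof.
move=> OO' lfP.
have /choice[b bP] := edge_lift_base CS mgX vs HE.
have blf e : b (lf e) = e by apply: edge_lift_inj (bP _) (lfP e).
have noedge y : ~ V' y -> [set e' : oedge V' | eterm e' = y] = set0.
  by move=> nV; apply/seteqP; split=> // e' /= h; apply: nV; rewrite -h; exact: epar_term.
have fQ x : finite_set [set e : oedge V | einit e = x].
  by apply: (@sub_finite_set _ _ [set` sE]) => // e _ /=; exact: sEP.
have locfin (y : Y) : finite_set [set e' : oedge V' | eterm e' = y].
  have [Vy|nVy] := pselect (V' y); last by rewrite noedge.
  have [bf bi _] := edges_at_bij bP Vy.
  apply: (@sub_finite_set _ _ [set e' : oedge V' | eterm e' = y]) => //.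
  have : finite_set ((fun e' => b (erev e')) @` [set e' : oedge V' | eterm e' = y]).
    by apply: sub_finite_set (fQ (f y)) => _ [e' he <-]; exact: bf.
  by rewrite (eq_finite_set (inj_card_eq bi)).
have sumQ y (F : oedge V -> R) : V' y ->
    \sum_(e' \in [set e' : oedge V' | eterm e' = y]) F (b (erev e')) = \sum_(e <- sE | einit e == f y) F e.
  move=> Vy; rewrite -(reindex_fsbig _ _ _ _ (edges_at_bij bP Vy)).
  have -> : [set e : oedge V | einit e = f y] = [set` [seq e <- sE | einit e == f y]].
    apply/seteqP; split=> e /=; rewrite mem_filter sEP andbT => /eqP//.
  by rewrite -fsbig_seq ?filter_uniq// big_filter.
(* The edges at [y] correspond to some of the finitely many edges of the base, so the whole sum
   bounds every degree; the 1 keeps [D] positive. *)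
pose D := 1 + \sum_(e <- sE) (elen e)^-1.
have i0 (e : oedge V) : 0 <= (elen e)^-1 by rewrite invr_ge0 ltW// elen_gt0.
have D0 : 0 < D by rewrite ltr_pwDl// sumr_ge0.
have bound (y : Y) : \sum_(e' \in [set e' : oedge V' | eterm e' = y]) (elen e')^-1 <= D.
  have [Vy|nVy] := pselect (V' y); last by rewrite noedge// fsbig_set0 ltW.
  rewrite (eq_fsbigr (fun e' => (fun e => (elen e)^-1) (b (erev e')))); last first.
    by move=> e' _ /=; have [<- _] := bP (erev e').
  rewrite (sumQ y (fun e => (elen e)^-1) Vy) /D; apply: (@le_trans _ _ (\sum_(e <- sE) (elen e)^-1)); last by rewrite lerDr.
  by rewrite big_mkcond; apply: ler_sum => e _; case: ifP.
pose hd (e' : oedge V') : Y := eterm e'.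
pose rv (e' : oedge V') : oedge V' := erev e'.
pose ln (e' : oedge V') : R := elen e'.
have rvK : involutive rv by exact: erevK.
have rvN e' : rv e' <> e' by exact: erev_neq.
have lnr e' : ln (rv e') = ln e' by [].
have ln0 e' : 0 < ln e' by exact: elen_gt0.
pose B := Bop hd rv ln D.
pose K n (p q : Y) : R := kern hd rv ln D n p q.
have BE (u : Y -> R) y : V' y ->
    B u y = u y - (2 * D)^-1 * \sum_(e <- sE | einit e == f y) (u y - u (step y e)) / elen e.
  move=> Vy; rewrite /B /Bop /div -(sumQ _ (fun e => (u y - u (step y e)) / elen e))//.
  congr (_ - _ * _); apply: eq_fsbigr => e' /set_mem he; rewrite -/(hd e') in he.
  have [fe se] := edge_lift_step (bP (erev e')); have [le _] := bP (erev e').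
  have -> : step y (b (erev e')) = hd (rv e') by rewrite -he -[hd e'](einit_erev e') se.
  by rewrite /grad -le -he.
have walkV y (w : seq (oedge V)) : V' y -> is_walk (f y) w -> V' (walk_end y w).
  move=> Vy ww; rewrite /= (walk_end_proj CS ww).
  have {Vy}: V (f y) := Vy; elim: w (f y) ww => //= e w IH x [_ ww] _.
  by apply: IH => //; exact: epar_term.
(* The kernel between the two ends of a lifted walk depends on the walk only. At time 0 it records
   whether the lift closes up, which by normality does not depend on the lift; the recursion for [B]
   only lengthens the walk by one edge. *)
have inv n y1 y2 (w : seq (oedge V)) : V' y1 -> f y1 = f y2 -> is_walk (f y1) w ->
    K n (walk_end y1 w) y1 = K n (walk_end y2 w) y2.
  move=> V1 f12; have V2 : V' y2 by rewrite /= -f12.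
  elim: n w => [|n IH] w ww.
    have [a [wa ea]] := cover_connected V1 V2.
    have [a' [wa' ea']] := cover_connected V2 V1.
    have ww2 : is_walk (f y2) w by rewrite -f12.
    rewrite /K /kern /= /delta; congr ((nat_of_bool _)%:R).
    apply/idP/idP => /eqP h; apply/eqP.
      exact: (galois_closed_walk CS gal f12 wa ea ww h).
    exact: (galois_closed_walk CS gal (esym f12) wa' ea' ww2 h).
  have ww2 : is_walk (f y2) w by rewrite -f12.
  have Vw1 := walkV _ _ V1 ww; have Vw2 := walkV _ _ V2 ww2.
  rewrite /K /kern !iterS -/B (BE _ _ Vw1) (BE _ _ Vw2) -/(kern _ _ _ _ _ _ _) -/(K n _ _) IH//.
  have E12 : f (walk_end y1 w) = f (walk_end y2 w).
    by rewrite (walk_end_proj CS ww) (walk_end_proj CS ww2) f12.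
  rewrite E12 -/(kern _ _ _ _ _ _ _) -/(K n _ _); congr (_ - _ * _).
  apply: eq_bigr => e /eqP ie; congr (_ / _); congr (_ - _).
  have we : is_walk (f y1) (w ++ [:: e]).
    by apply/is_walk_cat; split=> //=; rewrite -(walk_end_proj CS ww) E12 ie.
  by have := IH _ we; rewrite !walk_end_cat.
have /choice[sy syP] : forall x, exists y, f y = x.
  by move=> x; have /infinite_setN0[y] := @inf x; exists y.
(* The return kernel at a vertex and the kernel across an edge, as functions on the base. *)
pose Rk n x := K n (sy x) (sy x).
pose Q n (e : oedge V) := K n (step (sy (einit e)) e) (sy (einit e)).
have sV' x : V x -> V' (sy x) by rewrite /= syP.
have Vi (e : oedge V) : V (einit e) by exact: epar_init.
have KR n y : V' y -> K n y y = Rk n (f y).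
  by move=> Vy; apply: (inv n y (sy (f y)) [::]) => //; rewrite syP.
have KQ n (e' : oedge V') : K n (eterm e') (einit e') = Q n (b e').
  have [fe se] := edge_lift_step (bP e'); rewrite -se /Q.
  have := inv n (einit e') (sy (einit (b e'))) [:: b e'] (epar_init e').
  by rewrite syP; apply => //=; rewrite fe.
have brev e' : b (erev e') = erev (b e').
  by apply: edge_lift_inj (bP _) (edge_lift_rev (bP e')).
have tr n : \sum_(e <- sE) iter n (Aop hd rv ln D) (edge_form rv (lf e)) (lf e) =
    (size sE)%:R - 2 * (size sV)%:R + 2 * \sum_(x <- sV) Rk n x.
  under eq_bigr do rewrite (iterA_edge_form ln D rvN locfin).
  rewrite sumrB big_const_seq count_predT iter_addr_0 -mulr_sumr exchange_big /=.
  have step1 k : \sum_(e <- sE)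
     (kern hd rv ln D k (hd (lf e)) (hd (lf e)) - kern hd rv ln D k (hd (lf e)) (hd (rv (lf e))) -
      (kern hd rv ln D k (hd (rv (lf e))) (hd (lf e)) - kern hd rv ln D k (hd (rv (lf e))) (hd (rv (lf e))))) / ln (lf e)
    = 4 * D * \sum_(x <- sV) (Rk k x - Rk k.+1 x).
    (* The four kernels of an edge split into one term for each end. Summed over the edges leaving
       [x], [G] is [2 * D] times one step of the recursion at [x]; the two orientations give
       [4 * D], and the sum over [k] telescopes from [Rk 0 x = 1]. *)
    pose G e := (Rk k (einit e) - Q k e) / elen e.
    transitivity (\sum_(e <- sE) (G e + G (erev e))).
      apply: eq_bigr => e _; have [fe se] := edge_lift_step (lfP e).
      have [fr sr] := edge_lift_step (edge_lift_rev (lfP e)).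
      have [le _] := lfP e.
      rewrite -!/(K _ _ _) /hd /rv eterm_erev !KR; [|exact: epar_init|exact: epar_term].
      rewrite KQ blf.
      have -> : K k (einit (lf e)) (eterm (lf e)) = Q k (erev e).
        by rewrite -(blf e) -brev -KQ eterm_erev einit_erev blf.
      rewrite fe -[f (eterm _)](_ : f (einit (erev (lf e))) = _) ?einit_erev// in fr *.
      rewrite /G (_ : ln (lf e) = elen e)// (_ : elen (erev e) = elen e)// einit_erev fr; ring.
    rewrite big_split /=.
    have -> : \sum_(e <- sE) G (erev e) = \sum_(e <- sE) G e.
      rewrite -(big_map (@erev _ _ _) xpredT G); apply: perm_big.
      apply: uniq_perm => //; first by rewrite map_inj_uniq//; exact: inv_inj (@erevK _ _ _).
      move=> e; rewrite sEP; apply/mapP; exists (erev e); rewrite ?erevK//.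
    rewrite -mulr2n -[LHS]mulr_natl (sum_partition _ usV (t := fun e => einit e)); last first.
      by move=> e _; apply/sVP; exact: epar_init.
    rewrite !mulr_sumr; apply: eq_big_seq => x /sVP Vx.
    have := BE (fun p => K k p (sy x)) (sy x) (sV' x Vx); rewrite syP.
    have -> : B (fun p => K k p (sy x)) (sy x) = Rk k.+1 x by [].
    rewrite -/(Rk k x) => ->.
    have -> : \sum_(e <- sE | einit e == x) G e = \sum_(e <- sE | einit e == x) (K k (sy x) (sy x) - K k (step (sy x) e) (sy x)) / elen e.
      by apply: eq_bigr => e /eqP <-.
    by field; rewrite gt_eqF.
  under [X in _ - _ * X]eq_bigr do rewrite step1.
  rewrite -mulr_sumr exchange_big /=.
  have -> : \sum_(x <- sV) \sum_(k < n) (Rk k x - Rk k.+1 x) = (size sV)%:R - \sum_(x <- sV) Rk n x.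
    rewrite -[(size sV)%:R](_ : \sum_(x <- sV) 1 = _); last first.
      by rewrite big_const_seq count_predT iter_addr_0.
    rewrite -sumrB; apply: eq_big_seq => x _.
    rewrite -(big_mkord xpredT (fun k => Rk k x - Rk k.+1 x)).
    have -> : \sum_(0 <= k < n) (Rk k x - Rk k.+1 x) = - \sum_(0 <= k < n) (Rk k.+1 x - Rk k x).
      by rewrite -sumrN; under [RHS]eq_bigr do rewrite opprB.
    rewrite telescope_sumr// opprB; congr (_ - _).
    by rewrite /Rk /K /kern /= /delta eqxx.
  by field; rewrite gt_eqF.
have cR x : V x -> (fun n => Rk n x) @ \oo --> (0 : R).
  move=> Vx; apply: (return_kernel_vanishes rvK lnr ln0 locfin D0 bound (sV' x Vx)).
    by apply: sub_infinite_set (@inf x) => y /= ->.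
  move=> P Px Pe p Vp; have vs' := preimage_vertex_set CS mgX vs HE.
  have HE' := preimage_edges_exist CS mgX vs HE.
  apply: (vertex_connected mgY vs' HE' (F := P) _ (sV' x Vx) Vp) => // e' he.
  by apply: Pe; rewrite /rv eterm_erev.
have lim1 := @cvg_sum_seq R _ sE (fun n e => iter n.*2 (Aop hd rv ln D) (edge_form rv (lf e)) (lf e)) _ (fun e => @harm_proj_limit _ _ _ O' D OO' locfin D0 bound (lf e)).
have lim2 : (fun n => \sum_(e <- sE) iter n.*2 (Aop hd rv ln D) (edge_form rv (lf e)) (lf e)) @ \oo -->
    ((size sE)%:R - 2 * (size sV)%:R : R).
  have dbl : (fun n => n.*2) @ \oo --> \oo.
    by move=> A [N _ NA]; exists N => // n /= Nn; apply: NA => /=; lia.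
  have limR : (fun n => \sum_(x <- sV) Rk n x) @ \oo --> (0 : R).
    have -> : (fun n => \sum_(x <- sV) Rk n x) = (fun n => \sum_(x <- sV) if x \in sV then Rk n x else 0).
      by apply/funext => n; apply: eq_big_seq => x ->.
    have := @cvg_sum_seq R _ sV (fun n x => if x \in sV then Rk n x else 0) (fun=> 0).
    have -> : \sum_(x <- sV) 0 = 0 :> R by rewrite big1.
    apply=> x.
    by case: (boolP (x \in sV)) => [/sVP Vx|_]; [exact: cR|exact: cvg_cst].
  under eq_fun do rewrite tr.
  suff : (fun n => (size sE)%:R - 2 * (size sV)%:R + 2 * \sum_(x <- sV) Rk n.*2 x) @ \oo -->
    ((size sE)%:R - 2 * (size sV)%:R + 2 * 0 : R) by rewrite mulr0 addr0.
  apply: cvgD; first exact: cvg_cst.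
  by apply: cvgMr; exact: cvg_comp dbl limR.
exact: (cvg_unique (@Rhausdorff R) lim1 lim2).
Qed.

End CoverTrace.

(** * Singular 1-chains *)

Section Chains.
Context {R : realType} {X : topologicalType}.
Local Notation simplex n := (@simplex R X n).

Lemma fsum_sum (T : choiceType) (I : Type) (r : seq I) (F : I -> T -> R) :
  (forall i, fsupp (F i)) ->
  fsupp (fun x => \sum_(i <- r) F i x) /\
  fsum (fun x => \sum_(i <- r) F i x) = \sum_(i <- r) fsum (F i).
Proof.
move=> fF; elim: r => [|i r [IH1 IH2]].
  rewrite big_nil; split; last first.
    by rewrite /fsum fsbig1// => x _; rewrite big_nil.
  by apply: (@fsupp_sub _ _ set0) => // x _; rewrite big_nil.
rewrite big_cons; have E : (fun x => \sum_(i <- i :: r) F i x) = (fun x => F i x + \sum_(i <- r) F i x).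
  by apply/funext => x; rewrite big_cons.
by rewrite E; split; [exact: fsuppD|rewrite fsumD// IH2].
Qed.

Definition single (T : choiceType) (s : T) : T -> R := fun t => (t == s)%:R.

Lemma fsupp_single (T : choiceType) (s : T) : fsupp (single s).
Proof. by apply: (@fsupp_sub _ _ [set s]) => // t /eqP/negbTE; rewrite /single => ->. Qed.

Lemma boundaryE n (c : simplex n.+1 -> R) (t : simplex n) : chain c ->
  boundary c t = \sum_(s <- fset_set [set s | c s != 0]) c s * \sum_(i < n.+2) (-1) ^+ i * (face i s == t)%:R.
Proof.
move=> fc; rewrite /boundary -/(fsum _); apply: fsumE => // s ns.
by rewrite (@fsuppN0 _ _ c s ns) mul0r.
Qed.

(** Adjunction of boundary and coboundary, [phi] being read as a cochain. *)
Lemma fsum_boundary n (c : simplex n.+1 -> R) (phi : simplex n -> R) : chain c ->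
  fsum (fun t => boundary c t * phi t) =
  fsum (fun s => c s * \sum_(i < n.+2) (-1) ^+ i * phi (face i s)).
Proof.
move=> fc; rewrite [RHS](@fsumE _ _ [set s | c s != 0])//; last first.
  by move=> s ns; rewrite (@fsuppN0 _ _ c s ns) mul0r.
pose r := fset_set [set s | c s != 0].
pose F (s : simplex n.+1) (i : 'I_n.+2) (t : simplex n) := c s * (-1) ^+ i * ((t == face i s)%:R * phi t).
have fF s i : fsupp (F s i) by apply/fsuppMr/fsuppM/fsupp_single.
transitivity (fsum (fun t => \sum_(s <- r) \sum_(i < n.+2) F s i t)).
  apply: eq_fsum => t; rewrite boundaryE// mulr_suml; apply: eq_bigr => s _.
  rewrite -mulrA mulr_suml mulr_sumr; apply: eq_bigr => i _.
  by rewrite /F eq_sym; ring.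
have fF' s := fsum_sum (index_enum 'I_n.+2) (fF s).
rewrite (fsum_sum r (fun s => (fF' s).1)).2; apply: eq_bigr => s _.
rewrite (fF' s).2 mulr_sumr; apply: eq_bigr => i _.
by rewrite /F fsumZ fsum_delta mulrA.
Qed.

Lemma continuous_pair (S T U : topologicalType) (f : S -> T) (g : S -> U) :
  continuous f -> continuous g -> continuous (fun x => (f x, g x)).
Proof. by move=> cf cg x; exact: (cvg_pair (cf x) (cg x)). Qed.

Definition crd n (i : 'I_n.+1) (v : @stdsimplex R n) : R := set_val v ord0 i.

Lemma continuous_crd n (i : 'I_n.+1) : continuous (@crd n i).
Proof.
move=> v; apply: (@continuous_comp _ _ _ (fun v : @stdsimplex R n => set_val v : 'rV[R]_n.+1) (fun M : 'rV[R]_n.+1 => M ord0 i)).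
  exact: (@initial_continuous (@stdsimplex R n) _ set_val v).
exact: coord_continuous.
Qed.

Lemma crd_ge0 n (i : 'I_n.+1) (v : @stdsimplex R n) : 0 <= crd i v.
Proof. by have [h _] := set_valP v; exact: h. Qed.

Lemma crd_sum1 (v : @stdsimplex R 1) : crd ord0 v = 1 - crd ord_max v.
Proof.
have [_] := set_valP v; rewrite !big_ord_recl big_ord0 addr0 => h.
rewrite /crd -h (_ : lift ord0 ord0 = ord_max); last exact/val_inj.
by ring.
Qed.

Lemma crd_itv (v : @stdsimplex R 1) : 0 <= crd ord_max v <= 1.
Proof. by rewrite crd_ge0 -subr_ge0 -crd_sum1 crd_ge0. Qed.

Lemma crd_inj (v w : @stdsimplex R 1) : crd ord_max v = crd ord_max w -> v = w.
Proof.
move=> h; apply: val_inj; apply/rowP => i.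
case: (unliftP ord_max i) => [j|] -> //; rewrite (ord1 j).
rewrite (_ : lift ord_max ord0 = ord0); last exact/val_inj.
by have := crd_sum1 v; rewrite h -crd_sum1.
Qed.

Lemma simplex_point n (u : 'I_n.+1 -> R) : (forall i, 0 <= u i) -> \sum_i u i = 1 ->
  exists v : @stdsimplex R n, forall i, crd i v = u i.
Proof.
move=> u0 u1; have h : (\row_i u i) \in @stdsimplex R n.
  apply/mem_set; split=> [i|]; first by rewrite mxE.
  by under eq_bigr do rewrite mxE.
by exists (exist _ (\row_i u i) h : @stdsimplex R n) => i; rewrite /crd set_valE /= mxE.
Qed.

Lemma simplex_exists n (f : @stdsimplex R n -> X) : continuous f ->
  exists s : simplex n, forall v, s v = f v.
Proof.
move=> cf; pose s : simplex n := HB.pack_for (simplex n) f (@isContinuous.Build _ _ f cf).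
by exists s.
Qed.

Lemma crd_coface n (i : 'I_n.+2) j (v : @stdsimplex R n) :
  crd j (coface i v) = if unlift i j is Some k then crd k v else 0.
Proof. by rewrite /crd /coface set_valE /= mxE. Qed.

(* The 1-simplex of the path [p], as a chain; it only depends on [p] over
   [0, 1], and it is 0 if [p] is not continuous there. *)
Definition path_chain (p : R -> X) : simplex 1 -> R :=
  fun s => (`[< forall v, s v = p (crd ord_max v) >])%:R.

Lemma path_chainE (p : R -> X) (s : simplex 1) : (forall v, s v = p (crd ord_max v)) ->
  forall t, path_chain p t = (s == t)%:R.
Proof.
move=> sp t; congr ((nat_of_bool _)%:R); apply/asboolP/eqP => [tp|<-//].
by apply/continuousEP => v; rewrite sp tp.
Qed.

Lemma eq_path_chain (p q : R -> X) : (forall t : R, 0 <= t <= 1 -> p t = q t) ->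
  path_chain p = path_chain q.
Proof.
move=> pq; apply/funext => s; congr ((nat_of_bool _)%:R).
by apply/asboolP/asboolP => h v; rewrite h pq// crd_itv.
Qed.

Lemma path_simplex (p : R -> X) : continuous p ->
  exists s : simplex 1, path_chain p = single s /\ forall v, s v = p (crd ord_max v).
Proof.
move=> cp; have [|s sP] := @simplex_exists 1 (fun v => p (crd ord_max v)).
  by move=> v; apply: continuous_comp; [exact: continuous_crd|exact: cp].
by exists s; split=> //; apply/funext => t; rewrite (path_chainE sP) eq_sym.
Qed.

Lemma simplex_map (T : topologicalType) n (u : T -> 'I_n.+1 -> R) :
  (forall i, continuous (u^~ i)) -> (forall t i, 0 <= u t i) -> (forall t, \sum_i u t i = 1) ->
  exists g : T -> @stdsimplex R n, continuous g /\ forall t i, crd i (g t) = u t i.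
Proof.
move=> cu u0 u1; have /choice[g gP] := fun t => simplex_point (u0 t) (u1 t).
exists g; split=> //; apply: continuous_comp_initial => t.
have -> : set_val \o g = (fun t => \row_i u t i).
  by apply/funext => r /=; apply/rowP => i; rewrite mxE -gP.
move=> A [P PA sPA].
have h i : nbhs t [set r | P ord0 i ((\row_i u r i : 'rV[R]_n.+1) ord0 i)].
  have := PA ord0 i; rewrite mxE => Pi.
  have h1 : nbhs t [set r | P ord0 i (u r i)] := cu i t _ Pi.
  by apply: filterS h1 => r /=; rewrite mxE.
have h2 := @filter_forall _ _ _ (nbhs t) (nbhs_filter t) h.
by apply: (filterS _ h2) => r hr; apply: sPA => i j; rewrite (ord1 i); exact: hr.
Qed.

Lemma simplex_path (s : simplex 1) : exists p : R -> X, continuous p /\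
  forall v, s v = p (crd ord_max v).
Proof.
have cc := @continuous_clamp R 0 1 ler01.
have c01 (t : R) : 0 <= clamp 0 1 t <= 1 by exact: clamp_itv.
have [|||g [cg gP]] := @simplex_map R 1 (fun t i => if i == ord_max then clamp 0 1 t else 1 - clamp 0 1 t).
- move=> i; case: (i == ord_max) => //= t.
  by apply: cvgB; [exact: cvg_cst|exact: cc].
- by move=> t i; have /andP[? ?] := c01 t; case: ifP => // _; rewrite subr_ge0.
- by move=> t; rewrite !big_ord_recl big_ord0 /=; ring.
exists (fun t => s (g t)); split; last first.
  by move=> v; congr (s _); apply: crd_inj; rewrite gP eqxx clamp_id// crd_itv.
by move=> t; apply: (@continuous_comp _ _ _ g s); [exact: cg|exact: cts_fun].
Qed.

(** Homologies are established in an arbitrary submodule [K] containing the boundaries. Later [K]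
    also contains the edges, so that working modulo [K] discards them. *)
Definition submodule (T : Type) (K : (T -> R) -> Prop) : Prop :=
  K (fun=> 0) /\ forall a b u v, K u -> K v -> K (fun t => a * u t + b * v t).

Lemma submodule_comb (T : Type) (K : (T -> R) -> Prop) a b u v w : submodule K ->
  K u -> K v -> (forall t, w t = a * u t + b * v t) -> K w.
Proof. by move=> [_ KS] Ku Kv /funext ->; exact: KS. Qed.

Lemma submodule_comb4 (T : Type) (K : (T -> R) -> Prop) a1 a2 a3 a4 u1 u2 u3 u4 w : submodule K ->
  K u1 -> K u2 -> K u3 -> K u4 ->
  (forall t, w t = a1 * u1 t + a2 * u2 t + a3 * u3 t + a4 * u4 t) -> K w.
Proof.
move=> SK K1 K2 K3 K4 wE.
have K12 := (SK.2 a1 a2 _ _ K1 K2); have K34 := (SK.2 a3 a4 _ _ K3 K4).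
by apply: (submodule_comb (a := 1) (b := 1) SK K12 K34) => t; rewrite wE; ring.
Qed.

Lemma submodule_sum (T I : Type) (K : (T -> R) -> Prop) (r : seq I) (a : I -> R) (u : I -> T -> R) :
  submodule K -> (forall i, K (u i)) -> K (fun t => \sum_(i <- r) a i * u i t).
Proof.
move=> SK Ku; elim: r => [|i r IH].
  have -> : (fun t => \sum_(i <- [::]) a i * u i t) = (fun=> 0) by apply/funext => t; rewrite big_nil.
  by case: SK.
by apply: (submodule_comb (a := a i) (b := 1) SK (Ku i) IH) => t; rewrite big_cons mul1r.
Qed.

Lemma submodule_boundary1 : submodule (@boundary1 R X).
Proof.
have bE (b : simplex 2 -> R) t : chain b -> boundary b t = fsum (fun s => b s * \sum_(i < 3) (-1) ^+ i * (face i s == t)%:R).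
  by move=> _.
split; first by exists (fun=> 0) => [|t]; [apply: (@fsupp_sub _ _ set0)|rewrite /boundary fsbig1// => s _; rewrite mul0r].
move=> a b u v [bu cu bu_u] [bv cv bv_v].
exists (fun s => a * bu s + b * bv s) => [|t]; first by apply: fsuppD; exact: fsuppMr.
rewrite bE; last by apply: fsuppD; exact: fsuppMr.
rewrite -bu_u -bv_v !bE// -!fsumZ -fsumD.
- by apply: eq_fsum => s; ring.
- exact/fsuppMr/fsuppM.
- exact/fsuppMr/fsuppM.
Qed.

Section Congruences.
Variable K : (simplex 1 -> R) -> Prop.
Hypothesis SK : submodule K.
Hypothesis KB : forall u, boundary1 u -> K u.

Lemma triangle_chain (h : R * R -> X) : continuous h ->
  K (fun t => path_chain (fun r => h (r, 0)) t + path_chain (fun r => h (1 - r, r)) t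
              - path_chain (fun r => h (0, r)) t).
Proof.
move=> ch; have [|s sP] := @simplex_exists 2 (fun v => h (crd (lift ord0 ord0) v, crd ord_max v)).
  move=> v; apply: (@continuous_comp _ _ _ (fun v : @stdsimplex R 2 => (crd (lift ord0 ord0) v, crd ord_max v)) h).
    by apply: continuous_pair; exact: continuous_crd.
  exact: ch.
apply: KB; exists (single s) => [|t]; first exact: fsupp_single.
rewrite /boundary -/(fsum _) fsum_delta !big_ord_recl big_ord0 /=.
have f0 v : face ord0 s v = h (1 - crd ord_max v, crd ord_max v).
  rewrite /face /= sP !crd_coface liftK.
  rewrite (_ : ord_max = lift ord0 ord_max); last exact/val_inj.
  by rewrite liftK crd_sum1.
have f1 v : face (lift ord0 ord0) s v = h (0, crd ord_max v).
  rewrite /face /= sP !crd_coface unlift_none.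
  rewrite (_ : (ord_max : 'I_3) = lift (lift ord0 ord0) ord_max); last exact/val_inj.
  by rewrite liftK.
have f2 v : face (lift ord0 (lift ord0 ord0)) s v = h (crd ord_max v, 0).
  rewrite /face /= sP !crd_coface.
  rewrite (_ : (ord_max : 'I_3) = lift ord0 (lift ord0 ord0)); last exact/val_inj.
  rewrite unlift_none (_ : (lift ord0 ord0 : 'I_3) = lift (lift ord0 (lift ord0 ord0)) ord_max); last exact/val_inj.
  by rewrite liftK.
rewrite -(@path_chainE (fun r => h (1 - r, r)) _ f0) -(@path_chainE (fun r => h (0, r)) _ f1).
rewrite -(@path_chainE (fun r => h (r, 0)) _ f2) /bump /= !exprS expr0; ring.
Qed.

Lemma cst_chain (x : X) : K (path_chain (fun=> x)).
Proof.
have := @triangle_chain (fun=> x) (@cst_continuous _ _ x) => /= h.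
by apply: (submodule_comb (a := 1) (b := 0) SK h h) => t; ring.
Qed.

(** [a > b] is allowed and gives the reversed piece of path. *)
Definition seg (p : R -> X) (a b : R) : R -> X := fun t => p (a + t * (b - a)).

Lemma continuous_seg (p : R -> X) (a b : R) : continuous p -> continuous (seg p a b).
Proof.
move=> cp; rewrite (_ : seg p a b = p \o (fun t => a + t * (b - a)))// => t.
apply: continuous_comp; last exact: cp.
apply: cvgD; first exact: cvg_cst.
by apply: cvgM; [exact: cvg_id|exact: cvg_cst].
Qed.

(** A degenerate triangle, factoring through the line, has the three segments as sides; so pieces of
    a path add up whatever the order of [a], [b], [c]. *)
Lemma seg_chain (p : R -> X) (a b c : R) : continuous p ->
  K (fun t => path_chain (seg p a b) t + path_chain (seg p b c) t - path_chain (seg p a c) t).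
Proof.
move=> cp; pose h (z : R * R) := p (a + z.1 * (b - a) + z.2 * (c - a)).
have ch : continuous h.
  move=> z; apply: (@continuous_comp _ _ _ (fun z : R * R => a + z.1 * (b - a) + z.2 * (c - a)) p); last exact: cp.
  apply: cvgD; [apply: cvgD; first exact: cvg_cst|]; apply: cvgM.
  - exact: cvg_fst.
  - exact: cvg_cst.
  - exact: cvg_snd.
  - exact: cvg_cst.
have := triangle_chain ch.
have -> : (fun r => h (r, 0)) = seg p a b by apply/funext => r; rewrite /h /seg /=; congr p; ring.
have -> : (fun r => h (1 - r, r)) = seg p b c by apply/funext => r; rewrite /h /seg /=; congr p; ring.
by have -> : (fun r => h (0, r)) = seg p a c by apply/funext => r; rewrite /h /seg /=; congr p; ring.
Qed.

(** The square is cut along its diagonal, whose two contributions cancel. *)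
Lemma square_chain (H : R * R -> X) : continuous H ->
  K (fun t => path_chain (fun r => H (r, 0)) t + path_chain (fun r => H (1, r)) t
      - path_chain (fun r => H (0, r)) t - path_chain (fun r => H (r, 1)) t).
Proof.
move=> cH.
have cp (g : R * R -> R * R) : continuous g -> continuous (H \o g).
  by move=> cg z; apply: continuous_comp; [exact: cg|exact: cH].
have cD : continuous (fun z : R * R => z.1 + z.2).
  by move=> z; apply: cvgD; [exact: cvg_fst|exact: cvg_snd].
have c1 : continuous (fun z : R * R => (z.1 + z.2, z.2)).
  by apply: continuous_pair => // z; exact: cvg_snd.
have c2 : continuous (fun z : R * R => (z.2, z.1 + z.2)).
  by apply: continuous_pair => // z; exact: cvg_snd.
have h1 := triangle_chain (cp _ c1); have h2 := triangle_chain (cp _ c2).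
apply: (submodule_comb (a := 1) (b := - 1) SK h1 h2) => t /=.
have e1 : (fun r => H (r + 0, 0)) = (fun r => H (r, 0)) by apply/funext => r; rewrite addr0.
have e2 : (fun r => H (1 - r + r, r)) = (fun r => H (1, r)) by apply/funext => r; rewrite subrK.
have e3 : (fun r => H (0 + r, r)) = (fun r => H (r, r)) by apply/funext => r; rewrite add0r.
have e4 : (fun r => H (0, r + 0)) = (fun r => H (0, r)) by apply/funext => r; rewrite addr0.
have e5 : (fun r => H (r, 1 - r + r)) = (fun r => H (r, 1)) by apply/funext => r; rewrite subrK.
have e6 : (fun r => H (r, 0 + r)) = (fun r => H (r, r)) by apply/funext => r; rewrite add0r.
by rewrite /comp /= e1 e2 e3 e4 e5 e6; ring.
Qed.

End Congruences.
End Chains.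

(** * Chains of a metric graph *)

Section EdgeSpanning.
Context {R : realType} {X : metricType R} {V : set X}.
Hypothesis mg : metric_graph X.
Hypothesis vs : vertex_set V.
Hypothesis HE : forall x, ~ V x -> exists e : oedge V, eset e x.
Hypothesis cX : compact [set: X].

(** [q y] runs radially from the centre at time 0 to [y] at time 1. The joint estimate in [y] and
    [s] makes homotopies built from it continuous, also where a path crosses the centre. *)
Lemma cstar_contraction (x : X) n (r : R) (p : 'I_n -> R -> X) : cstar x r p ->
  exists q : X -> R -> X,
  (forall y, mdist x y < r -> (y = x /\ forall s, q y s = x) \/
     exists k (u : R), [/\ 0 < u < r, y = p k u & forall s, q y s = p k (s * u)]) /\
  forall y y' (s s' : R), mdist x y < r -> mdist x y' < r -> 0 <= s <= 1 -> 0 <= s' <= 1 ->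
    mdist (q y s) (q y' s') <= mdist y y' + `|s - s'| * r.
Proof.
move=> cs; have [r0 px py pd] := cs.
have [|q qP] := @choice _ _ (fun y qy => mdist x y < r -> (y = x /\ forall s, qy s = x) \/
     exists k (u : R), [/\ 0 < u < r, y = p k u & forall s, qy s = p k (s * u)]).
  move=> y; have [xy|nxy] := pselect (mdist x y < r); last by exists (fun=> x).
  have [->|[k [u [uI yE]]]] := py y xy; first by exists (fun=> x) => _; left.
  by exists (fun s => p k (s * u)) => _; right; exists k, u.
exists q; split=> // y y' s s' xy xy' sI s'I.
have /andP[s0 s1] := sI; have /andP[s'0 s'1] := s'I.
have su (u a : R) : 0 < u < r -> 0 <= a <= 1 -> 0 <= a * u < r.
  move=> /andP[u0 ur] /andP[a0 a1]; rewrite mulr_ge0 ?(ltW u0)//=.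
  by apply: le_lt_trans ur; rewrite ler_piMl// ltW.
apply: le_trans (metric_triangle _ (q y' s) _) _; apply: lerD.
  have [[-> qx]|[k [u [uI -> qy]]]] := qP y xy; have [[-> qx']|[l [u' [u'I -> qy']]]] := qP y' xy'.
  - by rewrite !qx !mdistxx.
  - rewrite qx qy' !(cstar_dist _ cs) ?su//; last by case/andP: u'I => /ltW -> ->.
    by rewrite ler_piMl//; case/andP: u'I => /ltW.
  - rewrite qy qx' ![mdist _ x]metric_sym !(cstar_dist _ cs) ?su//; last by case/andP: uI => /ltW -> ->.
    by rewrite ler_piMl//; case/andP: uI => /ltW.
  - have /andP[u0 ur] := uI; have /andP[u'0 u'r] := u'I.
    rewrite qy qy' !pd ?su// ?(ltW u0) ?(ltW u'0)// /star_dist; case: ifP => _.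
      by rewrite -mulrBr normrM (ger0_norm s0) ler_piMl.
    by rewrite -mulrDr ler_piMl// addr_ge0// ltW.
have [[-> qx']|[l [u' [u'I _ qy']]]] := qP y' xy'.
  by rewrite !qx' mdistxx mulr_ge0// ltW.
rewrite !qy' pd ?su// /star_dist eqxx -mulrBl normrM ler_wpM2l//.
by case/andP: u'I => u0 ur; rewrite ger0_norm ltW.
Qed.

Variable K : (@simplex R X 1 -> R) -> Prop.
Hypothesis SK : submodule K.
Hypothesis KB : forall u, boundary1 u -> K u.
Hypothesis KE : forall e : oedge V, K (path_chain (seg (epar e) 0 (elen e))).

(** Modulo [K] an initial segment of an edge depends only on its end point: seen from the reverse
    orientation it differs by the whole edge, which is in [K]. [gam] picks a representative, 0 at
    vertices. *)
Lemma edge_potential : exists gam : X -> @simplex R X 1 -> R,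
  forall (e : oedge V) (u : R), 0 <= u <= elen e ->
    K (fun t => path_chain (seg (epar e) 0 u) t - gam (epar e u) t).
Proof.
have [|gam gP] := @choice _ _ (fun y (g : @simplex R X 1 -> R) => (V y -> g = fun=> 0) /\
   (~ V y -> exists (e : oedge V) (u : R), [/\ 0 < u < elen e, epar e u = y & g = path_chain (seg (epar e) 0 u)])).
  move=> y; have [Vy|nVy] := pselect (V y); first by exists (fun=> 0).
  have [e [u /=]] := HE nVy; rewrite in_itv /= => uI uy.
  by exists (path_chain (seg (epar e) 0 u)); split=> // _; exists e, u.
have Kcst (p : R -> X) y : (forall t, p t = y) -> K (path_chain p).
  by move=> py; have -> : p = (fun=> y); [apply/funext|exact: cst_chain].
exists gam => e u /andP[]; rewrite le_eqVlt => /predU1P[<- _|u0].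
  rewrite (gP _).1; last exact: epar_init.
  have K0 : K (path_chain (seg (epar e) 0 0)).
    by apply: (@Kcst _ (epar e 0)) => t; rewrite /seg subrr mulr0 addr0.
  by apply: (submodule_comb (a := 1) (b := 0) SK K0 K0) => t; ring.
rewrite le_eqVlt => /predU1P[->|ul].
  rewrite (gP _).1; last exact: epar_term.
  by apply: (submodule_comb (a := 1) (b := 0) SK (KE e) (KE e)) => t; ring.
have uI : 0 < u < elen e by rewrite u0.
have [e' [u' [u'I ee' ->]]] := (gP (epar e u)).2 (epar_notV uI).
have [[-> ->]|[-> ->]] := oedge_eq u'I uI ee'.
  by apply: (submodule_comb (a := 0) (b := 0) SK (KE e) (KE e)) => t; ring.
have -> : seg (epar (erev e)) 0 (elen e - u) = seg (epar e) (elen e) u.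
  by apply/funext => t; rewrite /seg /=; congr (epar e _); ring.
have k1 := seg_chain KB 0 u (elen e) (@epar_cont _ _ _ e).
have k2 := seg_chain KB u (elen e) u (@epar_cont _ _ _ e).
have k3 : K (path_chain (seg (epar e) u u)).
  by apply: (@Kcst _ (epar e u)) => t; rewrite /seg subrr mulr0 addr0.
by apply: (submodule_comb4 (a1 := 1) (a2 := -1) (a3 := -1) (a4 := 1) SK k1 k2 k3 (KE e)) => t; ring.
Qed.

(** The radial contraction fills a square whose sides are the path, a constant path and two radial
    segments; a radial segment is a difference of two initial segments of one edge. *)
Lemma small_path_chain (gam : X -> @simplex R X 1 -> R) x n r (e : 'I_n -> oedge V) a (d : R -> X) :
  (forall (e : oedge V) (u : R), 0 <= u <= elen e ->
    K (fun t => path_chain (seg (epar e) 0 u) t - gam (epar e u) t)) ->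
  edge_chart x r e a -> continuous d -> (forall t : R, 0 <= t <= 1 -> mdist x (d t) < r) ->
  K (fun t => path_chain d t - (gam (d 1) t - gam (d 0) t)).
Proof.
move=> gP [cs a0 al _] cd dr; have [r0 px _ _] := cs.
have [q [qP qlip]] := cstar_contraction cs.
have radial y : mdist x y < r -> K (fun t => path_chain (q y) t - (gam y t - gam x t)).
  move=> xy; have [[-> qx]|[k [u [uI yE qy]]]] := qP y xy.
    have -> : q x = (fun=> x) by exact/funext.
    have kc := cst_chain SK KB x.
    by apply: (submodule_comb (a := 1) (b := 0) SK kc kc) => t; ring.
  have /andP[u0 ur] := uI.
  have -> : q y = seg (epar (e k)) (a k) (a k + u).
    by apply/funext => s; rewrite qy /seg; congr (epar _ _); ring.
  have k1 := seg_chain KB 0 (a k) (a k + u) (@epar_cont _ _ _ (e k)).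
  have ha : 0 <= a k <= elen (e k).
    by rewrite a0 /=; apply: le_trans (al k); rewrite lerDl ltW.
  have hu : 0 <= a k + u <= elen (e k).
    by rewrite addr_ge0 ?(ltW u0)//=; apply: le_trans (al k); rewrite lerD2l ltW.
  have k2 := gP _ _ ha; have k3 := gP _ _ hu.
  have xE : epar (e k) (a k) = x by have := px k; rewrite addr0.
  rewrite -yE xE in k2 k3.
  by apply: (submodule_comb4 (a1 := 1) (a2 := -1) (a3 := 1) (a4 := 0) SK k1 k2 k3 k3) => t; ring.
have c01 (t : R) : 0 <= clamp 0 1 t <= 1 by exact: clamp_itv.
have cdc : continuous (d \o clamp 0 1).
  by move=> t; apply: continuous_comp; [exact: continuous_clamp|exact: cd].
pose H (z : R * R) := q (d (clamp 0 1 z.2)) (clamp 0 1 z.1).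
have cH : continuous H.
  move=> z A /nbhs_mdist[eps eps0 eA].
  exists ([set s : R | `|z.1 - s| < eps / (2 * r)], [set t | mdist ((d \o clamp 0 1) z.2) ((d \o clamp 0 1) t) < eps / 2]).
    split.
      by apply/nbhs_ballP; exists (eps / (2 * r)) => //=; rewrite divr_gt0// mulr_gt0.
    by apply: (cdc z.2 [set w | mdist ((d \o clamp 0 1) z.2) w < eps / 2]); apply/nbhs_mdist; exists (eps / 2) => //; rewrite divr_gt0.
  move=> [s t] /= [zs zt]; apply: eA.
  rewrite /H /=; apply: le_lt_trans (qlip _ _ _ _ (dr _ (c01 _)) (dr _ (c01 _)) (c01 _) (c01 _)) _.
  have -> : eps = eps / 2 + eps / (2 * r) * r by field; rewrite gt_eqF.
  apply: ltr_leD => //; rewrite ler_wpM2r ?(ltW r0)//.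
  by apply: le_trans (clamp_lip _ _ _) (ltW zs).
have z01 : 0 <= (0 : R) <= 1 by rewrite lexx ler01.
have o01 : 0 <= (1 : R) <= 1 by rewrite lexx ler01.
have k := square_chain SK KB cH; rewrite /H /= in k.
have q0 y : mdist x y < r -> q y 0 = x.
  by move=> xy; have [[-> ->]//|[k' [u [uI yE ->]]]] := qP y xy; rewrite mul0r.
have q1 y : mdist x y < r -> q y 1 = y.
  by move=> xy; have [[-> ->]//|[k' [u [uI yE ->]]]] := qP y xy; rewrite mul1r.
have E1 : path_chain (fun s => q (d (clamp 0 1 0)) (clamp 0 1 s)) = path_chain (q (d 0)).
  by apply: eq_path_chain => t tI; rewrite !clamp_id.
have E2 : path_chain (fun t => q (d (clamp 0 1 t)) (clamp 0 1 1)) = path_chain d.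
  by apply: eq_path_chain => t tI; rewrite !clamp_id// q1//; exact: dr.
have E3 : path_chain (fun t => q (d (clamp 0 1 t)) (clamp 0 1 0)) = path_chain (fun=> x).
  by apply: eq_path_chain => t tI; rewrite !clamp_id// q0//; exact: dr.
have E4 : path_chain (fun s => q (d (clamp 0 1 1)) (clamp 0 1 s)) = path_chain (q (d 1)).
  by apply: eq_path_chain => t tI; rewrite !clamp_id.
rewrite E1 E2 E3 E4 in k.
have k0 := radial _ (dr 0 z01); have k1 := radial _ (dr 1 o01); have kc := cst_chain SK KB x.
by apply: (submodule_comb4 (a1 := 1) (a2 := -1) (a3 := 1) (a4 := 1) SK k k0 k1 kc) => t; ring.
Qed.

Lemma path_chain_potential : exists gam : X -> @simplex R X 1 -> R,
  forall p : R -> X, continuous p -> K (fun t => path_chain p t - (gam (p 1) t - gam (p 0) t)).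
Proof.
have [gam gP] := edge_potential; exists gam => p cp.
pose rad x r := exists n (e : 'I_n -> oedge V) a, edge_chart x r e a.
have /choice[r rP] : forall x, exists r : R, rad x r.
  by move=> x; have [n [r [e [a ch]]]] := edge_chart_exists mg vs HE x; exists r, n, e, a.
have r0 x : 0 < r x by have [n [e [a [[]]]]] := rP x.
have [|d0 d00 d0P] := lebesgue_number (W := fun x => [set y | mdist x y < r x]) cX.
  by move=> x _; apply/nbhs_mdist; exists (r x).
have cp' : {within `[(0 : R), 1], continuous p} by exact: continuous_subspaceT.
have [d1 d10 d1P] := compact_unif_continuous (segment_compact (a := 0) (b := 1)) cp' d00.
have [N NP] := small_mesh d10; have {}NP := NP N (leqnn N).
pose m i : R := i%:R / N.+1%:R.
have N0 : (0 : R) < N.+1%:R by rewrite ltr0n.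
have step i : (i <= N.+1)%N -> K (fun t => path_chain (seg p 0 (m i)) t - (gam (p (m i)) t - gam (p 0) t)).
  elim: i => [_|i IH iN].
    have -> : seg p 0 (m 0%N) = (fun=> p 0).
      by apply/funext => t; rewrite /seg /m mul0r subrr mulr0 addr0.
    have -> : m 0%N = 0 by rewrite /m mul0r.
    have kc := cst_chain SK KB (p 0).
    by apply: (submodule_comb (a := 1) (b := 0) SK kc kc) => t; ring.
  have {}IH := IH (ltnW iN).
  have [y _ yP] := d0P (p (m i)) I; have [n [e [a ch]]] := rP y.
  have mi : 0 <= m i <= 1 by apply: mesh_itv; exact: ltnW.
  have mS : m i.+1 - m i = N.+1%:R^-1.
    by rewrite /m -natr1; field; rewrite gt_eqF.
  have mi1 : 0 <= m i.+1 <= 1 by exact: mesh_itv.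
  have csg : continuous (seg p (m i) (m i.+1)) by exact: continuous_seg.
  have k1 : K (fun t => path_chain (seg p (m i) (m i.+1)) t - (gam (p (m i.+1)) t - gam (p (m i)) t)).
    have -> : p (m i.+1) = seg p (m i) (m i.+1) 1 by rewrite /seg mul1r addrC subrK.
    have -> : p (m i) = seg p (m i) (m i.+1) 0 by rewrite /seg mul0r addr0.
    apply: (small_path_chain gP ch csg) => t /andP[t0 t1]; apply: yP.
    rewrite ballEmdist /= /seg mS.
    have mt : m i + t * N.+1%:R^-1 <= m i.+1.
      have -> : m i.+1 = m i + N.+1%:R^-1 by rewrite -mS addrC subrK.
      by rewrite lerD2l ler_piMl// invr_ge0 ltW.
    apply: d1P.
    - by rewrite /= in_itv.
    - have /andP[mi0 _] := mi; have /andP[_ mi1'] := mi1.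
      by rewrite /= in_itv /= (le_trans mt)// addr_ge0// mulr_ge0// invr_ge0 ltW.
    - rewrite /ball /= opprD addrA subrr sub0r normrN ger0_norm; last by rewrite mulr_ge0// invr_ge0 ltW.
      by apply: le_lt_trans NP; rewrite ler_piMl// invr_ge0 ltW.
  have k2 := seg_chain KB 0 (m i) (m i.+1) cp.
  by apply: (submodule_comb4 (a1 := 1) (a2 := 1) (a3 := -1) (a4 := 0) SK IH k1 k2 k2) => t; ring.
have := step N.+1 (leqnn _); rewrite /m divff ?gt_eqF//.
by have -> : seg p 0 1 = p by apply/funext => t; rewrite /seg subr0 mulr1 add0r.
Qed.

(** Each 1-simplex is congruent to the difference of [gam] at its ends. Summed against [z], these
    differences pair the boundary of [z] with a 0-cochain, so nothing is left when [z] is a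
    cycle. *)
Lemma cycle1_submodule z : cycle1 z -> K z.
Proof.
move=> [fz dz]; have [gam gP] := path_chain_potential.
have [|| pt _] := @simplex_point R 0 (fun=> 1) => //; first by rewrite big_ord1.
pose phi t (s : @simplex R X 0) := gam (s pt) t.
have Ks (s : @simplex R X 1) : K (fun t => single s t - \sum_(i < 2) (-1) ^+ i * phi t (face i s)).
  have [p [cp sp]] := simplex_path s.
  have f0 : face ord0 s pt = p 1.
    rewrite /face /= sp crd_coface (_ : ord_max = lift ord0 ord0); last exact/val_inj.
    rewrite liftK; congr p; have [_] := set_valP pt; rewrite big_ord1 => h; exact: h.
  have f1 : face (lift ord0 ord0) s pt = p 0.
    rewrite /face /= sp crd_coface (_ : (ord_max : 'I_2) = lift ord0 ord0); last exact/val_inj.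
    by rewrite unlift_none.
  apply: (submodule_comb (a := 1) (b := 0) SK (gP p cp) (gP p cp)) => t.
  rewrite (path_chainE sp) /single eq_sym !big_ord_recl big_ord0 /phi f0 f1 /bump /= expr0 expr1; ring.
have h := submodule_sum (fset_set [set s | z s != 0]) z SK Ks.
suff zE : z = (fun t => \sum_(s <- fset_set [set s | z s != 0]) z s * (single s t - \sum_(i < 2) (-1) ^+ i * phi t (face i s))) by rewrite zE.
apply/funext => t; under eq_bigr do rewrite mulrBr.
rewrite sumrB.
have zF (F : @simplex R X 1 -> R) : \sum_(s <- fset_set [set s | z s != 0]) z s * F s = fsum (fun s => z s * F s).
  by rewrite (@fsumE _ _ [set s | z s != 0])// => s ns; rewrite (@fsuppN0 _ _ z s ns) mul0r.
rewrite !zF -fsum_boundary// (eq_fsum (G := fun s => (s == t)%:R * z s)); last first.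
  by move=> s; rewrite /single eq_sym mulrC.
rewrite fsum_delta [X in _ - X](_ : _ = 0) ?subr0// /fsum fsbig1// => s _.
by rewrite dz mul0r.
Qed.

End EdgeSpanning.

(** * Winding numbers along an edge *)

Section FractionalPart.
Context {R : realType}.
Implicit Types a b : R.

(* The representative of [a] modulo 1 in [-1/2, 1/2[. *)
Definition centred a : R := a - (Num.floor (a + 2^-1))%:~R.

Lemma centredP a : a - centred a \is a Num.int.
Proof. by rewrite /centred opprB addrC subrK intr_int. Qed.

Lemma centred_eq a b : a - b \is a Num.int -> `|b| < 2^-1 -> centred a = b.
Proof.
move=> /intrP[m mE]; rewrite ltr_norml => /andP[b1 b2].
have -> : a = m%:~R + b by rewrite -mE subrK.
rewrite /centred (@Num.Theory.floor_def _ _ m); first by rewrite addrAC subrr add0r.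
by rewrite intrD /=; apply/andP; split; lra.
Qed.

Lemma int_num_eq a b : a \is a Num.int -> a = b -> b \is a Num.int.
Proof. by move=> ? <-. Qed.

Lemma centred0 : centred 0 = 0.
Proof. by apply: centred_eq; rewrite ?subrr ?int_num0// normr0 invr_gt0. Qed.

End FractionalPart.

Section EdgeCocycle.
Context {R : realType} {X : metricType R} {V : set X}.
Hypothesis mg : metric_graph X.
Hypothesis vs : vertex_set V.
Hypothesis HE : forall x, ~ V x -> exists e : oedge V, eset e x.
Hypothesis cX : compact [set: X].
Variable e : oedge V.
Local Notation l := (elen e).

Definition edge_sign (e1 : oedge V) : R := (e1 == e)%:R - (e1 == erev e)%:R.

Lemma edge_sign_self : edge_sign e = 1.
Proof.
rewrite /edge_sign eqxx; case: eqP => [/esym/erev_neq//|_].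
by rewrite subr0.
Qed.

Lemma edge_sign_le1 e1 : `|edge_sign e1| <= 1.
Proof.
have [->|/negbTE h] := eqVneq e1 e; first by rewrite edge_sign_self normr1.
by rewrite /edge_sign h sub0r normrN; case: eqP => _; rewrite ?normr1 ?normr0.
Qed.

(* The coordinate of [e] modulo 1 collapses the rest of the graph to a point
   and winds once around the circle along [e]. *)
Lemma edge_angle : exists theta : X -> R, forall e1 u, 0 <= u <= elen e1 ->
  theta (epar e1 u) - edge_sign e1 * (u / l) \is a Num.int.
Proof.
have l0 : 0 < l := elen_gt0 e.
have [|theta tP] := @choice _ _ (fun x (a : R) => (forall u, 0 < u < l -> epar e u = x -> a = u / l) /\
   ((forall u, 0 < u < l -> epar e u <> x) -> a = 0)).
  move=> x; have [[u [uI ux]]|nu] := pselect (exists u, 0 < u < l /\ epar e u = x); last first.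
    by exists 0; split=> // u uI ux; case: nu; exists u.
  exists (u / l); split=> [u' u'I u'x|/(_ u uI)//].
  by rewrite (oedge_inj u'I uI) // u'x ux.
exists theta => e1 u uI; have [Vx|nVx] := pselect (V (epar e1 u)).
  rewrite (tP _).2; last by move=> u' u'I h; apply: (epar_notV u'I); rewrite h.
  rewrite sub0r rpredN; have [ee|ne] := boolP ((e1 == e) || (e1 == erev e)); last first.
    by move: ne; rewrite negb_or /edge_sign => /andP[/negbTE -> /negbTE ->]; rewrite subrr mul0r int_num0.
  have l1 : elen e1 = l by case/orP: ee => /eqP ->.
  rewrite rpredM//; first by rewrite /edge_sign rpredB// natr_int.
  have /andP[] := uI; rewrite le_eqVlt => /predU1P[<- _|u0]; first by rewrite mul0r int_num0.
  rewrite le_eqVlt => /predU1P[->|ul]; first by rewrite l1 divff ?gt_eqF// int_num1.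
  by case: (@epar_notV _ _ _ e1 u) => //; rewrite u0.
have uI' : 0 < u < elen e1.
  have /andP[u0 ul] := uI; rewrite !lt_neqAle u0 ul !andbT; apply/andP; split; apply/eqP => h; apply: nVx.
    by rewrite -h; exact: epar_init.
  by rewrite h; exact: epar_term.
have [h|h] := eqVneq e1 e.
  rewrite h in uI' *; rewrite ((tP _).1 u uI' erefl) edge_sign_self.
  by rewrite mul1r subrr int_num0.
have [h'|h'] := eqVneq e1 (erev e).
  have uI2 : 0 < l - u < l by move: uI'; rewrite h' /= => /andP[? ?]; apply/andP; split; lra.
  rewrite ((tP _).1 (l - u) uI2); last by rewrite h' /=.
  rewrite /edge_sign (negbTE h) h' eqxx sub0r mulN1r opprK mulrBl divff ?gt_eqF//.
  by rewrite subrK int_num1.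
rewrite (tP _).2; last first.
  move=> u' u'I hh; have [[? _]|[? _]] := oedge_eq uI' u'I (esym hh).
    by move: h => /eqP.
  by move: h' => /eqP.
by rewrite /edge_sign (negbTE h) (negbTE h') subrr mul0r subr0 int_num0.
Qed.

(** [theta] itself may jump, but modulo 1 it varies by [t / l] at most along a ray of length [t].
    The bound 1/4 ensures that two steps add up to less than 1/2, where centred representatives are
    additive. *)
Lemma edge_angle_close (theta : X -> R) :
  (forall e1 u, 0 <= u <= elen e1 -> theta (epar e1 u) - edge_sign e1 * (u / l) \is a Num.int) ->
  exists2 lam : R, 0 < lam & forall x x', mdist x x' < lam -> `|centred (theta x' - theta x)| < 4^-1.
Proof.
move=> tP; have l0 : 0 < l := elen_gt0 e.
pose W y := [set w | exists b : R, `|b| < 8^-1 /\ theta w - theta y - b \is a Num.int].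
have [|lam lam0 lamP] := lebesgue_number (W := W) cX.
  move=> x _; have [n [r [e1 [a [[r0 px py pd] a0 al _]]]]] := edge_chart_exists mg vs HE x.
  apply/nbhs_mdist; exists (Num.min r (l / 8)); first by rewrite lt_min r0 divr_gt0.
  move=> y; rewrite lt_min => /andP[yr yl].
  have [->|[k [t [tI yE]]]] := py y yr.
    by exists 0; rewrite normr0 subrr subr0 int_num0.
  have /andP[t0 tr] := tI.
  have ty : mdist x y = t.
    rewrite yE -(px k) pd ?lexx// /star_dist ?eqxx ?sub0r ?normrN ?gtr0_norm//.
    by rewrite (ltW t0).
  exists (edge_sign (e1 k) * (t / l)); split.
    rewrite normrM; apply: (@le_lt_trans _ _ (1 * `|t / l|)).
      by rewrite ler_wpM2r// edge_sign_le1.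
    rewrite mul1r ger0_norm ?divr_ge0 ?(ltW t0) ?(ltW l0)// ltr_pdivrMr// mulrC -ty.
    by [].
  have h1 : 0 <= a k <= elen (e1 k).
    by rewrite a0 /=; apply: le_trans (al k); rewrite lerDl ltW.
  have h2 : 0 <= a k + t <= elen (e1 k).
    by rewrite addr_ge0 ?(ltW t0)//=; apply: le_trans (al k); rewrite lerD2l ltW.
  have xE : epar (e1 k) (a k) = x by have := px k; rewrite addr0.
  by apply: (int_num_eq (rpredB (tP _ _ h2) (tP _ _ h1))); rewrite yE xE; ring.
exists lam => // x x' xx'; have [y _ yP] := lamP x I.
have [b [b8 bi]] : W y x by apply: yP; rewrite ballEmdist /= mdistxx.
have [b' [b'8 b'i]] : W y x' by apply: yP; rewrite ballEmdist.
have bb : `|b' - b| < 4^-1.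
  apply: le_lt_trans (ler_normB _ _) _.
  by rewrite (_ : 4^-1 = 8^-1 + 8^-1 :> R) ?ltrD//; field.
rewrite (@centred_eq _ _ (b' - b))//.
  by apply: (int_num_eq (rpredB b'i bi)); ring.
by apply: lt_trans bb _; rewrite ltf_pV2 ?posrE// ltr_nat.
Qed.

(** A discrete local system with fibre [R]: transport adds the centred increments of the angle.
    [Jp p] is the resulting winding along [p], and [Tr_square], on a square mapped onto a triangle,
    gives the cocycle relation. *)
Lemma edge_cocycle : exists J : @simplex R X 1 -> R,
  (forall s : @simplex R X 2, \sum_(i < 3) (-1) ^+ i * J (face i s) = 0) /\
  forall e1 (s : @simplex R X 1), (forall v, s v = seg (epar e1) 0 (elen e1) (crd ord_max v)) -> J s = edge_sign e1.
Proof.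
have l0 : 0 < l := elen_gt0 e.
have [theta tP] := edge_angle; have [lam lam0 lamP] := edge_angle_close tP.
pose c x x' := centred (theta x' - theta x).
pose T (y : X * R) (x' : X) : X * R := (x', y.2 + c y.1 x').
have TS : transport_system fst T lam.
  split=> //.
  - move=> [x a] x1 x2 /= d1 d2 d3; congr pair; rewrite -addrA; congr (a + _).
    apply/esym/centred_eq; last first.
      apply: le_lt_trans (ler_normD _ _) _; rewrite (_ : 2^-1 = 4^-1 + 4^-1 :> R); last by field.
      by apply: ltrD; exact: lamP.
    by apply: (int_num_eq (rpredD (centredP (theta x1 - theta x)) (centredP (theta x2 - theta x1)))); rewrite /c; ring.
  - by move=> [x a]; rewrite /T /= /c subrr centred0 addr0.
pose Jp (p : R -> X) := (Tr T lam p (p 0, 0)).2.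
(* Transport commutes with translations of the fibre, so the winding measured from 0 determines it
   from any height. *)
have shift (p : nat -> X) n x a : dtr T p n (x, a) = ((dtr T p n (x, 0)).1, a + (dtr T p n (x, 0)).2).
  elim: n => [|n IH] /=; first by rewrite addr0.
  by rewrite IH /T /=; congr (_, _); exact: esym (addrA _ _ _).
have TrJ (p : R -> X) a : {within `[(0 : R), 1], continuous p} ->
    Tr T lam p (p 0, a) = (p 1, a + Jp p).
  move=> cp; have := Tr_pi TS cp (erefl : (p 0, a).1 = p 0).
  rewrite /Jp /Tr /trn shift /= => <-; by [].
have eqJ (p q : R -> X) : {within `[(0 : R), 1], continuous p} -> (forall t : R, 0 <= t <= 1 -> p t = q t) ->
    Jp p = Jp q.
  move=> cp pq; have p0 : p 0 = q 0 by rewrite pq// lexx ler01.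
  by rewrite /Jp -p0 (eq_Tr TS _ cp pq).
have [|J JP] := @choice _ _ (fun (s : @simplex R X 1) (a : R) => forall p : R -> X, continuous p -> (forall v, s v = p (crd ord_max v)) -> a = Jp p).
  move=> s; have [p [cp sp]] := simplex_path s; exists (Jp p) => q cq sq.
  apply: eqJ; first exact: continuous_subspaceT.
  move=> t tI; have [||v vP] := @simplex_point R 1 (fun i => if i == ord_max then t else 1 - t).
  - by move=> i; case: ifP => _; rewrite ?subr_ge0; case/andP: tI.
  - by rewrite !big_ord_recl big_ord0 /=; ring.
  have <- : crd ord_max v = t by rewrite vP eqxx.
  by rewrite -sp -sq.
exists J; split=> [s|e1 s sE]; last first.
  rewrite (JP s _ (@continuous_seg _ _ (epar e1) 0 (elen e1) (@epar_cont _ _ _ e1)) sE).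
  have cs : {within `[(0 : R), 1], continuous (seg (epar e1) 0 (elen e1))}.
    by apply: continuous_subspaceT; exact/continuous_seg/epar_cont.
  (* At least three steps, so that each one advances the angle by at most 1/3, which is its own
     centred representative. *)
  have [n0 /(fineW (leq_addr 2 n0))] := fine_exists TS cs; set n := (n0 + 2)%N => fn.
  set p := seg _ _ _ in cs fn *.
  have N0 : (0 : R) < n.+1%:R by rewrite ltr0n.
  rewrite /Jp (TrE TS _ fn)// /trn.
  suff h i : (i <= n.+1)%N -> dtr T (mesh p n) i (p 0, 0) = (mesh p n i, i%:R * (edge_sign e1 / n.+1%:R)).
    by rewrite h//= mulrC divfK// gt_eqF.
  elim: i => [_|i IH iN]; first by rewrite /= /mesh !mul0r.
  rewrite /= IH ?(ltnW iN)// /T /=; congr pair.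
  have -> : i.+1%:R * (edge_sign e1 / n.+1%:R) = i%:R * (edge_sign e1 / n.+1%:R) + edge_sign e1 / n.+1%:R.
    by rewrite -[i.+1%:R]natr1; ring.
  congr (_ + _); apply: centred_eq; last first.
    rewrite normrM normfV (ger0_norm (ltW N0)) ltr_pdivrMr//.
    apply: (@le_lt_trans _ _ 1); first exact: edge_sign_le1.
    have h2 : (2 : R) < n.+1%:R by rewrite ltr_nat /n !addnS.
    by move: h2; lra.
  have mE j : (j <= n.+1)%N -> theta (mesh p n j) - edge_sign e1 * (j%:R / n.+1%:R) \is a Num.int.
    move=> jn; have /andP[m0 m1] := @mesh_itv R n j jn.
    have h : 0 <= j%:R / n.+1%:R * elen e1 <= elen e1.
      by rewrite mulr_ge0 ?(ltW (elen_gt0 _))//= ler_piMl// ltW// elen_gt0.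
    have := tP _ _ h; rewrite /mesh /p /seg subr0 add0r.
    have [ee|ne] := boolP ((e1 == e) || (e1 == erev e)); last first.
      by move: ne; rewrite negb_or /edge_sign => /andP[/negbTE -> /negbTE ->]; rewrite subrr !mul0r.
    have -> : elen e1 = l by case/orP: ee => /eqP ->.
    by rewrite mulfK// gt_eqF.
  by apply: (int_num_eq (rpredB (mE _ iN) (mE _ (ltnW iN)))); rewrite -[i.+1%:R]natr1; ring.
have cc := @continuous_clamp R 0 1 ler01.
have c01 (t : R) : 0 <= clamp 0 1 t <= 1 by exact: clamp_itv.
(* The map from [(a, b)] to the barycentric coordinates [(1 - a, a (1 - b), a b)] collapses the side
   [a = 0] to a vertex; the other three sides are the faces of the triangle. *)
pose u (z : R * R) (i : 'I_3) : R := let a := clamp 0 1 z.1 in let b := clamp 0 1 z.2 in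
  if i == ord0 then 1 - a else if i == ord_max then a * b else a * (1 - b).
have [|||g [cg gP]] := @simplex_map R (R * R)%type 2 u.
- have ca : continuous (fun z : R * R => clamp 0 1 z.1).
    by move=> z; apply: continuous_comp; [exact: cvg_fst|exact: cc].
  have cb : continuous (fun z : R * R => clamp 0 1 z.2).
    by move=> z; apply: continuous_comp; [exact: cvg_snd|exact: cc].
  move=> i z; rewrite /u; case: (i == ord0); last case: (i == ord_max).
  + by apply: cvgB; [exact: cvg_cst|exact: ca].
  + by apply: cvgM; [exact: ca|exact: cb].
  + by apply: cvgM; [exact: ca|apply: cvgB; [exact: cvg_cst|exact: cb]].
- move=> z i; have /andP[? ?] := c01 z.1; have /andP[? ?] := c01 z.2.
  by rewrite /u; case: ifP => _; [|case: ifP => _]; rewrite ?mulr_ge0// subr_ge0.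
- by move=> z; rewrite !big_ord_recl big_ord0 /u /=; ring.
pose H z := s (g z).
have cH : continuous H by move=> z; apply: (@continuous_comp _ _ _ g s); [exact: cg|exact: cts_fun].
have crd_ext (v w : @stdsimplex R 2) : (forall i, crd i v = crd i w) -> v = w.
  by move=> h; apply: val_inj; apply/rowP => i; exact: h.
have z01 : 0 <= (0 : R) <= 1 by rewrite lexx ler01.
have o01 : 0 <= (1 : R) <= 1 by rewrite lexx ler01.
have cl0 : clamp 0 1 0 = 0 :> R by rewrite clamp_id.
have cl1 : clamp 0 1 1 = 1 :> R by rewrite clamp_id.
have i3 (P : 'I_3 -> Prop) : P ord0 -> P (lift ord0 ord0) -> P ord_max -> forall i, P i.
  move=> h0 h1 h2 i; case: (unliftP ord0 i) => [j|] -> //.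
  case: (unliftP ord0 j) => [k|] -> //.
  by rewrite (ord1 k) (_ : lift ord0 _ = ord_max) //; exact/val_inj.
have o3 : (ord_max : 'I_3) = lift ord0 (lift ord0 ord0) by exact/val_inj.
have f2 v : face ord_max s v = H (crd ord_max v, 0).
  rewrite /face /= /H; congr (s _); apply: crd_ext; apply: i3; rewrite gP /u /= ?cl0 ?clamp_id ?crd_itv//.
  - rewrite crd_coface (_ : ord0 = lift (ord_max : 'I_3) ord0); last exact/val_inj.
    by rewrite liftK crd_sum1.
  - rewrite crd_coface (_ : lift ord0 ord0 = lift (ord_max : 'I_3) ord_max); last exact/val_inj.
    by rewrite liftK subr0 mulr1.
  - by rewrite crd_coface unlift_none mulr0.
have f0 v : face ord0 s v = H (1, crd ord_max v).
  rewrite /face /= /H; congr (s _); apply: crd_ext; apply: i3; rewrite gP /u /= ?cl1 ?clamp_id ?crd_itv//.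
  - by rewrite crd_coface unlift_none subrr.
  - by rewrite crd_coface liftK mul1r crd_sum1.
  - rewrite crd_coface (_ : (ord_max : 'I_3) = lift ord0 ord_max); last exact/val_inj.
    by rewrite liftK mul1r.
have f1 v : face (lift ord0 ord0) s v = H (crd ord_max v, 1).
  rewrite /face /= /H; congr (s _); apply: crd_ext; apply: i3; rewrite gP /u /= ?cl1 ?clamp_id ?crd_itv//.
  - rewrite crd_coface (_ : ord0 = lift (lift ord0 ord0 : 'I_3) ord0); last exact/val_inj.
    by rewrite liftK crd_sum1.
  - by rewrite crd_coface unlift_none subrr mulr0.
  - rewrite crd_coface (_ : (ord_max : 'I_3) = lift (lift ord0 ord0) ord_max); last exact/val_inj.
    by rewrite liftK mulr1.
have c1 (a : R) : continuous (fun r : R => H (a, r)).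
  move=> r; apply: (@continuous_comp _ _ _ (fun r => (a, r)) H); last exact: cH.
  by apply: continuous_pair => // ?; [exact: cvg_cst|exact: cvg_id].
have c2 (a : R) : continuous (fun r : R => H (r, a)).
  move=> r; apply: (@continuous_comp _ _ _ (fun r => (r, a)) H); last exact: cH.
  by apply: continuous_pair => // ?; [exact: cvg_id|exact: cvg_cst].
rewrite !big_ord_recl big_ord0 -o3 (JP _ _ (c1 1) f0) (JP _ _ (c2 1) f1) (JP _ _ (c2 0) f2).
have H0 (t : R) : H (0, t) = H (0, 0).
  rewrite /H; congr (s _); apply: crd_ext; apply: i3; rewrite !gP /u /= cl0 ?mul0r//.
have J0 : Jp (fun r => H (0, r)) = 0.
  have -> : (fun r => H (0, r)) = (fun=> H (0, 0)) by apply/funext.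
  by rewrite /Jp (Tr_cst TS).
have := @Tr_square _ _ _ _ _ _ TS H (H (0, 0), 0) (continuous_subspaceT cH) erefl.
rewrite (TrJ (fun r => H (0, r)))//; last exact: continuous_subspaceT.
rewrite (TrJ (fun r => H (r, 0)))//; last exact: continuous_subspaceT.
rewrite (TrJ (fun r => H (r, 1)))//; last exact: continuous_subspaceT.
rewrite (TrJ (fun r => H (1, r)))//; last exact: continuous_subspaceT.
rewrite J0 => -[]; rewrite !add0r /bump /= !exprS expr0 => ->; ring.
Qed.

End EdgeCocycle.

(** * The first Betti number *)

Section Betti.
Context {R : realType} {X : topologicalType}.

Lemma boundary1_sum (I : Type) (r : seq I) (a : I -> R) (u : I -> @simplex R X 1 -> R) :
  (forall i, boundary1 (u i)) -> boundary1 (fun t => \sum_(i <- r) a i * u i t).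
Proof. by move=> h; exact: submodule_sum submodule_boundary1 h. Qed.

(** The coordinates of each basis in the other form two matrices whose product is the identity, by
    uniqueness of coordinates; this bounds [g] by [g']. *)
Lemma H1_basis_le g g' (b : 'I_g -> @simplex R X 1 -> R) (b' : 'I_g' -> @simplex R X 1 -> R) :
  H1_basis b -> H1_basis b' -> (g <= g')%N.
Proof.
move=> [bc bP] [b'c b'P].
have /choice[B BP] : forall k, exists a : 'rV[R]_g', boundary1 (fun s => b k s - \sum_(j < g') a ord0 j * b' j s).
  by move=> k; have [a [aP _]] := b'P _ (bc k); exists a.
have /choice[A AP] : forall k, exists a : 'rV[R]_g, boundary1 (fun s => b' k s - \sum_(j < g) a ord0 j * b j s).
  by move=> k; have [a [aP _]] := bP _ (b'c k); exists a.
apply: (@mulmx1_min R g g' (\matrix_(k, j) B k ord0 j) (\matrix_(k, j) A k ord0 j)).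
apply/row_matrixP => k; have [a [_ aU]] := bP _ (bc k).
rewrite -(aU (row k (1%:M))) ?row1; last first.
  have [c0 _] := @submodule_boundary1 R X.
  suff -> : (fun s => b k s - \sum_(j < g) (delta_mx 0 k : 'rV[R]_g) ord0 j * b j s) = (fun=> 0) by [].
  apply/funext => s; rewrite (bigD1 k)//= mxE !eqxx mul1r big1 ?addr0 ?subrr// => j jk.
  by rewrite mxE eqxx (negbTE jk) mul0r.
apply/esym/aU.
have h1 := boundary1_sum (index_enum 'I_g') (fun j => B k ord0 j) AP.
apply: (submodule_comb (a := 1) (b := 1) submodule_boundary1 (BP k) h1) => s.
rewrite !mul1r; under [X in _ = _ + X]eq_bigr do rewrite mulrBr.
rewrite sumrB addrA subrK; congr (_ - _).
under eq_bigr do rewrite !mxE mulr_suml.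
rewrite exchange_big /=; apply: eq_bigr => j _; rewrite mulr_sumr; apply: eq_bigr => i _.
by rewrite !mxE mulrA.
Qed.

Lemma genusE g (b : 'I_g -> @simplex R X 1 -> R) : H1_basis b -> genus R X = g.
Proof.
move=> hb; rewrite /genus; apply: xget_unique; first by exists b.
move=> g' [b' hb']; apply/eqP; rewrite eqn_leq.
by rewrite (H1_basis_le hb hb') (H1_basis_le hb' hb).
Qed.

Lemma point_simplex : exists p : @stdsimplex R 0, crd ord0 p = 1.
Proof.
have [||p pP] := @simplex_point R 0 (fun=> 1) => //; first by rewrite big_ord1.
by exists p.
Qed.

Lemma coboundary_cocycle (phi : @simplex R X 0 -> R) (s : @simplex R X 2) :
  \sum_(i < 3) (-1) ^+ i * \sum_(j < 2) (-1) ^+ j * phi (face j (face i s)) = 0.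
Proof.
have E (i i' : 'I_3) (j j' : 'I_2) : lift i (lift j ord0) = lift i' (lift j' ord0) ->
    phi (face j (face i s)) = phi (face j' (face i' s)).
  move=> h; congr phi; apply/continuousEP => v; rewrite /face /=; congr (s _).
  have vv (a : 'I_1) : crd a v = crd ord0 v by rewrite (ord1 a).
  have w (i0 : 'I_3) (j0 : 'I_2) k : crd k (coface i0 (coface j0 v)) = (k == lift i0 (lift j0 ord0))%:R * crd ord0 v.
    rewrite crd_coface; case: unliftP => [k1|] ->; last by rewrite (negbTE (neq_lift _ _)) mul0r.
    rewrite crd_coface (inj_eq (@lift_inj _ _)); case: unliftP => [k2|] ->; last by rewrite (negbTE (neq_lift _ _)) mul0r.
    by rewrite (ord1 k2) eqxx mul1r.
  by apply: val_inj; apply/rowP => k; have := w i j k; rewrite h -w.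
rewrite !big_ord_recl !big_ord0 /bump /= !exprS expr0.
rewrite (E (lift ord0 ord0) ord0 ord0 ord0); last exact/val_inj.
rewrite (E (lift ord0 (lift ord0 ord0)) ord0 ord0 (lift ord0 ord0)); last exact/val_inj.
rewrite (E (lift ord0 (lift ord0 ord0)) (lift ord0 ord0) (lift ord0 ord0) (lift ord0 ord0)); last exact/val_inj.
by ring.
Qed.

End Betti.

(** * The genus of a compact metric graph *)

Section Genus.
Context {R : realType} {X : metricType R} {V : set X}.
Hypothesis mg : metric_graph X.
Hypothesis vs : vertex_set V.
Hypothesis HE : forall x, ~ V x -> exists e : oedge V, eset e x.
Hypothesis cX : compact [set: X].
Variables (sO : seq (oedge V)) (sV : seq X).
Hypothesis usO : uniq sO.
Hypothesis usV : uniq sV.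
Hypothesis sOP : forall e : oedge V, (e \in sO) = (erev e \notin sO).
Hypothesis sVP : forall x, x \in sV <-> V x.

Local Notation m := (size sO).
Local Notation k := (size sV).
Local Notation ed i := (tnth (in_tuple sO) i).
Local Notation vx j := (tnth (in_tuple sV) j).

Definition edge_chain (e : oedge V) : @simplex R X 1 -> R :=
  path_chain (seg (epar e) 0 (elen e)).

Lemma edge_chain_single (e : oedge V) : exists s : @simplex R X 1,
  edge_chain e = single s /\ forall v, s v = seg (epar e) 0 (elen e) (crd ord_max v).
Proof. exact/path_simplex/continuous_seg/epar_cont. Qed.

Lemma edge_chain_rev (K : (@simplex R X 1 -> R) -> Prop) (e : oedge V) : submodule K ->
  (forall u, boundary1 u -> K u) -> K (fun t => edge_chain (erev e) t + edge_chain e t).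
Proof.
move=> SK KB; have k1 := seg_chain KB 0 (elen e) 0 (@epar_cont _ _ _ e).
have k2 := cst_chain SK KB (epar e 0).
have E1 : seg (epar e) 0 0 = (fun=> epar e 0).
  by apply/funext => t; rewrite /seg subrr mulr0 addr0.
have E2 : seg (epar (erev e)) 0 (elen e) = seg (epar e) (elen e) 0.
  by apply/funext => t; rewrite /seg /=; congr (epar e _); ring.
rewrite E1 in k1; apply: (submodule_comb (a := 1) (b := 1) SK k1 k2) => t.
by rewrite /edge_chain /= E2; ring.
Qed.

Definition incidence : 'M[R]_(m, k) :=
  \matrix_(i, j) ((eterm (ed i) == vx j)%:R - (einit (ed i) == vx j)%:R).

(** The kernel of the transpose consists of the functions on vertices that agree at the ends of
    every edge; these are the constants, since the graph is connected. *)
Lemma rank_incidence : (\rank incidence + 1)%N = k.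
Proof.
have injV : injective (fun j => vx j) by apply/(@tuple_uniqP _ _ (in_tuple sV)).
have mem_vx x : V x -> exists j, x = vx j by move=> /sVP xV; exact/tnthP.
have [x0 Vx0] : exists x, V x.
  have [[x _] _ _] := mg; have [Vx|/HE[e _]] := pselect (V x); first by exists x.
  by exists (einit e); exact: epar_init.
have [j0 j0x] := mem_vx x0 Vx0.
pose ev (v : 'rV[R]_k) x := \sum_j v ord0 j * (x == vx j)%:R.
have evx v j : ev v (vx j) = v ord0 j.
  rewrite /ev (bigD1 j)//= eqxx mulr1 big1 ?addr0// => i ij.
  by rewrite (inj_eq injV) eq_sym (negbTE ij) mulr0.
have mulE v i : (v *m incidence^T) ord0 i = ev v (eterm (ed i)) - ev v (einit (ed i)).
  by rewrite mxE -sumrB; apply: eq_bigr => j _; rewrite !mxE mulrBr.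
have ker1 : (kermx incidence^T :=: (const_mx 1 : 'rV[R]_k))%MS.
  apply/eqmxP/andP; split; last first.
    apply/sub_kermxP/rowP => i; rewrite mulE [RHS]mxE.
    have c1 x : V x -> ev (const_mx 1) x = 1 by move=> /mem_vx[j ->]; rewrite evx mxE.
    by rewrite !c1 ?subrr//; [exact: epar_init|exact: epar_term].
  apply/rV_subP => v /sub_kermxP vM.
  have ve (e : oedge V) : ev v (einit e) = ev v (eterm e).
    have h e' : e' \in sO -> ev v (einit e') = ev v (eterm e').
      move=> /(@tnthP _ _ (in_tuple sO))[i ->]; apply/esym/eqP; rewrite -subr_eq0 -mulE vM mxE.
      by [].
    have [eO|eO] := boolP (e \in sO); first exact: h.
    have := h (erev e); rewrite einit_erev eterm_erev sOP in eO *.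
    by move: eO; rewrite negbK => eO /(_ eO).
  have vc x : V x -> ev v x = ev v x0.
    move=> Vx; apply: (vertex_connected mg vs HE (F := fun x => ev v x = ev v x0) _ Vx0 Vx) => // e <-.
    exact: esym (ve e).
  apply/sub_rVP; exists (ev v x0); apply/rowP => j; rewrite !mxE mulr1 -evx.
  by apply: vc; apply/sVP; exact: mem_tnth.
have c0 : (const_mx 1 : 'rV[R]_k) != 0.
  by apply/eqP => /rowP/(_ j0); rewrite !mxE => /eqP; rewrite oner_eq0.
have := mxrank_ker incidence^T; rewrite ker1 rank_rV c0 mxrank_tr.
have := rank_leq_col incidence; lia.
Qed.

Lemma cycle_edge_chains z : cycle1 z -> exists N : 'rV[R]_m,
  boundary1 (fun t => z t - \sum_i N ord0 i * edge_chain (ed i) t).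
Proof.
(* The submodule modulo which cycles vanish by [cycle1_submodule]: the boundaries together with the
   span of the edges. *)
pose K (u : @simplex R X 1 -> R) := exists N : 'rV[R]_m,
  boundary1 (fun t => u t - \sum_i N ord0 i * edge_chain (ed i) t).
have SB := @submodule_boundary1 R X.
have KB u : boundary1 u -> K u.
  move=> bu; exists 0; apply: (submodule_comb (a := 1) (b := 0) SB bu bu) => t.
  by rewrite big1 => [|i _]; [ring|rewrite mxE mul0r].
have SK : submodule K.
  split=> [|a b u v [N NP] [N' N'P]]; first exact/KB/SB.1.
  exists (a *: N + b *: N'); apply: (submodule_comb (a := a) (b := b) SB NP N'P) => t.
  under eq_bigr do rewrite !mxE mulrDl -!mulrA.
  by rewrite big_split /= -!mulr_sumr; ring.
have Kd i : K (edge_chain (ed i)).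
  exists (delta_mx 0 i).
  suff -> : (fun t => edge_chain (ed i) t - \sum_j (delta_mx 0 i : 'rV[R]_m) ord0 j * edge_chain (ed j) t) = (fun=> 0) by exact: SB.1.
  apply/funext => s; rewrite (bigD1 i)//= mxE !eqxx mul1r big1 ?addr0 ?subrr// => j jk.
  by rewrite mxE eqxx (negbTE jk) mul0r.
have KE (e : oedge V) : K (edge_chain e).
  have h e' : e' \in sO -> K (edge_chain e') by move=> /(@tnthP _ _ (in_tuple sO))[i ->].
  have [|eO] := boolP (e \in sO); first exact: h.
  have k1 := edge_chain_rev e SK KB; have k2 : K (edge_chain (erev e)).
    by apply: h; move: eO; rewrite sOP negbK.
  by apply: (submodule_comb (a := 1) (b := -1) SK k1 k2) => t; ring.
exact: (cycle1_submodule mg vs HE cX SK KB KE).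
Qed.

(** A cocycle takes equal values on homologous chains; on a combination of edges it is read off edge
    by edge. *)
Lemma cocycle_edge_chains (J : @simplex R X 1 -> R) z (N : 'rV[R]_m) (sx : 'I_m -> @simplex R X 1) :
  (forall s : @simplex R X 2, \sum_(i < 3) (-1) ^+ i * J (face i s) = 0) ->
  (forall i, edge_chain (ed i) = single (sx i)) -> chain z ->
  boundary1 (fun t => z t - \sum_i N ord0 i * edge_chain (ed i) t) ->
  fsum (fun s => z s * J s) = \sum_i N ord0 i * J (sx i).
Proof.
move=> cJ sE fz [b fb bE].
have h : fsum (fun t => boundary b t * J t) = 0.
  by rewrite fsum_boundary// /fsum fsbig1// => s _; rewrite cJ mulr0.
have fN i : fsupp (fun t => N ord0 i * ((t == sx i)%:R * J t)).
  exact/fsuppMr/fsuppM/fsupp_single.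
have [f1 f2] := fsum_sum (index_enum 'I_m) fN.
have E : fsum (fun s => z s * J s) = fsum (fun t => boundary b t * J t) +
    fsum (fun t => \sum_i N ord0 i * ((t == sx i)%:R * J t)).
  rewrite -fsumD//; last first.
    apply: (@fsupp_sub _ _ ([set s | z s != 0] `|` [set t | \sum_i N ord0 i * ((t == sx i)%:R * J t) != 0])).
      by rewrite finite_setU.
    move=> t /not_orP[/(@fsuppN0 _ _ z) zt /(@fsuppN0 _ _ (fun t => \sum_i N ord0 i * ((t == sx i)%:R * J t))) Nt].
    rewrite bE zt sub0r mulNr mulr_suml; apply/eqP; rewrite oppr_eq0 -[X in _ == X]Nt; apply/eqP.
    by apply: eq_bigr => i _; rewrite sE /single mulrA.
  apply: eq_fsum => t; rewrite bE mulrBl mulr_suml -[LHS]addr0 -addrA; congr (_ + _).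
  rewrite addrC -sumrB big1// => i _; rewrite sE /single; ring.
rewrite E h add0r f2; apply: eq_bigr => i _.
by rewrite fsumZ fsum_delta.
Qed.

(** A basis of the left kernel of the incidence matrix is shown to be a basis of H_1. Coboundaries
    of vertex indicators place the coefficients of a cycle in that kernel, and winding numbers
    recover each coefficient. *)
Theorem genus_formula : (genus R X + k = m + 1)%N.
Proof.
have /choice[sx sxP] : forall i, exists s : @simplex R X 1, edge_chain (ed i) = single s /\
    forall v, s v = seg (epar (ed i)) 0 (elen (ed i)) (crd ord_max v).
  by move=> i; exact: edge_chain_single.
have sE i : edge_chain (ed i) = single (sx i) by have [] := sxP i.
have [pt pt1] := @point_simplex R.
have face0 i (v : @stdsimplex R 0) : face ord0 (sx i) v = eterm (ed i).
  have vpt : crd ord0 v = 1 by have [_] := set_valP v; rewrite big_ord1.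
  rewrite /face /= (sxP i).2 crd_coface (_ : ord_max = lift ord0 ord0); last exact/val_inj.
  by rewrite liftK vpt /seg mul1r subr0 add0r.
have face1 i (v : @stdsimplex R 0) : face (lift ord0 ord0) (sx i) v = einit (ed i).
  rewrite /face /= (sxP i).2 crd_coface (_ : (ord_max : 'I_2) = lift ord0 ord0); last exact/val_inj.
  by rewrite unlift_none /seg mul0r addr0.
pose B := row_base (kermx incidence).
pose b (q : 'I_(\rank (kermx incidence))) (s : @simplex R X 1) := \sum_i B q i * edge_chain (ed i) s.
have bE (a : 'rV[R]_(\rank (kermx incidence))) s : \sum_q a ord0 q * b q s = \sum_i (a *m B) ord0 i * edge_chain (ed i) s.
  under [RHS]eq_bigr do rewrite mxE mulr_suml.
  rewrite exchange_big /=; apply: eq_bigr => q _; rewrite mulr_sumr; apply: eq_bigr => i _.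
  by rewrite mulrA.
have fb (c : 'I_m -> R) : fsupp (fun s => \sum_i c i * edge_chain (ed i) s).
  by apply: (fsum_sum (index_enum 'I_m) _).1 => i; apply: fsuppMr; rewrite sE; exact: fsupp_single.
have hb : H1_basis b.
  split=> [q|z cz].
    split=> [|t]; first exact: fb.
    have := fsum_boundary (fun t' => (t' == t)%:R) (fb (B q)).
    rewrite (eq_fsum (G := fun t' => (t' == t)%:R * boundary (b q) t')); last by move=> s; rewrite mulrC.
    rewrite fsum_delta => ->.
    pose F s := \sum_(i < 2) (-1) ^+ i * (face i s == t)%:R : R.
    have fi i : fsupp (fun s => B q i * ((s == sx i)%:R * F s)) by exact/fsuppMr/fsuppM/fsupp_single.
    rewrite (eq_fsum (G := fun s => \sum_i B q i * ((s == sx i)%:R * F s))); last first.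
      by move=> s; rewrite mulr_suml; apply: eq_bigr => i _; rewrite sE /single mulrA.
    rewrite (fsum_sum _ fi).2; under eq_bigr do rewrite fsumZ fsum_delta.
    have F1 i : F (sx i) = (eterm (ed i) == t pt)%:R - (einit (ed i) == t pt)%:R.
      have tE (s : @simplex R X 0) x : (forall v, s v = x) -> (s == t) = (x == t pt).
        move=> sx0; apply/eqP/eqP => [<-|h]; first by rewrite sx0.
        apply/continuousEP => v; rewrite sx0 h; congr (t _).
        apply: val_inj; apply/rowP => i0; rewrite (ord1 i0).
        have vpt : crd ord0 v = 1 by have [_] := set_valP v; rewrite big_ord1.
        exact: etrans pt1 (esym vpt).
      rewrite /F !big_ord_recl big_ord0 /bump /= (tE _ _ (face0 i)) (tE _ _ (face1 i)); ring.
    under eq_bigr do rewrite F1.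
    have [Vt|nVt] := pselect (V (t pt)); last first.
      rewrite big1// => i _; have /eqP/negbTE -> : eterm (ed i) <> t pt by move=> h; apply: nVt; rewrite -h; exact: epar_term.
      have /eqP/negbTE -> : einit (ed i) <> t pt by move=> h; apply: nVt; rewrite -h; exact: epar_init.
      by rewrite subrr mulr0.
    have [j jE] : exists j, t pt = vx j by apply/tnthP/sVP.
    have BM : B *m incidence = 0 by apply/sub_kermxP; rewrite eq_row_base.
    have := congr1 (fun M : 'M[R]_(_, _) => M q j) BM; rewrite !mxE => BMqj.
    apply: etrans BMqj; by apply: eq_bigr => i _; rewrite [incidence _ _]mxE jE.
  have [N NP] := cycle_edge_chains cz; have [fz dz] := cz.
  have NM : (N <= B)%MS.
    rewrite eq_row_base; apply/sub_kermxP/rowP => j; rewrite [RHS]mxE.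
    (* The indicator of a vertex; its coboundary vanishes on [z] and takes the entries of a column
       of the incidence matrix on the edges. *)
    pose phi (s : @simplex R X 0) : R := (s pt == vx j)%:R.
    have := cocycle_edge_chains (J := fun s => \sum_(i < 2) (-1) ^+ i * phi (face i s)) (coboundary_cocycle phi) sE fz NP.
    rewrite -fsum_boundary// (eq_fsum (G := fun=> 0)); last by move=> s; rewrite dz mul0r.
    rewrite /fsum fsbig1// => h; rewrite mxE; apply: etrans (esym h); apply: eq_bigr => i _; congr (_ * _).
    by rewrite !big_ord_recl big_ord0 /bump /= /phi face0 face1 [incidence _ _]mxE; ring.
  have [a aE] := submxP NM; exists a; split.
    suff -> : (fun s => z s - \sum_q a ord0 q * b q s) = (fun t => z t - \sum_i N ord0 i * edge_chain (ed i) t) by [].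
    by apply/funext => s; rewrite bE aE.
  move=> a' a'P; have : row_free B := row_base_free _.
  move=> /row_free_inj; apply; rewrite -aE; apply/rowP => i.
  (* Winding along the edge of index [i] extracts the coefficient of index [i], so equal classes
     have equal coefficients. *)
  have [J [cJ Je]] := edge_cocycle mg vs HE cX (ed i).
  have Js i' : J (sx i') = (i' == i)%:R.
    have injO : injective (fun i => ed i) by apply/(@tuple_uniqP _ _ (in_tuple sO)).
    rewrite (Je _ _ (sxP i').2) /edge_sign (inj_eq injO).
    have : ed i' \in sO by exact: mem_tnth.
    case: (eqVneq (ed i') (erev (ed i))) => [->|_]; last by rewrite subr0.
    by rewrite sOP erevK mem_tnth.
  have sumJ (N' : 'rV[R]_m) : \sum_i0 N' ord0 i0 * J (sx i0) = N' ord0 i.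
    rewrite (bigD1 i)//= Js eqxx mulr1 big1 ?addr0// => i' h.
    by rewrite Js (negbTE h) mulr0.
  have h1 := cocycle_edge_chains cJ sE fz NP.
  have h2 := cocycle_edge_chains (N := a' *m B) cJ sE fz.
  rewrite -sumJ -h1 h2 ?sumJ//.
  suff -> : (fun t => z t - \sum_i (a' *m B) ord0 i * edge_chain (ed i) t) = (fun s => z s - \sum_q a' ord0 q * b q s) by [].
  by apply/funext => s; rewrite bE.
rewrite (genusE hb) mxrank_ker.
have := rank_incidence; have := rank_leq_row incidence; lia.
Qed.

End Genus.

(** * The measure of the base *)

Section ModelOrientation.
Context {R : realType} {X : metricType R} {V : set X}.

(** [choose] depends only on the pair formed by an edge and its reverse, so the edges equal to their
    representative form an orientation. *)
Definition edge_rep (e : oedge V) : oedge V := choose (pred2 e (erev e)) e.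

Lemma edge_rep_rev e : edge_rep (erev e) = edge_rep e.
Proof.
rewrite /edge_rep erevK (@eq_choose _ _ (pred2 e (erev e))); last by move=> e'; rewrite /= orbC.
by apply: choose_id; rewrite /= eqxx ?orbT.
Qed.

Lemma edge_rep_orientation (e : oedge V) : (edge_rep e == e) = (edge_rep (erev e) != erev e).
Proof.
rewrite edge_rep_rev; have : pred2 e (erev e) (edge_rep e) by apply: chooseP; rewrite /= eqxx.
have en : (e == erev e) = false by apply/eqP => /esym/erev_neq.
by move=> /orP[/eqP ->|/eqP ->]; rewrite ?eqxx ?en// eq_sym en.
Qed.

Lemma sum_edges (s : seq (oedge V)) (F : oedge V -> R) : uniq s -> (forall e, e \in s) ->
  (forall e, F (erev e) = F e) ->
  \sum_(e <- s) F e = 2 * \sum_(e <- s | edge_rep e == e) F e.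
Proof.
move=> us sP Fr; rewrite (bigID (fun e => edge_rep e == e)) /=.
have -> : \sum_(e <- s | edge_rep e != e) F e = \sum_(e <- s | edge_rep e == e) F e.
  have ps : perm_eq s (map (@erev _ _ _) s).
    apply: uniq_perm => //; first by rewrite map_inj_uniq//; exact: inv_inj (@erevK _ _ _).
    by move=> e; rewrite sP; apply/esym/mapP; exists (erev e); rewrite ?erevK.
  rewrite (perm_big _ ps) big_map; apply: eq_big => [e|e _]; last exact: Fr.
  by rewrite [RHS]edge_rep_orientation.
by ring.
Qed.

End ModelOrientation.

Section ModelMeasure.
Context {R : realType} {X : pmetricType R} {V : set X}.
Hypothesis mg : metric_graph X.
Hypothesis vs : vertex_set V.
Hypothesis HE : forall x, ~ V x -> exists e : oedge V, eset e x.
Variable mu : borel_measure X.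

Lemma eset_rev (e : oedge V) : eset (erev e) = eset e.
Proof. by rewrite /eset /= rev_image. Qed.

Lemma open_eset (e : oedge V) : open (eset e).
Proof.
apply/open_mdist => x [t /=]; rewrite in_itv /= => tI <-.
have [r [[r0 rt rl] [_ rP]]] := oedge_local mg vs tI; exists r => // y /rP[s].
rewrite ltr_norml => /andP[s1 s2] ->; exists s => //=; rewrite in_itv /=.
by apply/andP; split; lra.
Qed.

Lemma open_not_vertex : open (~` V).
Proof.
apply/open_mdist => x /= /(vertex_set_closed_near mg vs)[r r0 rP].
by exists r.
Qed.

Lemma measurable_open (U : set (g_sigma_algebraType (@open X))) : open (U : set X) -> measurable U.
Proof. by move=> oU; exact: sub_sigma_algebra. Qed.

Lemma measure_edges (s : seq (oedge V)) : uniq s -> (forall e, e \in s -> erev e \notin s) ->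
  measurable ([set x | exists2 e, e \in s & eset e x] : set (g_sigma_algebraType (@open X))) /\
  mu [set x | exists2 e, e \in s & eset e x] = (\sum_(e <- s) mu (eset e))%E.
Proof.
elim: s => [_ _|e s IH /= /andP[es us] sr].
  have -> : [set x : X | exists2 e : oedge V, e \in [::] & eset e x] = set0.
    by apply/seteqP; split=> // x [].
  by rewrite big_nil measure0; split=> //; exact: measurable0.
have [|m1 m2] := IH us.
  by move=> e' h; have := sr e'; rewrite !inE h orbT => /(_ isT); rewrite negb_or => /andP[].
have -> : [set x : X | exists2 e0 : oedge V, e0 \in e :: s & eset e0 x] =
    eset e `|` [set x | exists2 e0, e0 \in s & eset e0 x].
  apply/seteqP; split=> [x [e0]|x [ex|[e0 h ex]]].
  - by rewrite inE => /predU1P[->|h] ex; [left|right; exists e0].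
  - by exists e => //; rewrite mem_head.
  - by exists e0 => //; rewrite inE h orbT.
have me : measurable (eset e : set (g_sigma_algebraType (@open X))).
  by apply: measurable_open; exact: open_eset.
split; first exact: measurableU.
rewrite big_cons measureU//; first by congr (_ + _)%E.
apply/seteqP; split=> // x [[t + tx] [e0 e0s [t0 + t0x]]].
rewrite /= !in_itv /= => tI t0I.
have [[ee _]|[ee _]] := oedge_eq tI t0I (etrans tx (esym t0x)).
  by move: es; rewrite ee e0s.
by have := sr e0; rewrite inE e0s orbT => /(_ isT); rewrite -ee mem_head.
Qed.

Lemma measure_model (s : seq (oedge V)) : uniq s ->
  (forall e, (e \in s) = (erev e \notin s)) -> mu V = 0%E ->
  mu [set: X] = (\sum_(e <- s) mu (eset e))%E.
Proof.
move=> us sr V0; have [|m1 <-] := @measure_edges s us; first by move=> e; rewrite sr.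
have mV : measurable (V : set (g_sigma_algebraType (@open X))).
  by rewrite -[V]setCK; apply: measurableC; apply: measurable_open; exact: open_not_vertex.
have -> : [set: X] = V `|` [set x | exists2 e, e \in s & eset e x].
  apply/esym/seteqP; split=> // x _; have [Vx|nVx] := pselect (V x); first by left.
  right; have [e ex] := HE nVx; have [es|es] := boolP (e \in s); first by exists e.
  by exists (erev e); [rewrite sr erevK|rewrite eset_rev].
rewrite measureU//; first by rewrite [X in (X + _)%E]V0 add0e.
apply/seteqP; split=> // x [Vx [e _ [t /=]]].
by rewrite in_itv /= => tI tx; apply: (epar_notV tI); rewrite tx.
Qed.

End ModelMeasure.

(* [Gamma] is the base, [Gamma'] the cover, [mu'] the canonical measure of
   [Gamma'] and [mu] its pushdown to [Gamma]. *)
Theorem theoremB (R : realType) (Gamma Gamma' : pmetricType R)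
    (phi : Gamma' -> Gamma)
    (mu' : borel_measure Gamma') (mu : borel_measure Gamma) :
  metric_graph Gamma -> compact [set: Gamma] ->
  metric_graph Gamma' ->
  galois_covering phi -> infinite_fibers phi ->
  canonical_measure mu' -> pushdown phi mu' mu ->
  mu [set: Gamma] = ((genus R Gamma)%:R - 1)%:E /\
  (genus R Gamma)%:R - 1 = - (euler_char R Gamma)%:~R :> R.
Proof.
move=> mgX cX mgY [cov gal] inf can [V [vs V0 push]]; split; last first.
  by rewrite /euler_char intrD rmorphN /= opprD opprK addrC.
have HE x : ~ V x -> exists e : oedge V, eset e x by exact: oedge_exists mgX vs x cX.
have [T [lam CS]] := covering_system_exists cX mgX cov.
have [sV0 [sE0 [sV0P sE0P]]] := finite_model mgX vs HE cX.
pose sV := undup [seq x <- sV0 | `[< V x >]]; pose sE := undup sE0.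
have usE : uniq sE by exact: undup_uniq.
have usV : uniq sV by exact: undup_uniq.
have sEP (e : oedge V) : e \in sE by rewrite mem_undup.
have sVP x : x \in sV <-> V x.
  rewrite mem_undup mem_filter; split=> [/andP[/asboolP//]|Vx].
  by rewrite sV0P// andbT; exact/asboolP.
pose sO := [seq e <- sE | edge_rep e == e].
have usO : uniq sO by exact: filter_uniq.
have sOP (e : oedge V) : (e \in sO) = (erev e \notin sO).
  by rewrite !mem_filter !sEP !andbT edge_rep_orientation.
have /choice[b bP] := edge_lift_base CS mgX vs HE.
have brev e' : b (erev e') = erev (b e').
  by apply: edge_lift_inj (bP _) (edge_lift_rev (bP e')).
have /choice[lf lfP] : forall e : oedge V, exists e' : oedge (phi @^-1` V), edge_lift e' e.
  move=> e; have /infinite_setN0[y ye] := @inf (einit e).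
  by have [e' []] := elift_oedge_exists CS mgX vs HE ye; exists e'.
(* The orientation of the base is pulled back to the cover. *)
pose O' : set (oedge (phi @^-1` V)) := [set e' | edge_rep (b e') == b e'].
have OO' : orientation O'.
  by move=> e'; rewrite /O' /= brev edge_rep_orientation; split=> [/negP//|/negP].
have vs' := preimage_vertex_set CS mgX vs HE.
pose F e := dens (harm_proj O' (dform (lf e))) (lf e).
have muF e : mu (eset e) = (F e)%:E.
  have [_ /(_ _ (lfP e)) ->] := push e.
  by have [_ /(_ (lf e))[_ ->]] := can _ O' vs' OO'.
have Frev e : F (erev e) = F e by apply: EFin_inj; rewrite -!muF eset_rev.
have tr := trace_harm_proj CS mgX mgY vs HE gal inf usE usV sEP sVP OO' lfP.
(* The trace runs over both orientations, the measure over one; [F] does not see the orientation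
   because both have the same support. Likewise [size sE] is twice [size sO]. *)
have S1 := sum_edges usE sEP Frev.
have S2 := @sum_edges _ _ _ sE (fun=> 1) usE sEP (fun=> erefl).
have gen := genus_formula mgX vs HE cX usO usV sOP sVP.
rewrite (measure_model mgX vs HE usO sOP V0).
under eq_bigr do rewrite muF.
rewrite sumEFin; congr (_%:E).
rewrite -/(F _) in tr; move: tr S1; rewrite -[LHS]/(\sum_(e <- sE) F e) => -> S1.
have cnt (I : Type) (s : seq I) : \sum_(i <- s) 1 = (size s)%:R :> R.
  by rewrite big_const_seq count_predT iter_addr_0.
have e1 : \sum_(e <- sE | edge_rep e == e) F e = \sum_(e <- sO) F e by rewrite big_filter.
have e2 : \sum_(e <- sE | edge_rep e == e) (1 : R) = (size sO)%:R by rewrite -big_filter cnt.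
rewrite e1 in S1; rewrite e2 cnt in S2.
have : (genus R Gamma)%:R + (size sV)%:R = (size sO)%:R + 1 :> R.
  by rewrite -natrD gen natrD.
by move: S1 S2; lra.
Qed.
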